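(* There is an absolute constant $c>0$ such that the following holds. Let $L(z,y)$ be a real-valued loss function on $\mathbb R^C\times Y$ such that, for every $y$, the map $z\mapsto L(z,y)$ is $\ell$-Lipschitz and $\beta$-smooth, and such that $L(0,y)$ is independent of $y$. Let $D$ be a distribution over $X\times Y$ and let $S=\{(x_i,y_i)\}_{i=1}^n\sim D^n$. Let $\mathcal H=\{h_w:w\in\mathbb R^m\}$ be a class of functions $h_w:X\to\mathbb R^C$ such that for every $w$ there exists $a_w>0$ with $\|h_w(x)\|\le a_w$ for all $x\in X$. Let $\Theta:=\{\overline w\in\mathbb R^m:\|\overline w\|_2\le R\}$ and fix $\sigma>0$. For each $\overline w\in\Theta$ define $Q:=\mathcal N(\overline w,\sigma^2I_m)$. Assume that the regularity hypotheses $\mathrm{Reg}(\sigma)$ stated in the context hold, and assume moreover that there exists $B>0$ such that, for all $(x,y)$ and all $\overline w\in\Theta$, $$\big|\operatorname{Jen}_Q[L(h_w(x),y)]\big|\le\sigma^2B.$$ Let $P$ be any prior distribution on $\mathbb R^m$, let $\delta\in(0,1]$, and let $\lambda>0$. Then, with probability at least $1-\delta$ over $S\sim D^n$, we have uniformly for all $\overline w\in\Theta$, $$\begin{aligned}L_D(h_{\overline w})\le{}&L_S(h_{\overline w})+2c\,\frac{R\sigma}{\sqrt n}\sqrt{\beta^2J_{S,\sigma}+\ell^2H_{S,\sigma}}+8\sigma^2B\sqrt{\frac{2\ln(8/\delta)}{n}}\\&+\frac1\lambda\Bigg[D_{\mathrm{KL}}(Q\|P)+\ln\bigg(\frac2\delta\,\mathbb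 E_{w\sim P}\exp\Big(\frac{\lambda^2\ell^2a_w^2}{2n}\Big)\bigg)\Bigg],\end{aligned}$$ where $J_{S,\sigma}$ and $H_{S,\sigma}$ are the sample-dependent quantities defined in the context.
   Context: $L_D(h):=\mathbb E_{(x,y)\sim D}[L(h(x),y)]$ and $L_S(h):=\frac1n\sum_{i=1}^nL(h(x_i),y_i)$. A map $z\mapsto L(z,y)$ is $\beta$-smooth if it is differentiable with $\beta$-Lipschitz gradient (Euclidean norm). The Jensen gap of $f$ with respect to a distribution $Q$ on $\mathbb R^m$ is $\operatorname{Jen}_Q[f(w)]:=f(\mathbb E_{w\sim Q}[w])-\mathbb E_{w\sim Q}[f(w)]$. $D_{\mathrm{KL}}$ is the Kullback–Leibler divergence. Hypotheses $\mathrm{Reg}(\sigma)$, with $u\sim\mathcal N(0,I_m)$, for the (arbitrary) sample $S$ and each $i\in\{1,\dots,n\}$: the map $w\mapsto h_w(x_i)$ is twice continuously differentiable on $\mathbb R^m$; the Gaussian expectations below and $\mathbb E_u[L(h_{w+\sigma u}(x_i),y_i)]$ are finite, and the latter may be differentiated in $w$ under the expectation sign. Write $J_i(w):=\nabla_wh_w(x_i)\in\mathbb R^{C\times m}$ and $H_{i,k}(w):=\nabla_w^2(h_w(x_i))_k\in\mathbb R^{m\times m}$. There exist sample-dependent matrices $G_i\succeq0$ with $J_i(w)^\top J_i(w)\preceq G_i$ for all $w\in\Theta$. The quantity $$A_{i,\sigma}:=\sup_{w\in\Theta}\int_0^1\mathbb E_u\big[u^\top J_i(w+t\sigma u)^\top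 J_i(w+t\sigma u)u\big]dt$$ is finite. There exist sample-dependent matrices $B_{i,\sigma}\succeq0$ such that for all $w\in\Theta$, $$\int_0^1\mathbb E_u\Big[\sum_{k=1}^CH_{i,k}(w+t\sigma u)^\top uu^\top H_{i,k}(w+t\sigma u)\Big]dt\preceq B_{i,\sigma}.$$ Define $J_{S,\sigma}:=\frac1n\sum_{i=1}^nA_{i,\sigma}\operatorname{Trace}(G_i)$ and $H_{S,\sigma}:=\frac1n\sum_{i=1}^n\operatorname{Trace}(B_{i,\sigma})$. *)

(* Defs.v *)
From HB Require Import structures.
From mathcomp Require Export all_boot all_order all_algebra.
From mathcomp Require Export all_classical all_reals all_analysis.

Set Implicit Arguments.
Unset Strict Implicit.
Unset Printing Implicit Defensive.

Export Order.TTheory GRing.Theory Num.Theory.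
Export numFieldNormedType.Exports.

Local Open Scope classical_set_scope.
Local Open Scope ring_scope.
Local Open Scope charge_scope.

(* The library norm `|v| on 'rV[R]_n is the sup norm, hence enorm. *)
Definition enorm (R : realType) (n : nat) (v : 'rV[R]_n) : R :=
  Num.sqrt (\sum_(i < n) v 0 i ^+ 2).

Definition eball (R : realType) (n : nat) (r : R) : set 'rV[R]_n :=
  [set v | enorm v <= r].

Definition gradient (R : realType) (n : nat) (f : 'rV[R]_n -> R)
    (w : 'rV[R]_n) : 'rV[R]_n :=
  \row_j 'D_(delta_mx 0 j) f w.

Definition hessian (R : realType) (n : nat) (f : 'rV[R]_n -> R)
    (w : 'rV[R]_n) : 'M[R]_n :=
  'J (gradient f) w.

Definition lipschitz_fun (R : realType) (n : nat) (l : R)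
    (f : 'rV[R]_n -> R) : Prop :=
  forall z z', `|f z - f z'| <= l * enorm (z - z').

Definition smooth_fun (R : realType) (n : nat) (beta : R)
    (f : 'rV[R]_n -> R) : Prop :=
  (forall z, differentiable f z) /\
  (forall z z', enorm (gradient f z - gradient f z') <= beta * enorm (z - z')).

Definition twice_continuously_differentiable (R : realType) (m C : nat)
    (f : 'rV[R]_m -> 'rV[R]_C) : Prop :=
  (forall w, differentiable f w) /\
  (forall k : 'I_C,
    (forall w, differentiable (gradient (fun v => f v 0 k)) w) /\
    continuous (hessian (fun v => f v 0 k))).

Definition psd (R : realType) (n : nat) (A : 'M[R]_n) : Prop :=
  A^T = A /\ forall v : 'rV[R]_n, 0 <= (v *m A *m v^T) 0 0.

Definition loewner_le (R : realType) (n : nat) (A B : 'M[R]_n) : Prop :=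
  psd (B - A).

(* Product sigma-algebra on 'rV[R]_n, i.e. its Borel sigma-algebra. *)
Definition measure_rV_display : measure_display.
Proof. exact. Qed.

Section measurable_rV.
Variables (R : realType) (n : nat).

Let coors : 'I_n -> 'rV[R]_n -> R := fun i v => v 0 i.

HB.instance Definition _ := @isMeasurable.Build measure_rV_display
  'rV[R]_n (g_sigma_preimage coors)
  (@sigma_algebra0 _ setT _) (@sigma_algebraC _ _)
  (@sigma_algebra_bigcup _ setT _).

End measurable_rV.

Lemma measurable_fun_rV d (T : measurableType d) (R : realType) (n : nat)
    (f : T -> 'rV[R]_n) :
  (forall i, measurable_fun setT (fun t => f t 0 i)) -> measurable_fun setT f.
Proof.
move=> mf; apply: (@measurability _ _ _ _ setT f
  (\big[setU/set0]_(i < n) preimage_set_system setT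
     (fun v : 'rV[R]_n => v 0 i) measurable)) => //.
move=> _ [A + <-]; rewrite -bigcup_seq => -[i /= _ [B mB <-]].
by have := mf i measurableT _ mB; rewrite !setTI.
Qed.

Section iid.
Context d (T : measurableType d) (R : realType) (D : probability T R).

Definition tuple_cons (n : nat) (p : T * n.-tuple T) : n.+1.-tuple T :=
  [tuple of p.1 :: p.2].

Lemma measurable_tuple_cons (n : nat) : measurable_fun setT (@tuple_cons n).
Proof. exact: measurable_cons. Qed.

HB.instance Definition _ (n : nat) := @isMeasurableFun.Build _ _ _ _
  (@tuple_cons n) (@measurable_tuple_cons n).

(* The n-fold product measure D^n. *)
Fixpoint iid (n : nat) : probability (n.-tuple T) R :=
  match n return probability (n.-tuple T) R with
  | 0 => \d_([tuple])
  | n'.+1 => distribution (D \x iid n')%E (@tuple_cons n')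
  end.

End iid.

Section gaussian.
Variables (R : realType) (n : nat).

(* measurableTypeR R is R with its Borel sigma-algebra, under the display that
   the library uses for measures on R such as normal_prob. *)
Definition gaussian_map (w : 'rV[R]_n) (s : R)
    (t : n.-tuple (measurableTypeR R)) : 'rV[R]_n :=
  w + s *: \row_i tnth t i.

Lemma measurable_gaussian_map w s : measurable_fun setT (gaussian_map w s).
Proof.
apply: measurable_fun_rV => i.
have mid : measurable_fun setT (idfun : measurableTypeR R -> R).
  by move=> _ A mA; rewrite setTI.
rewrite (_ : (fun t => _) =
    fun t : n.-tuple (measurableTypeR R) => w 0 i + s * (tnth t i : R)).
  apply: measurable_realfun.measurable_funD => //.
  apply: measurable_realfun.measurable_funM => //.
  by apply: (measurableT_comp mid); exact: measurable_tnth.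
by apply/funext => t; rewrite !mxE.
Qed.

HB.instance Definition _ w s := @isMeasurableFun.Build _ _ _ _
  (gaussian_map w s) (measurable_gaussian_map w s).

(* N(w, s^2 I_n), as the law of w + s u with u having i.i.d. standard normal
   coordinates. *)
Definition gaussian (w : 'rV[R]_n) (s : R) : probability 'rV[R]_n R :=
  distribution (iid (normal_prob 0 1 : probability (measurableTypeR R) R) n) (gaussian_map w s).

Definition std_gaussian : probability 'rV[R]_n R := gaussian 0 1.

Definition mean (Q : probability 'rV[R]_n R) : 'rV[R]_n :=
  \row_j \int[Q]_w (w 0 j).

Definition jensen_gap (Q : probability 'rV[R]_n R) (f : 'rV[R]_n -> R) : R :=
  f (mean Q) - \int[Q]_w f w.

End gaussian.

Definition KL d (T : measurableType d) (R : realType) (Q P : probability T R)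
    : \bar R :=
  if `[< Q `<< P >] then
    (\int[Q]_x lne ('d (charge_of_finite_measure Q) '/d P x))%E
  else +oo%E.

Section risk.
Context dX dY (X : measurableType dX) (Y : measurableType dY) (R : realType).
Variables (m C n : nat) (L : 'rV[R]_C -> Y -> R) (h : 'rV[R]_m -> X -> 'rV[R]_C).

Definition risk (D : probability (X * Y)%type R) (w : 'rV[R]_m) : R :=
  \int[D]_z L (h w z.1) z.2.

Definition emp_risk (S : n.-tuple (X * Y)) (w : 'rV[R]_m) : R :=
  n%:R^-1 * \sum_(i < n) L (h w (tnth S i).1) (tnth S i).2.

(* Vectors are rows, so 'J is the transpose of the usual C x m Jacobian and a
   column vector u is written u^T. *)
Definition jac (x : X) (w : 'rV[R]_m) : 'M[R]_(C, m) := ('J (h^~ x) w)^T.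

Definition hess (x : X) (k : 'I_C) (w : 'rV[R]_m) : 'M[R]_m :=
  hessian (fun v => h v x 0 k) w.

Definition jac_form (x : X) (w u : 'rV[R]_m) : R :=
  (u *m (jac x w)^T *m jac x w *m u^T) 0 0.

Definition hess_form (x : X) (w u : 'rV[R]_m) : 'M[R]_m :=
  \sum_(k < C) (hess x k w)^T *m u^T *m u *m hess x k w.

Variables (sigma : R) (Theta : set 'rV[R]_m).

Definition jac_sup (x : X) : \bar R :=
  ereal_sup [set (\int[lebesgue_measure]_(t in `[0%R, 1%R])
    \int[std_gaussian R m]_u (jac_form x (w + (t * sigma) *: u) u)%:E)%E
    | w in Theta].

Definition hess_mean_at (x : X) (w : 'rV[R]_m) (t : R) : 'M[R]_m :=
  \matrix_(a, b)
    \int[std_gaussian R m]_u hess_form x (w + (t * sigma) *: u) u a b.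

Definition hess_mean (x : X) (w : 'rV[R]_m) : 'M[R]_m :=
  \matrix_(a, b) \int[lebesgue_measure]_(t in `[0, 1]) hess_mean_at x w t a b.

Definition loss_at (z : X * Y) (w : 'rV[R]_m) : R := L (h w z.1) z.2.

Definition smoothed_loss_at (z : X * Y) (w : 'rV[R]_m) : R :=
  \int[std_gaussian R m]_u loss_at z (w + sigma *: u).

(* G and B are the matrices G_i and B_(i,sigma) attached to the sample S.  The
   integrability fields say that the (real-valued) integrals are meaningful. *)
Record Reg (S : n.-tuple (X * Y)) (G B : 'I_n -> 'M[R]_m) : Prop := {
  reg_C2 : forall i, twice_continuously_differentiable (h^~ (tnth S i).1) ;
  reg_jac_integrable : forall i w t, Theta w -> 0 <= t <= 1 ->
    (std_gaussian R m).-integrable setT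
      (fun u => (jac_form (tnth S i).1 (w + (t * sigma) *: u) u)%:E) ;
  reg_hess_integrable : forall i w t a b, Theta w -> 0 <= t <= 1 ->
    (std_gaussian R m).-integrable setT
      (fun u => (hess_form (tnth S i).1 (w + (t * sigma) *: u) u a b)%:E) ;
  reg_hess_mean_integrable : forall i w a b, Theta w ->
    lebesgue_measure.-integrable `[0%R, 1%R]
      (fun t : R => (hess_mean_at (tnth S i).1 w t a b)%:E) ;
  reg_loss_integrable : forall i w, Theta w -> \forall v \near w,
    (std_gaussian R m).-integrable setT
      (fun u => (loss_at (tnth S i) (v + sigma *: u))%:E) ;
  reg_grad_integrable : forall i w j, Theta w ->
    (std_gaussian R m).-integrable setT
      (fun u => (gradient (loss_at (tnth S i)) (w + sigma *: u) 0 j)%:E) ;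
  reg_smoothed_differentiable : forall i w, Theta w ->
    differentiable (smoothed_loss_at (tnth S i)) w ;
  reg_diff_under_expectation : forall i w, Theta w ->
    gradient (smoothed_loss_at (tnth S i)) w =
    \row_j \int[std_gaussian R m]_u
      gradient (loss_at (tnth S i)) (w + sigma *: u) 0 j ;
  reg_G_psd : forall i, psd (G i) ;
  reg_G_dom : forall i w, Theta w ->
    loewner_le ((jac (tnth S i).1 w)^T *m jac (tnth S i).1 w) (G i) ;
  reg_jac_sup_fin : forall i, jac_sup (tnth S i).1 \is a fin_num ;
  reg_B_psd : forall i, psd (B i) ;
  reg_B_dom : forall i w, Theta w ->
    loewner_le (hess_mean (tnth S i).1 w) (B i)
}.

Definition J_S (S : n.-tuple (X * Y)) (G : 'I_n -> 'M[R]_m) : R :=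
  n%:R^-1 * \sum_(i < n) fine (jac_sup (tnth S i).1) * \tr (G i).

Definition H_S (B : 'I_n -> 'M[R]_m) : R :=
  n%:R^-1 * \sum_(i < n) \tr (B i).

End risk.

(* Main.v *)
(* Let g_w(z) be the loss of h_w at z minus its average over Q = N(w, sigma^2 I).
   By Fubini, the generalization gap of h_w is the Q-average of the generalization
   gap plus the deviation of the empirical mean of g_w from its expectation.  The
   first term is bounded by the PAC-Bayes theorem: Donsker-Varadhan, Hoeffding's
   lemma and Markov's inequality.

   For the second, |g_w| <= sigma^2 Bjen, so the bounded differences inequality and
   symmetrization bound the supremum over w by an empirical Rademacher average
   (the supremum runs over a dense sequence, which makes it measurable).  On a line,
   the derivative of g_w(z_i) in the direction v is E <v, grad loss(w) - grad
   loss(w + sigma u)>; splitting off the increments of h and of its derivative,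
   written as integrals along the segment from w to w + sigma u, bounds its square by
   2 sigma^2 (beta^2 A_i v G_i v^T + ell^2 v B_i v^T).  Hence
   (g_w - g_w')^2 is at most a quadratic form in w - w', that is, a sum of squares of
   linear functionals, and Maurer's vector contraction replaces g_w by these linear
   functionals, whose Rademacher average over the ball of radius R is at most
   R times the square root of the total trace. *)
From HB Require Import structures.
Require Import Defs.
From mathcomp Require Import ring lra measurable_realfun.
Local Open Scope classical_set_scope.
Local Open Scope ring_scope.

Set Implicit Arguments.
Unset Strict Implicit.
Unset Printing Implicit Defensive.

(** * Rademacher averages and vector contraction *)

(** The bound a_w is finite for each w but unbounded in w, so losses need not be Q-integrable a
    priori. If the divergence or the prior moment is infinite, so is the right-hand side. Otherwise
    Donsker-Varadhan, applied to the Hoeffding exponent itself, makes a_w^2 integrable under Q, and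
    this licenses Fubini. The complexity must be that of the observed sample, not its expectation.
    The bounded differences inequality is therefore applied once, to the supremum minus the
    empirical Rademacher average, whose mean is nonpositive by symmetrization; the price is a
    difference constant 2 + 4 = 6 times the bound on a summand. Sign averages are defined by
    recursion with an offset function. No measure on sign vectors is needed, and every induction
    treats the terms already signed as part of the offset. Symmetrization costs a factor 2,
    contraction a factor 2 (the Khintchine constant used) and the derivative bound a factor sqrt 2.
    Their product sqrt 32 is rounded up to 6 = 2 c, so c = 3. Each of the two events fails with
    probability at most delta / 2. *)

Section rademacher.
Variable R : realType.
Implicit Types (a b g : nat -> R) (gs us vs : seq (nat -> R)).

Definition bdd a := exists M, forall k, `|a k| <= M.

Definition bdds gs := foldr (fun g P => bdd g /\ P) True gs.

(* Average over all signs e of the supremum of a + sum_i e_i g_i. *)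
Fixpoint rad gs a : R :=
  if gs is g :: gs' then (rad gs' (a \+ g) + rad gs' (a \- g)) / 2
  else sup (range a).

Lemma bddD a b : bdd a -> bdd b -> bdd (a \+ b).
Proof.
move=> [M aM] [N bN]; exists (M + N) => k.
by rewrite (le_trans (ler_normD _ _))// lerD.
Qed.

Lemma bddB a b : bdd a -> bdd b -> bdd (a \- b).
Proof.
move=> [M aM] [N bN]; exists (M + N) => k.
by rewrite (le_trans (ler_normB _ _))// lerD.
Qed.

Lemma bdds_cat us vs : bdds (us ++ vs) <-> bdds us /\ bdds vs.
Proof. by elim: us => [|u us IH] /=; [tauto|rewrite IH; tauto]. Qed.

Lemma le_sup_range a k : bdd a -> a k <= sup (range a).
Proof.
move=> [M aM]; apply: ub_le_sup; last by exists k.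
by exists M => _ [j _ <-]; rewrite (le_trans (ler_norm _)).
Qed.

Lemma sup_range_le a M : (forall k, a k <= M) -> sup (range a) <= M.
Proof. by move=> aM; apply: ge_sup; [exists (a 0), 0|move=> _ [j _ <-]]. Qed.

(** A change in one of the functions becomes a change in the offset once its sign is fixed. This
    stability in the offset therefore yields the bounded differences of the Rademacher average. *)
Lemma le_rad gs a b e : bdds gs -> bdd b -> (forall k, a k <= b k + e) ->
  rad gs a <= rad gs b + e.
Proof.
elim: gs a b => [|g gs IH] a b /=.
  move=> _ bb ab; apply: sup_range_le => k; rewrite (le_trans (ab k))// lerD2r.
  exact: le_sup_range.
move=> [bg bgs] bb ab.
have h1 : rad gs (a \+ g) <= rad gs (b \+ g) + e.
  by apply: IH => //; [exact: bddD|move=> k /=; have := ab k; lra].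
have h2 : rad gs (a \- g) <= rad gs (b \- g) + e.
  by apply: IH => //; [exact: bddB|move=> k /=; have := ab k; lra].
lra.
Qed.

Lemma addf_comm a b g : (a \+ b) \+ g = (a \+ g) \+ b.
Proof. by apply/funext => k /=; ring. Qed.

Lemma addfB_comm a b g : (a \+ b) \- g = (a \- g) \+ b.
Proof. by apply/funext => k /=; ring. Qed.

Lemma subfB_comm a b g : (a \- b) \- g = (a \- g) \- b.
Proof. by apply/funext => k /=; ring. Qed.

Lemma rad_swap g u gs a : rad (g :: u :: gs) a = rad (u :: g :: gs) a.
Proof.
by rewrite /= (addf_comm a g u) (addfB_comm a g u) -(addfB_comm a u g)
  (subfB_comm a g u); ring.
Qed.

(** The signs are exchangeable. Moving [u] to the front lets it be absorbed into the offset while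
    [vs] is being treated. *)
Lemma rad_cat_cons vs u us a : rad (vs ++ u :: us) a = rad (u :: vs ++ us) a.
Proof.
elim: vs a => [//|v vs IH] a.
by rewrite -[RHS]rad_swap /= !IH.
Qed.

(* Khintchine: the average of |s + sum_k +-d_k|. *)
Fixpoint signed_mean (ds : seq R) (s : R) : R :=
  if ds is d :: ds' then (signed_mean ds' (s + d) + signed_mean ds' (s - d)) / 2
  else `|s|.

Definition sumsq (ds : seq R) : R := \sum_(d <- ds) d ^+ 2.

Lemma sumsq_ge0 ds : 0 <= sumsq ds.
Proof. by apply: sumr_ge0 => d _; exact: sqr_ge0. Qed.

(* The fourth moment E(s + X)^4 <= s^4 + 6 s^2 q + 3 q^2 and the pointwise bound
   |x| >= (3/4) x^2 / t - x^4 / (16 t^3), tangent at x = 2t. *)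
Lemma signed_mean_moments ds s t : 0 < t ->
  3 / 4 * t^-1 * (s ^+ 2 + sumsq ds)
  - (s ^+ 4 + 6 * s ^+ 2 * sumsq ds + 3 * sumsq ds ^+ 2) * t^-1 ^+ 3 / 16
  <= signed_mean ds s.
Proof.
move=> t0; have : 0 < t^-1 by rewrite invr_gt0.
move: (t^-1) => {t0} {}t t0.
elim: ds s => [|d ds IH] s /=.
  rewrite /sumsq big_nil mulr0 expr0n/= !mulr0 !addr0.
  suff H x : 0 <= x -> 3 / 4 * t * x ^+ 2 - x ^+ 4 * t ^+ 3 / 16 <= x.
    rewrite -(real_normK (num_real s)).
    have -> : s ^+ 4 = `|s| ^+ 4.
      by rewrite -normrX ger0_norm// (exprM s 2 2 : s ^+ 4 = _) sqr_ge0.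
    exact: H.
  move=> x0; rewrite -subr_ge0.
  have -> : x - (3 / 4 * t * x ^+ 2 - x ^+ 4 * t ^+ 3 / 16) =
    x * ((t * x - 2) ^+ 2 * (t * x + 4)) / 16 by field.
  rewrite divr_ge0// mulr_ge0// mulr_ge0 ?sqr_ge0//.
  by rewrite addr_ge0// mulr_ge0// ltW.
have -> : sumsq (d :: ds) = d ^+ 2 + sumsq ds by rewrite /sumsq big_cons.
have := IH (s + d); have := IH (s - d); move: (sumsq ds) => q h1 h2.
(* Averaging the induction hypothesis over s + d and s - d gives the claim up to a surplus of 2 d^4
   in the subtracted fourth moment, so only this sign is needed. *)
have h3 : 0 <= d ^+ 4 * t ^+ 3.
  rewrite mulr_ge0//; last exact: exprn_ge0 (ltW t0).
  by rewrite (exprM d 2 2 : d ^+ 4 = _) sqr_ge0.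
set x := signed_mean ds _ in h1 *; set y := signed_mean ds _ in h2 *.
nra.
Qed.

(** With t = sqrt (sumsq ds + s^2) the fourth moment is at most 3 t^4, so the moment bound leaves
    (3/4 - 3/16) t = 9/16 t, which exceeds t / 2. The shift [s] is present because the offset
    contributes a i - a j to each difference in [rad_ge_pair]. *)
Lemma khintchine ds s : Num.sqrt (sumsq ds) <= 2 * signed_mean ds s.
Proof.
have [q0|q0] := eqVneq (sumsq ds + s ^+ 2) 0.
  have -> : sumsq ds = 0.
    by have := sumsq_ge0 ds; have := sqr_ge0 s; move: q0; lra.
  rewrite sqrtr0 mulr_ge0//; elim: ds s {q0} => [|d ds IH] s //=.
  by rewrite divr_ge0// addr_ge0.
have qs0 : 0 < sumsq ds + s ^+ 2.
  by rewrite lt_neqAle eq_sym q0 addr_ge0 ?sqr_ge0 ?sumsq_ge0.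
set t := Num.sqrt (sumsq ds + s ^+ 2).
have t0 : 0 < t by rewrite sqrtr_gt0.
have tq : t ^+ 2 = sumsq ds + s ^+ 2 by rewrite sqr_sqrtr// ltW.
have ht : Num.sqrt (sumsq ds) <= t by rewrite ler_wsqrtr// lerDl sqr_ge0.
apply: (le_trans ht).
have h := signed_mean_moments ds s t0.
have h4 : (s ^+ 4 + 6 * s ^+ 2 * sumsq ds + 3 * sumsq ds ^+ 2) <= 3 * t ^+ 4.
  rewrite (_ : t ^+ 4 = (t ^+ 2) ^+ 2); last by rewrite -exprM.
  rewrite tq -subr_ge0.
  have -> : 3 * (sumsq ds + s ^+ 2) ^+ 2 -
   (s ^+ 4 + 6 * s ^+ 2 * sumsq ds + 3 * sumsq ds ^+ 2) = 2 * (s ^+ 2) ^+ 2.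
    by ring.
  by rewrite mulr_ge0// sqr_ge0.
have h5 : (s ^+ 4 + 6 * s ^+ 2 * sumsq ds + 3 * sumsq ds ^+ 2) * t^-1 ^+ 3
    <= 3 * t.
  have -> : 3 * t = 3 * t ^+ 4 * t^-1 ^+ 3 by field; rewrite gt_eqF.
  by rewrite ler_wpM2r// exprn_ge0// invr_ge0 ltW.
have h6 : t^-1 * (s ^+ 2 + sumsq ds) = t.
  by rewrite addrC -tq; field; rewrite gt_eqF.
move: h; rewrite -mulrA h6; lra.
Qed.

Definition deltas vs (i j : nat) : seq R := [seq v i - v j | v <- vs].

(** The supremum is at least its value at i and at j, and twice the maximum of two numbers is their
    sum plus the absolute value of their difference. Averaging over signs cancels the signed terms
    in the sum and leaves [signed_mean] of the differences. *)
Lemma rad_ge_pair vs a i j : bdds vs -> bdd a ->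
  a i + a j + signed_mean (deltas vs i j) (a i - a j) <= 2 * rad vs a.
Proof.
elim: vs a => [|v vs IH] a /=.
  move=> _ ba; have := le_sup_range i ba; have := le_sup_range j ba.
  by case: (ler0P (a i - a j)) => _; lra.
move=> [bv bvs] ba.
have h1 := IH _ bvs (bddD ba bv); have h2 := IH _ bvs (bddB ba bv).
move: h1 h2 => /=.
rewrite (_ : a i + v i - (a j + v j) = a i - a j + (v i - v j)); last by ring.
rewrite (_ : a i - v i - (a j - v j) = a i - a j - (v i - v j)); last by ring.
rewrite -/(deltas vs i j); lra.
Qed.

(** With one sign, the left side is half the supremum over pairs (i, j) of (a i + g i) + (a j - g
    j). The increment g i - g j is at most half the Euclidean length of the differences, hence at
    most [signed_mean] by Khintchine; the 1/4 in the hypothesis absorbs the Khintchine constant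
    2. *)
Lemma contraction1 g vs a : bdds vs -> bdd a -> bdd g ->
  (forall i j, (g i - g j) ^+ 2 <= sumsq (deltas vs i j) / 4) ->
  rad [:: g] a <= rad vs a.
Proof.
move=> bvs ba bg gv /=.
suff H i j : (a i + g i) + (a j - g j) <= 2 * rad vs a.
  suff : sup (range (a \+ g)) <= 2 * rad vs a - sup (range (a \- g)) by lra.
  apply: sup_range_le => i /=.
  suff : sup (range (a \- g)) <= 2 * rad vs a - (a i + g i) by lra.
  by apply: sup_range_le => j /=; have := H i j; lra.
apply: le_trans (rad_ge_pair i j bvs ba).
have := khintchine (deltas vs i j) (a i - a j).
have : g i - g j <= Num.sqrt (sumsq (deltas vs i j)) / 2.
  rewrite (le_trans (ler_norm _))// -sqrtr_sqr.
  rewrite (_ : 2 = Num.sqrt (2 ^+ 2)); last by rewrite sqrtr_sqr ger0_norm.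
  rewrite -sqrtrV ?sqr_ge0// -sqrtrM ?sumsq_ge0// ler_wsqrtr//.
  by rewrite (le_trans (gv i j))// -natrX.
lra.
Qed.

(** For fixed signs of [us] these functions only modify the offset, and [contraction1] holds for
    every bounded offset. *)
Lemma contraction_step g vs us a : bdds us -> bdds vs -> bdd a -> bdd g ->
  (forall i j, (g i - g j) ^+ 2 <= sumsq (deltas vs i j) / 4) ->
  rad (g :: us) a <= rad (vs ++ us) a.
Proof.
elim: us a => [|u us IH] a.
  by move=> _; rewrite cats0; exact: contraction1.
move=> /= [bu bus] bvs ba bg gv.
have := rad_swap g u us a; rewrite /= => ->.
rewrite rad_cat_cons /=.
have := IH (a \+ u) bus bvs (bddD ba bu) bg gv.
have := IH (a \- u) bus bvs (bddB ba bu) bg gv.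
rewrite /=; lra.
Qed.

Lemma contraction n (g : 'I_n -> nat -> R) (vs : 'I_n -> seq (nat -> R))
    (s : seq 'I_n) us a :
  bdds us -> (forall i, bdds (vs i)) -> bdd a -> (forall i, bdd (g i)) ->
  (forall i j k, (g i j - g i k) ^+ 2 <= sumsq (deltas (vs i) j k) / 4) ->
  rad ([seq g i | i <- s] ++ us) a <= rad (flatten [seq vs i | i <- s] ++ us) a.
Proof.
move=> bus bvs ba bg gv; elim: s a ba => [//|i s IH] a ba.
have bfl : bdds (flatten [seq vs i | i <- s] ++ us).
  elim: s {IH} => [//|k s IH] /=; rewrite -catA; apply/bdds_cat; split => //.
apply: (@le_trans _ _ (rad (g i :: flatten [seq vs i | i <- s] ++ us) a)).
  have := IH _ (bddD ba (bg i)); have := IH _ (bddB ba (bg i)) => /=; lra.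
by rewrite /= -catA; exact: contraction_step.
Qed.

End rademacher.

(** * Linear classes and positive semidefinite forms *)

Section euclidean.
Variable R : realType.

(** With X, Y, Z as in the proof, Y (X Y - Z^2) is the sum of the squares (Y x_i - Z y_i)^2. The
    case Y = 0 forces every y_i to vanish. *)
Lemma cauchy_schwarz_sum (I : finType) (x y : I -> R) :
  (\sum_i x i * y i) ^+ 2 <= (\sum_i x i ^+ 2) * (\sum_i y i ^+ 2).
Proof.
set X := \sum_i x i ^+ 2; set Y := \sum_i y i ^+ 2; set Z := \sum_i x i * y i.
have Y0 : 0 <= Y by apply: sumr_ge0 => i _; exact: sqr_ge0.
have H : 0 <= Y * (X * Y - Z ^+ 2).
  have -> : Y * (X * Y - Z ^+ 2) = \sum_i (Y * x i - Z * y i) ^+ 2.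
    rewrite (eq_bigr (fun i => Y ^+ 2 * x i ^+ 2 +
      (- (2 * Y * Z) * (x i * y i) + Z ^+ 2 * y i ^+ 2))).
      by rewrite !big_split/= -!mulr_sumr -/X -/Y -/Z; ring.
    by move=> i _; ring.
  by apply: sumr_ge0 => i _; exact: sqr_ge0.
have [Y_gt0|Y_eq0] : 0 < Y \/ Y = 0 by move: Y0; rewrite le_eqVlt => /predU1P[]; auto.
  by rewrite -subr_ge0 -(pmulr_rge0 _ Y_gt0).
suff -> : Z = 0 by rewrite Y_eq0 mulr0 expr0n.
apply: big1 => i _; suff -> : y i = 0 by rewrite mulr0.
apply/eqP; rewrite -sqrf_eq0; apply/eqP.
by have /psumr_eq0P := Y_eq0; apply => // j _; exact: sqr_ge0.
Qed.

Definition dot n (x y : 'rV[R]_n) : R := \sum_i x 0 i * y 0 i.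

Lemma enorm_ge0 n (x : 'rV[R]_n) : 0 <= enorm x.
Proof. exact: sqrtr_ge0. Qed.

Lemma sqr_enorm n (x : 'rV[R]_n) : enorm x ^+ 2 = \sum_i x 0 i ^+ 2.
Proof. by rewrite sqr_sqrtr// sumr_ge0// => i _; exact: sqr_ge0. Qed.

Lemma sqr_dot_le n (x y : 'rV[R]_n) :
  dot x y ^+ 2 <= enorm x ^+ 2 * enorm y ^+ 2.
Proof. by rewrite !sqr_enorm; exact: cauchy_schwarz_sum. Qed.

Lemma dot_le n (x y : 'rV[R]_n) : `|dot x y| <= enorm x * enorm y.
Proof.
rewrite -(@ler_pXn2r _ 2) ?nnegrE ?mulr_ge0 ?enorm_ge0//.
by rewrite real_normK ?num_real// exprMn sqr_dot_le.
Qed.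

Lemma dotDr n (v x y : 'rV[R]_n) : dot v (x + y) = dot v x + dot v y.
Proof. by rewrite /dot -big_split; apply: eq_bigr => i _; rewrite mxE mulrDr. Qed.

Lemma dotZr n (v x : 'rV[R]_n) k : dot v (k *: x) = k * dot v x.
Proof. by rewrite /dot mulr_sumr; apply: eq_bigr => i _; rewrite mxE mulrCA. Qed.

Lemma dotC n (v x : 'rV[R]_n) : dot v x = dot x v.
Proof. by apply: eq_bigr => i _; rewrite mulrC. Qed.

Lemma dotNr n (v x : 'rV[R]_n) : dot v (- x) = - dot v x.
Proof. by rewrite -scaleN1r dotZr mulN1r. Qed.

Lemma dot_mulmx n (v x : 'rV[R]_n) : dot v x = (v *m x^T) 0 0.
Proof. by rewrite mxE; apply: eq_bigr => i _; rewrite mxE. Qed.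

Lemma parallelogram n (x y : 'rV[R]_n) :
  enorm (x + y) ^+ 2 + enorm (x - y) ^+ 2 = 2 * (enorm x ^+ 2 + enorm y ^+ 2).
Proof.
rewrite !sqr_enorm -!big_split mulr_sumr /=; apply: eq_bigr => i _.
by rewrite !mxE; ring.
Qed.

Lemma sqrt_midpoint (x y : R) : 0 <= x -> 0 <= y ->
  (Num.sqrt x + Num.sqrt y) / 2 <= Num.sqrt ((x + y) / 2).
Proof.
move=> x0 y0; rewrite -(@ler_pXn2r _ 2) ?nnegrE ?sqrtr_ge0//.
rewrite sqr_sqrtr; last by rewrite divr_ge0// addr_ge0.
have := sqr_sqrtr x0; have := sqr_sqrtr y0.
have := sqr_ge0 (Num.sqrt x - Num.sqrt y); nra.
Qed.

(** Jensen's inequality for the square root, one sign at a time: by the parallelogram law the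
    average of |b + u|^2 and |b - u|^2 is |b|^2 + |u|^2, and concavity does the rest. The vector [b]
    accumulates the signed vectors already chosen. *)
Lemma rad_linear m (w : nat -> 'rV[R]_m) (r : R) (us : seq 'rV[R]_m)
    (b : 'rV[R]_m) :
  (forall k, enorm (w k) <= r) ->
  rad [seq (fun k => dot (w k) u) | u <- us] (fun k => dot (w k) b) <=
  r * Num.sqrt (enorm b ^+ 2 + \sum_(u <- us) enorm u ^+ 2).
Proof.
move=> wr; have r0 : 0 <= r by rewrite (le_trans _ (wr 0%N))// enorm_ge0.
elim: us b => [|u us IH] b /=.
  rewrite big_nil addr0 sqrtr_sqr ger0_norm ?enorm_ge0//.
  apply: sup_range_le => k; rewrite (le_trans (ler_norm _))//.
  by rewrite (le_trans (dot_le _ _))// ler_wpM2r ?enorm_ge0.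
have -> : (fun k => dot (w k) b) \+ (fun k => dot (w k) u) =
  fun k => dot (w k) (b + u) by apply/funext => k; rewrite dotDr.
have -> : (fun k => dot (w k) b) \- (fun k => dot (w k) u) =
  fun k => dot (w k) (b - u) by apply/funext => k; rewrite dotDr dotNr.
rewrite big_cons; set q := \sum_(_ <- us) _.
have q0 : 0 <= q by apply: sumr_ge0 => v _; exact: sqr_ge0.
have := IH (b + u); have := IH (b - u); rewrite -/q => h1 h2.
have := @sqrt_midpoint (enorm (b + u) ^+ 2 + q) (enorm (b - u) ^+ 2 + q).
rewrite !addr_ge0 ?sqr_ge0// => /(_ isT isT).
rewrite (_ : (_ + q + _) / 2 = enorm b ^+ 2 + (enorm u ^+ 2 + q)); last first.
  by have := parallelogram b u; lra.
move=> /(ler_wpM2l r0); lra.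
Qed.

Lemma bdd_linear m (w : nat -> 'rV[R]_m) (r : R) (u : 'rV[R]_m) :
  (forall k, enorm (w k) <= r) -> bdd (fun k => dot (w k) u).
Proof.
move=> wr; exists (r * enorm u) => k.
by rewrite (le_trans (dot_le _ _))// ler_wpM2r ?enorm_ge0.
Qed.

Definition qform n (M : 'M[R]_n) (v : 'rV[R]_n) : R := (v *m M *m v^T) 0 0.

Lemma qformE n (M : 'M[R]_n) v : qform M v = \sum_i \sum_j v 0 i * v 0 j * M i j.
Proof.
rewrite /qform mxE exchange_big/=; apply: eq_bigr => j _.
rewrite mxE mulr_suml; apply: eq_bigr => i _; rewrite mxE; ring.
Qed.

Lemma qformB n (M N : 'M[R]_n) v : qform (M - N) v = qform M v - qform N v.
Proof. by rewrite /qform mulmxBr mulmxBl !mxE. Qed.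

Lemma qformD n (M N : 'M[R]_n) v : qform (M + N) v = qform M v + qform N v.
Proof. by rewrite /qform mulmxDr mulmxDl !mxE. Qed.

Lemma qformZ n k (M : 'M[R]_n) v : qform (k *: M) v = k * qform M v.
Proof. by rewrite /qform -scalemxAr -scalemxAl !mxE. Qed.

Lemma psdD n (M N : 'M[R]_n) : psd M -> psd N -> psd (M + N).
Proof.
move=> [M1 M2] [N1 N2]; split; first by rewrite linearD/= M1 N1.
by move=> v; rewrite -/(qform _ _) qformD addr_ge0//; [exact: M2|exact: N2].
Qed.

Lemma psdZ n k (M : 'M[R]_n) : 0 <= k -> psd M -> psd (k *: M).
Proof.
move=> k0 [M1 M2]; split; first by rewrite linearZ/= M1.
by move=> v; rewrite -/(qform _ _) qformZ mulr_ge0//; exact: M2.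
Qed.

Lemma qform_outer n (u v : 'rV[R]_n) : qform (u^T *m u) v = dot v u ^+ 2.
Proof.
rewrite /qform mulmxA -mulmxA mxE big_ord1 expr2 -!dot_mulmx.
by congr (_ * _); rewrite dotC.
Qed.

Lemma qform_delta n (M : 'M[R]_n) i : qform M (delta_mx 0 i) = M i i.
Proof.
by rewrite /qform -rowE trmx_delta -colE !mxE.
Qed.

(** Serves both halves of the elimination: with zero diagonal the expansion is affine in t, which
    kills the off-diagonal entries; with a positive pivot it completes the square. *)
Lemma qform_shift n (M : 'M[R]_n) v i t : M^T = M ->
  qform M (v + t *: delta_mx 0 i) =
  qform M v + 2 * t * dot v (row i M) + t ^+ 2 * M i i.
Proof.
move=> Msym; have vM : (v *m M) 0 i = dot v (row i M).
  by rewrite mxE; apply: eq_bigr => j _; rewrite mxE -[in LHS]Msym mxE.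
pose e : 'rV[R]_n := delta_mx 0 i.
have e1 : (v *m M *m e^T) 0 0 = dot v (row i M).
  by rewrite trmx_delta -colE mxE vM.
have e2 : (e *m M *m v^T) 0 0 = dot v (row i M).
  by rewrite -rowE -dot_mulmx dotC.
have mxD (A B : 'M[R]_1) : (A + B) 0 0 = A 0 0 + B 0 0 by rewrite mxE.
have mxZ k (A : 'M[R]_1) : (k *: A) 0 0 = k * A 0 0 by rewrite mxE.
rewrite -(qform_delta M i) -/e /qform mulmxDl linearD/= linearZ/= !mulmxDl.
rewrite !mulmxDr -!scalemxAl -!scalemxAr !mxD !mxZ e1 e2; ring.
Qed.

(* Cholesky elimination, by induction on the number of nonzero diagonal entries. *)
Lemma psd_sum_squares n (M : 'M[R]_n) : psd M ->
  exists us : seq 'rV[R]_n,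
    (forall v, qform M v = \sum_(u <- us) dot v u ^+ 2) /\
    \sum_(u <- us) enorm u ^+ 2 = \tr M.
Proof.
have [k] := ubnP #|[pred i | M i i != 0]|.
elim: k M => // k IH M Mk [Msym Mpsd].
have diag_ge0 i : 0 <= M i i by rewrite -qform_delta; exact: Mpsd.
have [i Mii|M0] := pickP [pred i | M i i != 0]; last first.
  have {}M0 i : M i i = 0 by apply/eqP; have := M0 i => /= /negbFE.
  suff -> : M = 0.
    exists [::]; split; last by rewrite big_nil mxtrace0.
    by move=> v; rewrite big_nil /qform mulmx0 mul0mx mxE.
  apply/matrixP => i j; rewrite mxE.
  have H t : 0 <= 2 * t * M i j.
    have := Mpsd (delta_mx 0 j + t *: delta_mx 0 i).
    rewrite -/(qform _ _) qform_shift// qform_delta !M0 mulr0 addr0 add0r.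
    rewrite /dot (bigD1 j)//= !mxE !eqxx mul1r big1 ?addr0// => l lj.
    by rewrite !mxE (negbTE lj) andbF mul0r.
  apply/eqP/negPn/negP => Mij.
  have : 0 < M i j ^+ 2 by rewrite exprn_even_gt0.
  have := H (- M i j); nra.
move: Mii => /= Mii; have d0 : 0 < M i i by rewrite lt_neqAle eq_sym Mii diag_ge0.
pose u : 'rV[R]_n := (Num.sqrt (M i i))^-1 *: row i M.
have s2 : (Num.sqrt (M i i))^-1 ^+ 2 = (M i i)^-1.
  by rewrite exprVn sqr_sqrtr// ltW.
have M'psd : psd (M - u^T *m u).
  split; first by rewrite linearB/= trmx_mul trmxK Msym.
  move=> v; rewrite -/(qform _ _) qformB qform_outer dotZr exprMn s2.
  (* This shift minimizes the quadratic in t, and the minimum is exactly the form of the Schur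
     complement at v. *)
  have := Mpsd (v + (- dot v (row i M) / M i i) *: delta_mx 0 i).
  rewrite -/(qform _ _) qform_shift//; set x := dot _ _.
  congr (_ <= _); field; by rewrite gt_eqF.
have M'E j : (M - u^T *m u) j j = M j j - M i j ^+ 2 / M i i.
  rewrite !mxE big_ord1 !mxE -s2; ring.
have [|us [us1 us2]] := IH (M - u^T *m u) _ M'psd.
  (* A zero diagonal entry stays zero, since it could only decrease while the remainder is positive
     semidefinite; the pivot entry becomes zero, so the count drops strictly. *)
  rewrite -ltnS (leq_trans _ Mk)// ltnS; apply: proper_card; apply/properP; split.
    apply/fintype.subsetP => j; rewrite !inE; apply: contraNneq => Mj.
    have := M'psd.2 (delta_mx 0 j); rewrite -/(qform _ _) qform_delta M'E Mj.
    rewrite sub0r oppr_ge0 => h; rewrite oppr_eq0 eq_le h.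
    by rewrite divr_ge0// sqr_ge0.
  exists i; rewrite !inE// M'E negbK subr_eq0; apply/eqP; field.
  by rewrite gt_eqF.
exists (u :: us); split.
  by move=> v; rewrite big_cons -us1 qformB qform_outer addrC subrK.
rewrite big_cons us2 linearB/= mxtrace_mulC (_ : \tr (u *m u^T) = enorm u ^+ 2).
  by rewrite addrC subrK.
rewrite /mxtrace big_ord1 mxE sqr_enorm; apply: eq_bigr => j _.
by rewrite !mxE expr2.
Qed.

End euclidean.

(** * Bounded differences *)

Section hoeffding_calculus.
Variable R : realType.

Lemma le0_derive_le (f df : R -> R) (t : R) : 0 <= t ->
  (forall x, is_derive x (1 : R) f (df x)) -> (forall x, 0 <= x -> df x <= 0) ->
  f t <= f 0.
Proof.
move=> t0 fd df0.
have [|c /itvP c0 E] := MVT_segment t0 (fun x _ => fd x).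
  by apply: derivable_within_continuous => x _; exact: ex_derive.
by rewrite -subr_le0 E subr0 mulr_le0_ge0// df0 ?c0.
Qed.

(** The tangent line of the exponential at t z lies below its values at t and - t. Weighting the two
    inequalities by (1 + z) / 2 and (1 - z) / 2 cancels the first-order terms. *)
Lemma expR_chord (t z : R) : `|z| <= 1 ->
  expR (t * z) <= (1 + z) / 2 * expR t + (1 - z) / 2 * expR (- t).
Proof.
rewrite ler_norml => /andP[z1 z2].
have e0 := expR_gt0 (t * z).
have h1 : expR (t * z) * (1 + (t - t * z)) <= expR t.
  rewrite [leRHS](_ : _ = expR (t * z) * expR (t - t * z)).
    by rewrite ler_pM2l// expR_ge1Dx.
  by rewrite -expRD; congr expR; ring.
have h2 : expR (t * z) * (1 + (- t - t * z)) <= expR (- t).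
  rewrite [leRHS](_ : _ = expR (t * z) * expR (- t - t * z)).
    by rewrite ler_pM2l// expR_ge1Dx.
  by rewrite -expRD; congr expR; ring.
have {}h1 : (1 + z) / 2 * (expR (t * z) * (1 + (t - t * z))) <=
    (1 + z) / 2 * expR t by rewrite ler_wpM2l//; lra.
have {}h2 : (1 - z) / 2 * (expR (t * z) * (1 + (- t - t * z))) <=
    (1 - z) / 2 * expR (- t) by rewrite ler_wpM2l//; lra.
apply: le_trans (lerD h1 h2); rewrite le_eqVlt; apply/orP; left; apply/eqP.
by field.
Qed.

(* With A the two-point moment generating function and r = A'/A its logarithmic
   derivative, r' = 1 - r^2 <= 1, hence r <= mu + t and A e^(-mu t - t^2/2)
   is nonincreasing. *)
Lemma two_point_mgf (mu t : R) : `|mu| <= 1 -> 0 <= t ->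
  (1 + mu) / 2 * expR t + (1 - mu) / 2 * expR (- t) <=
  expR (t * mu + t ^+ 2 / 2).
Proof.
rewrite ler_norml => /andP[mu1 mu2] t0.
set p := (1 + mu) / 2; set q : R := (1 - mu) / 2.
have p0 : 0 <= p by rewrite /p; lra.
have q0 : 0 <= q by rewrite /q; lra.
have pq : p + q = 1 by rewrite /p /q; lra.
have pq' : p - q = mu by rewrite /p /q; lra.
clearbody p q; pose A x := p * expR x + q * expR (- x).
pose A' x := p * expR x - q * expR (- x).
have A0 x : 0 < A x.
  have e1 := expR_gt0 x; have e2 := expR_gt0 (- x).
  rewrite /A; have [pp|pn0] := eqVneq p 0.
    have qq : q = 1 by move: pq; rewrite pp add0r.
    by rewrite pp qq mul0r add0r mul1r.
  apply: ltr_wpDr; first by rewrite mulr_ge0// ltW.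
  by rewrite mulr_gt0// lt_neqAle eq_sym pn0.
have dN x : is_derive x (1 : R) (expR \o -%R : R -> R) (- expR (- x)).
  rewrite -mulrN1.
  exact: (@is_derive1_comp _ expR -%R x _ _ (is_derive_expR _) (is_deriveNid x 1)).
have dA x : is_derive x (1 : R) A (A' x).
  rewrite /A' -mulrN; exact: (is_deriveD (is_deriveZ p (is_derive_expR x))
    (is_deriveZ q (dN x))).
have dA' x : is_derive x (1 : R) A' (A x).
  rewrite /A -(opprK (q * _)) -mulrN.
  exact: (is_deriveB (is_deriveZ p (is_derive_expR x)) (is_deriveZ q (dN x))).
have dV x : is_derive x (1 : R) (fun y => (A y)^-1) (- (A x) ^- 2 *: A' x).
  by apply: is_deriveV; rewrite gt_eqF.
have rle x : 0 <= x -> A' x <= (mu + x) * A x.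
  move=> x0; pose r := A' * (fun y => (A y)^-1) - (id : R -> R).
  have dr y : is_derive y (1 : R) r (- (A' y / A y) ^+ 2).
    apply: (is_derive_eq (is_deriveB (is_deriveM (dA' y) (dV y))
      (is_derive_id y (1 : R)))).
    rewrite /GRing.scale/=; field; by rewrite gt_eqF.
  have := le0_derive_le x0 dr (fun y _ => _).
  have -> : r 0 = mu.
    change (A' 0 / A 0 - 0 = mu).
    by rewrite /A /A' oppr0 expR0 !mulr1 pq pq' divr1 addr0.
  have -> : r x = A' x / A x - x by [].
  move=> h; rewrite -ler_pdivrMr//; suff : A' x / A x - x <= mu by lra.
  by apply: h => y; rewrite oppr_le0 sqr_ge0.
pose E : R -> R := fun x => - (x * mu + x ^+ 2 / 2).
have dE x : is_derive x (1 : R) E (- (mu + x)).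
  have -> : E = - (mu \*: id + 2^-1 \*: ((id : R -> R) ^+ 2)).
    apply/funext => y; change (E y = - (mu * y + 2^-1 * (y * y))).
    by rewrite /E; field.
  apply: (is_derive_eq (is_deriveN (is_deriveD
    (is_deriveZ mu (is_derive_id x (1 : R)))
    (is_deriveZ 2^-1 (is_deriveX 2 (is_derive_id x (1 : R))))))).
  by rewrite /GRing.scale/= !expr1; field.
pose K : R -> R := A * (expR \o E).
have dK x : is_derive x (1 : R) K ((A' x - (mu + x) * A x) * expR (E x)).
  apply: (is_derive_eq (is_deriveM (dA x)
    (is_derive1_comp (is_derive_expR (E x)) (dE x)))).
  rewrite /GRing.scale/=; ring.
have := le0_derive_le t0 dK.
have -> : K 0 = 1.
  change (A 0 * expR (E 0) = 1).
  by rewrite /A /E oppr0 mul0r expr0n/= mul0r addr0 oppr0 expR0 !mulr1.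
have -> : K t = A t * expR (E t) by [].
move=> h.
have : A t * expR (E t) <= 1.
  apply: h => x x0; rewrite mulr_le0_ge0 ?expR_ge0// subr_le0; exact: rle.
by rewrite /E expRN ler_pdivrMr ?expR_gt0// mul1r.
Qed.

End hoeffding_calculus.

(** Bounded measurable functions are integrable for every probability and stable under the
    operations below, which settles all integrability conditions on the sample side at once. *)
Definition bmeas d (T : measurableType d) (R : realType) (f : T -> R) : Prop :=
  measurable_fun setT f /\ exists M, forall x, `|f x| <= M.

Section bmeas.
Context d (T : measurableType d) (R : realType).
Implicit Types (f g : T -> R) (P : probability T R).

Lemma bmeas_integrable P f : bmeas f -> P.-integrable setT (EFin \o f).
Proof.
move=> [mf [M fM]]; apply: measurable_bounded_integrable => //.
  by rewrite (le_lt_trans (probability_le1 _ _))// ltry.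
exists M; split; first exact: num_real.
by move=> N MN x _ /=; exact: le_trans (fM x) (ltW MN).
Qed.

Lemma bmeas_cst (r : R) : bmeas (fun _ : T => r).
Proof. by split; [exact: measurable_cst|exists `|r|]. Qed.

Lemma bmeasD f g : bmeas f -> bmeas g -> bmeas (fun x => f x + g x).
Proof.
move=> [mf [M fM]] [mg [N gN]]; split; first exact: measurable_funD.
by exists (M + N) => x; rewrite (le_trans (ler_normD _ _))// lerD.
Qed.

Lemma bmeasB f g : bmeas f -> bmeas g -> bmeas (fun x => f x - g x).
Proof.
move=> [mf [M fM]] [mg [N gN]]; split; first exact: measurable_funB.
by exists (M + N) => x; rewrite (le_trans (ler_normB _ _))// lerD.
Qed.

Lemma bmeasZ r f : bmeas f -> bmeas (fun x => r * f x).
Proof.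
move=> [mf [M fM]]; split; first by apply: measurable_funM.
by exists (`|r| * M) => x; rewrite normrM ler_wpM2l.
Qed.

Lemma bmeas_expR f : bmeas f -> bmeas (fun x => expR (f x)).
Proof.
move=> [mf [M fM]]; split; first exact: measurableT_comp.
exists (expR M) => x; rewrite ger0_norm ?expR_ge0// ler_expR.
by rewrite (le_trans (ler_norm _)).
Qed.

Lemma bmeas_comp d' (T' : measurableType d') (g : T' -> T) f :
  measurable_fun setT g -> bmeas f -> bmeas (fun x => f (g x)).
Proof.
move=> mg [mf [M fM]]; split; last by exists M => x.
exact: measurableT_comp mf mg.
Qed.

Lemma bmeas_sup (a : nat -> T -> R) M :
  (forall k, measurable_fun setT (a k)) -> (forall k x, `|a k x| <= M) ->
  bmeas (fun x => sup (range (a ^~ x))).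
Proof.
move=> ma aM; split.
  (* The supremum of the whole sequence is its tail supremum from index 0, for which measurability
     is known. *)
  rewrite (_ : (fun x => _) = fun x => sups (a ^~ x) 0).
    apply: measurable_fun_sups => // x _.
    by exists M => _ [k _ <-]; rewrite (le_trans (ler_norm _)).
  apply/funext => x; rewrite /sups /sdrop; congr sup.
  by apply/seteqP; split => [_ [k _ <-]|_ [k _ <-]]; exists k.
exists M => x; rewrite ler_norml; apply/andP; split.
  apply: (@le_trans _ _ (a 0%N x)).
    by have := aM 0%N x; rewrite ler_norml => /andP[].
  by apply: (@le_sup_range _ (a ^~ x)); exists M.
by apply: (@sup_range_le _ (a ^~ x)) => k; rewrite (le_trans (ler_norm _)).
Qed.

Lemma EFin_Rintegral P f : P.-integrable setT (EFin \o f) ->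
  (\int[P]_x f x)%:E = (\int[P]_x (f x)%:E)%E.
Proof. by move=> fi; rewrite fineK//; exact: integrable_fin_num. Qed.

Lemma Rint_le P f g : bmeas f -> bmeas g -> (forall x, f x <= g x) ->
  \int[P]_x f x <= \int[P]_x g x.
Proof. by move=> bf bg fg; apply: le_Rintegral => //; exact: bmeas_integrable. Qed.

Lemma Rint_cst P r : \int[P]_x r = r.
Proof. by rewrite Rintegral_cst// [X in fine X]probability_setT mulr1. Qed.

Lemma RintD P f g : bmeas f -> bmeas g ->
  \int[P]_x (f x + g x) = \int[P]_x f x + \int[P]_x g x.
Proof. by move=> bf bg; rewrite RintegralD//; exact: bmeas_integrable. Qed.

Lemma RintB P f g : bmeas f -> bmeas g ->
  \int[P]_x (f x - g x) = \int[P]_x f x - \int[P]_x g x.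
Proof. by move=> bf bg; rewrite RintegralB//; exact: bmeas_integrable. Qed.

Lemma RintZ P r f : bmeas f -> \int[P]_x (r * f x) = r * \int[P]_x f x.
Proof. by move=> bf; rewrite RintegralZl//; exact: bmeas_integrable. Qed.

Lemma Rint_bound P f M : bmeas f -> (forall x, `|f x| <= M) ->
  `|\int[P]_x f x| <= M.
Proof.
move=> bf fM; rewrite ler_norml -[leLHS](Rint_cst P) -[X in _ && (_ <= X)](Rint_cst P).
apply/andP; split; apply: Rint_le => //; try exact: bmeas_cst.
  by move=> x; have := fM x; rewrite ler_norml => /andP[].
by move=> x; rewrite (le_trans (ler_norm _)).
Qed.

End bmeas.

Section bmeas_product.
Context d1 d2 (T1 : measurableType d1) (T2 : measurableType d2) (R : realType).
Variables (P1 : probability T1 R) (P2 : probability T2 R).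
Implicit Type f : T1 * T2 -> R.

Lemma bmeas_pair2 f x : bmeas f -> bmeas (fun y => f (x, y)).
Proof. exact: bmeas_comp. Qed.

Lemma bmeas_pair1 f y : bmeas f -> bmeas (fun x => f (x, y)).
Proof. exact: bmeas_comp. Qed.

Lemma bmeas_Rint2 f : bmeas f -> bmeas (fun x => \int[P2]_y f (x, y)).
Proof.
move=> bf; split; last first.
  have [M fM] := bf.2; exists M => x.
  by apply: Rint_bound => //; exact: bmeas_pair2.
have := measurable_fubini_F (bmeas_integrable (P1 \x P2)%E bf).
move=> h; apply/measurable_EFinP; move: h; apply: eq_measurable_fun => x _.
by rewrite /= EFin_Rintegral//; apply: bmeas_integrable; exact: bmeas_pair2.
Qed.

Lemma bmeas_Rint1 f : bmeas f -> bmeas (fun y => \int[P1]_x f (x, y)).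
Proof.
move=> bf; split; last first.
  have [M fM] := bf.2; exists M => y.
  by apply: Rint_bound => //; exact: bmeas_pair1.
have := measurable_fubini_G (bmeas_integrable (P1 \x P2)%E bf).
move=> h; apply/measurable_EFinP; move: h; apply: eq_measurable_fun => y _.
by rewrite /= EFin_Rintegral//; apply: bmeas_integrable; exact: bmeas_pair1.
Qed.

Lemma Rint_fubini1 f : bmeas f ->
  \int[(P1 \x P2)%E]_z f z = \int[P1]_x \int[P2]_y f (x, y).
Proof.
move=> bf; have bi := bmeas_integrable (P1 \x P2)%E bf.
rewrite {1}/Rintegral -integral12_prod_meas1//; congr fine.
apply: eq_integral => x _.
by rewrite EFin_Rintegral//; apply: bmeas_integrable; exact: bmeas_pair2.
Qed.

Lemma Rint_fubini2 f : bmeas f ->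
  \int[(P1 \x P2)%E]_z f z = \int[P2]_y \int[P1]_x f (x, y).
Proof.
move=> bf; have bi := bmeas_integrable (P1 \x P2)%E bf.
rewrite {1}/Rintegral -integral21_prod_meas1//; congr fine.
apply: eq_integral => y _.
by rewrite EFin_Rintegral//; apply: bmeas_integrable; exact: bmeas_pair1.
Qed.

End bmeas_product.

Section iid_integrals.
Context d (T : measurableType d) (R : realType) (D : probability T R).

Lemma Rint_iidS n (F : n.+1.-tuple T -> R) : bmeas F ->
  \int[iid D n.+1]_S F S = \int[(D \x iid D n)%E]_p F (tuple_cons p).
Proof.
move=> bF; rewrite /Rintegral integral_distribution//.
  by apply/measurable_EFinP; exact: bF.1.
apply: (@bmeas_integrable _ _ _ (D \x iid D n)%E (F \o @tuple_cons _ _ n)).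
by apply: (bmeas_comp _ bF); exact: measurable_tuple_cons.
Qed.

Lemma iid_sample0 (F : 0.-tuple T -> R) : \int[iid D 0]_S F S = F [tuple].
Proof.
by rewrite -[RHS](@Rint_cst _ _ _ (iid D 0)); apply: eq_Rintegral => S _;
  rewrite (tuple0 S).
Qed.

End iid_integrals.

(** * Exponential moments of functions with bounded differences *)

Section mcdiarmid.
Context d (T : measurableType d) (R : realType).

(** The chord bound is affine in Z, so only the mean of Z survives integration and [two_point_mgf]
    applies to it. *)
Lemma hoeffding_unit (P : probability T R) (Z : T -> R) t :
  measurable_fun setT Z -> (forall x, `|Z x| <= 1) -> 0 <= t ->
  \int[P]_x expR (t * Z x) <= expR (t * \int[P]_x Z x + t ^+ 2 / 2).
Proof.
move=> mZ Z1 t0; have bZ : bmeas Z by split => //; exists 1.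
have muZ := Rint_bound P bZ Z1.
apply: le_trans (two_point_mgf muZ t0).
have b1 : bmeas (fun x => expR (t * Z x)).
  by apply: bmeas_expR; exact: bmeasZ.
have b2 : bmeas (fun x => (1 + Z x) / 2 * expR t + (1 - Z x) / 2 * expR (- t)).
  rewrite (_ : (fun x => _) = fun x => (expR t / 2 + expR (- t) / 2) +
    (expR t / 2 - expR (- t) / 2) * Z x).
    by apply: bmeasD; [exact: bmeas_cst|exact: bmeasZ].
  by apply/funext => x; field.
apply: (le_trans (Rint_le P b1 b2 (fun x => expR_chord t (Z1 x)))).
rewrite (@eq_Rintegral _ _ _ _ _ (fun x => (expR t / 2 + expR (- t) / 2) +
    (expR t / 2 - expR (- t) / 2) * Z x)); last by move=> x _; field.
rewrite RintD ?RintZ ?Rint_cst//; [|exact: bmeas_cst|exact: bmeasZ].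
by rewrite le_eqVlt; apply/orP; left; apply/eqP; field.
Qed.

Lemma bmeas_range (Z : T -> R) c : measurable_fun setT Z ->
  (forall x y, Z x - Z y <= c) -> bmeas Z.
Proof.
move=> mZ Zc; split => //; exists (`|Z point| + c) => x.
rewrite -lerBlDl; have := Zc x point; have := Zc point x.
by case: (ler0P (Z x)); case: (ler0P (Z point)); lra.
Qed.

(** The range lies in [l, l + c] with l its infimum. The affine map onto [-1, 1] turns s into s c /
    2, and (s c / 2)^2 / 2 is the stated exponent. For c = 0 the map degenerates, but Z is then
    constant. *)
Lemma hoeffding (P : probability T R) (Z : T -> R) c s :
  measurable_fun setT Z -> (forall x y, Z x - Z y <= c) -> 0 <= s ->
  \int[P]_x expR (s * (Z x - \int[P]_y Z y)) <= expR (s ^+ 2 * c ^+ 2 / 8).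
Proof.
move=> mZ Zc s0; have bZ := bmeas_range mZ Zc.
set mu := \int[P]_y Z y.
have c0 : 0 <= c by have := Zc point point; rewrite subrr.
have [E|c_neq0] := eqVneq c 0.
  have Zcst x : Z x = Z point.
    by have := Zc x point; have := Zc point x; rewrite E; lra.
  have -> : mu = Z point by rewrite -[RHS](Rint_cst P); apply: eq_Rintegral.
  rewrite (@eq_Rintegral _ _ _ _ _ (fun=> 1)).
    by rewrite Rint_cst E expr0n/= mulr0 mul0r expR0.
  by move=> x _; rewrite Zcst subrr mulr0 expR0.
have {}c0 : 0 < c by rewrite lt_neqAle eq_sym c_neq0.
have hb : has_inf (range Z).
  split; first by exists (Z point), point.
  by have [M ZM] := bZ.2; exists (- M) => _ [x _ <-]; have := ZM x;
    rewrite ler_norml => /andP[].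
pose l := inf (range Z).
have lZ x : l <= Z x by apply: ge_inf; [exact: hb.2|exists x].
have Zl x : Z x <= l + c.
  rewrite -lerBlDr; apply: lb_le_inf; first exact: hb.1.
  by move=> _ [y _ <-]; have := Zc x y; lra.
pose W x := 2 / c * (Z x - (l + c / 2)).
have bW : bmeas W by apply/bmeasZ/bmeasB => //; exact: bmeas_cst.
have W1 x : `|W x| <= 1.
  rewrite /W normrM gtr0_norm ?divr_gt0//.
  rewrite -ler_pdivlMl ?divr_gt0// mulr1 invf_div ler_norml.
  by have := lZ x; have := Zl x; lra.
have sc0 : 0 <= s * c / 2 by rewrite divr_ge0// mulr_ge0// ltW.
have := hoeffding_unit P bW.1 W1 sc0.
have -> : \int[P]_x W x = 2 / c * (mu - (l + c / 2)).
  by rewrite RintZ ?RintB ?Rint_cst//; [exact: bmeas_cst|apply: bmeasB => //; exact: bmeas_cst].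
set r := _ * (_ * (_ - _)) + _ => h.
have e1 : forall x, expR (s * (Z x - mu)) =
    expR (- (s * (mu - (l + c / 2)))) * expR (s * c / 2 * W x).
  by move=> x; rewrite -expRD; congr expR; rewrite /W; field; rewrite gt_eqF.
under eq_Rintegral do rewrite e1.
rewrite RintZ; last by apply: bmeas_expR; exact: bmeasZ.
apply: (le_trans (ler_wpM2l (expR_ge0 _) h)).
rewrite -expRD ler_expR /r le_eqVlt; apply/orP; left; apply/eqP.
by field; rewrite gt_eqF.
Qed.

(** Stated on lists of any length, so that fixing the head of a sample gives a function of the same
    kind and the inductions on the sample size go through. *)
Definition bounded_differences (c : R) (F : seq T -> R) : Prop :=
  forall s1 s2 z z', `|F (s1 ++ z :: s2) - F (s1 ++ z' :: s2)| <= c.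

Lemma bounded_differences_cons c F z :
  bounded_differences c F -> bounded_differences c (fun s => F (z :: s)).
Proof. by move=> bF s1 s2 z1 z2; exact: (bF (z :: s1)). Qed.

(** Any sample is reached from a constant one by n single changes, so F stays within n c of one
    value. *)
Lemma bounded_differences_bmeas c F n : bounded_differences c F ->
  measurable_fun setT (fun S : n.-tuple T => F S) ->
  bmeas (fun S : n.-tuple T => F S).
Proof.
move=> bF mF; split => //.
have H s s0 : size s = size s0 -> `|F s - F s0| <= (size s)%:R * c.
  elim: s s0 F bF {mF} => [|z s IH] [|z0 s0] F bF //=.
    by rewrite subrr normr0 mul0r.
  move=> [ss]; rewrite -natr1 mulrDl mul1r.
  have h1 := IH s0 _ (bounded_differences_cons z bF) ss.
  have h2 := bF [::] s0 z z0.
  by rewrite -(subrK (F (z :: s0)) (F (z :: s))) -addrA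
    (le_trans (ler_normD _ _))// lerD.
exists (`|F (nseq n point)| + n%:R * c) => S.
have := H S (nseq n point); rewrite size_nseq size_tuple => /(_ erefl) h.
by rewrite -(subrK (F (nseq n point)) (F S)) addrC (le_trans (ler_normD _ _))// lerD2l.
Qed.

(** Induction on n. For a fixed head z the tail is handled by the induction hypothesis around its
    conditional mean [F1 z]; that mean again varies by at most c in z, so Hoeffding's lemma supplies
    one more factor. *)
Lemma mcdiarmid_mgf (D : probability T R) n (F : seq T -> R) c s :
  bounded_differences c F ->
  measurable_fun setT (fun S : n.-tuple T => F S) -> 0 <= s ->
  \int[iid D n]_S expR (s * (F S - \int[iid D n]_S' F S')) <=
  expR (n%:R * (s ^+ 2 * c ^+ 2 / 8)).
Proof.
move=> bF mF s0; elim: n F bF mF => [|n IH] F bF mF.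
  rewrite (iid_sample0 D (fun S => F S)).
  rewrite (iid_sample0 D (fun S : 0.-tuple T => expR (s * (F S - F [::])))).
  by rewrite subrr mulr0 mul0r.
set mu := \int[iid D n.+1]_S' F S'.
have bmF := bounded_differences_bmeas bF mF.
pose G (p : T * n.-tuple T) := F (p.1 :: p.2).
have bG : bmeas G.
  by apply: (bmeas_comp _ bmF); exact: measurable_tuple_cons.
pose F1 z := \int[iid D n]_S F (z :: S).
have bF1 : bmeas F1 by exact: (bmeas_Rint2 D (iid D n) bG).
have muE : mu = \int[D]_z F1 z.
  by rewrite /mu Rint_iidS// (Rint_fubini1 D (iid D n) bG).
have F1c z z' : F1 z - F1 z' <= c.
  rewrite -RintB; [|exact: bmeas_pair2 bG|exact: bmeas_pair2 bG].
  rewrite -[leRHS](Rint_cst (iid D n)); apply: Rint_le.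
  - by apply: bmeasB; exact: bmeas_pair2 bG.
  - exact: bmeas_cst.
  - by move=> S; rewrite (le_trans (ler_norm _))//; exact: (bF [::]).
have bE : bmeas (fun S : n.+1.-tuple T => expR (s * (F S - mu))).
  by apply/bmeas_expR/bmeasZ/bmeasB => //; exact: bmeas_cst.
rewrite Rint_iidS//.
have bEG : bmeas (fun p : T * n.-tuple T => expR (s * (G p - mu))).
  by apply/bmeas_expR/bmeasZ/bmeasB => //; exact: bmeas_cst.
rewrite (Rint_fubini1 D (iid D n) bEG) /=.
have inner z : \int[iid D n]_S expR (s * (F (z :: S) - mu)) <=
    expR (n%:R * (s ^+ 2 * c ^+ 2 / 8)) * expR (s * (F1 z - mu)).
  have e S : expR (s * (F (z :: S) - mu)) =
      expR (s * (F1 z - mu)) * expR (s * (F (z :: S) - F1 z)).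
    by rewrite -expRD; congr expR; ring.
  under eq_Rintegral do rewrite e.
  rewrite RintZ; last first.
    apply/bmeas_expR/bmeasZ/bmeasB; last exact: bmeas_cst.
    exact: bmeas_pair2 bG.
  rewrite mulrC ler_wpM2r ?expR_ge0//.
  apply: (IH (fun S => F (z :: S))); first exact: bounded_differences_cons.
  exact: (bmeas_pair2 z bG).1.
apply: (@le_trans _ _ (\int[D]_z (expR (n%:R * (s ^+ 2 * c ^+ 2 / 8)) *
   expR (s * (F1 z - mu))))).
  apply: Rint_le => //; first exact: (bmeas_Rint2 D (iid D n) bEG).
  by apply/bmeasZ/bmeas_expR/bmeasZ/bmeasB => //; exact: bmeas_cst.
rewrite RintZ; last by apply/bmeas_expR/bmeasZ/bmeasB => //; exact: bmeas_cst.
rewrite -[n.+1%:R]natr1 mulrDl mul1r expRD ler_wpM2l ?expR_ge0//.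
by rewrite muE; apply: hoeffding => //; exact: bF1.1.
Qed.

End mcdiarmid.

(** * Symmetrization *)

(** Markov's inequality, read on the complement. The function is extended-valued because in the
    PAC-Bayes argument it is an integral over the prior that may be infinite for some samples. *)
Lemma measurable_lt_ge d (T : measurableType d) (R : realType) (P : probability T R)
    (f : T -> \bar R) (c delta : R) :
  measurable_fun setT f -> (forall x, 0 <= f x)%E -> 0 < c ->
  (\int[P]_x f x <= (c * delta)%:E)%E ->
  measurable [set x | (f x < c%:E)%E] /\
  ((1 - delta)%:E <= P [set x | (f x < c%:E)%E])%E.
Proof.
move=> mf f0 c0 fc.
have mE : measurable [set x | (c%:E <= f x)%E].
  by rewrite -[X in measurable X]setTI; exact: emeasurable_fun_c_infty.
have EC : [set x | (f x < c%:E)%E] = ~` [set x | (c%:E <= f x)%E].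
  by apply/seteqP; split => x /=; rewrite ltNge => /negP.
rewrite EC; split; first exact: measurableC.
rewrite probability_setC// EFinB leeB//.
have := le_integral_abse P measurableT mf c0.
rewrite setTI (_ : [set x | _] = [set x | (c%:E <= f x)%E]); last first.
  by apply/seteqP; split => x /=; rewrite gee0_abs.
under eq_integral do rewrite gee0_abs//.
move=> /le_trans/(_ fc); rewrite EFinM lee_pmul2l// ?lte_fin//.
Qed.

Lemma sup_range_ext (R : realType) (a b : nat -> R) :
  a =1 b -> sup (range a) = sup (range b).
Proof. by move=> /funext ->. Qed.

Lemma bdd0 (R : realType) : bdd (fun=> 0 : R).
Proof. by exists 0 => k; rewrite normr0. Qed.

Section rad_measurable.
Context d (T : measurableType d) (R : realType).
Implicit Types (a g : nat -> T -> R).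

(** A countable family of measurable functions with one common bound: taking the supremum over the
    index then stays inside [bmeas]. *)
Definition umeas a := (forall k, measurable_fun setT (a k)) /\
  exists M, forall k x, `|a k x| <= M.

Lemma umeas_bmeas a k : umeas a -> bmeas (a k).
Proof. by move=> [ma [M aM]]; split => //; exists M. Qed.

Lemma umeas_bdd a x : umeas a -> bdd (a ^~ x).
Proof. by move=> [_ [M aM]]; exists M. Qed.

Lemma umeas_sup a : umeas a -> bmeas (fun x => sup (range (a ^~ x))).
Proof. by move=> [ma [M aM]]; exact: bmeas_sup aM. Qed.

Lemma umeasD a g : umeas a -> umeas g -> umeas (fun k x => a k x + g k x).
Proof.
move=> [ma [M aM]] [mg [N gN]]; split=> [k|]; first exact: measurable_funD.
by exists (M + N) => k x; rewrite (le_trans (ler_normD _ _))// lerD.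
Qed.

Lemma umeasB a g : umeas a -> umeas g -> umeas (fun k x => a k x - g k x).
Proof.
move=> [ma [M aM]] [mg [N gN]]; split=> [k|]; first exact: measurable_funB.
by exists (M + N) => k x; rewrite (le_trans (ler_normB _ _))// lerD.
Qed.

Lemma umeasZ r a : umeas a -> umeas (fun k x => r * a k x).
Proof.
move=> [ma [M aM]]; split=> [k|]; first exact: measurable_funM.
by exists (`|r| * M) => k x; rewrite normrM ler_wpM2l.
Qed.

Lemma umeas_cst (b : nat -> R) : bdd b -> umeas (fun k (_ : T) => b k).
Proof. by move=> [M bM]; split=> [k|]; [exact: measurable_cst|exists M]. Qed.

Lemma bmeas_rad n (g : 'I_n -> nat -> T -> R) (s : seq 'I_n) a :
  (forall i, umeas (g i)) -> umeas a ->
  bmeas (fun x => rad [seq (fun k => g i k x) | i <- s] (a ^~ x)).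
Proof.
move=> ug; elim: s a => [|i s IH] a ua /=; first exact: umeas_sup.
rewrite (_ : (fun x => _) = fun x => 2^-1 *
   (rad [seq (fun k => g i0 k x) | i0 <- s] (fun k => a k x + g i k x) +
    rad [seq (fun k => g i0 k x) | i0 <- s] (fun k => a k x - g i k x))).
  by apply/bmeasZ/bmeasD; apply: IH; [exact: umeasD|exact: umeasB].
by apply/funext => x; rewrite mulrC.
Qed.

End rad_measurable.

Lemma umeas_comp d d' (T : measurableType d) (T' : measurableType d')
    (R : realType) (g : T' -> T) (a : nat -> T -> R) :
  measurable_fun setT g -> umeas a -> umeas (fun k x => a k (g x)).
Proof.
move=> mg [ma [M aM]]; split => [k|]; last by exists M => k x.
exact: measurableT_comp (ma k) mg.
Qed.

Section symmetrization.
Context d (T : measurableType d) (R : realType) (D : probability T R).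
Variable g : nat -> T -> R.
Hypothesis ug : umeas g.

Definition dev (a : nat -> R) (S : seq T) : R :=
  sup (range (fun k => a k + \sum_(z <- S) (\int[D]_z' g k z' - g k z))).

(** The factor 2 of symmetrization sits inside the functions, and g is meant to carry the factor
    1/n. The offset [a] is general because symmetrization proceeds one sample point at a time. *)
Definition rads (a : nat -> R) (S : seq T) : R :=
  rad [seq (fun k => 2 * g k z) | z <- S] a.

Lemma bdd_mean : bdd (fun k => \int[D]_z g k z).
Proof.
have [M gM] := ug.2; exists M => k.
by apply: Rint_bound => //; exact: umeas_bmeas.
Qed.

Lemma umeas_dev n a : bdd a ->
  umeas (fun k (S : n.-tuple T) =>
    a k + \sum_(z <- S) (\int[D]_z' g k z' - g k z)).
Proof.
move=> ba; apply: umeasD; first exact: umeas_cst.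
rewrite (_ : (fun k S => _) = fun k (S : n.-tuple T) =>
   \sum_(i < n) (\int[D]_z' g k z' - g k (tnth S i))); last first.
  by apply/funext => k; apply/funext => S; rewrite big_tuple.
have [M gM] := ug.2; split => [k|].
  apply: measurable_sum => i; apply: measurable_funB => //.
  by apply: (measurableT_comp (ug.1 k)); exact: measurable_tnth.
exists (\sum_(i < n) (M + M)) => k S.
rewrite (le_trans (ler_norm_sum _ _ _))//; apply: ler_sum => i _.
rewrite (le_trans (ler_normB _ _))// lerD//.
by apply: Rint_bound => //; exact: umeas_bmeas.
Qed.

Lemma bmeas_dev n a : bdd a -> bmeas (fun S : n.-tuple T => dev a S).
Proof. by move=> ba; apply: umeas_sup; exact: umeas_dev. Qed.

Lemma bmeas_rads n a : bdd a -> bmeas (fun S : n.-tuple T => rads a S).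
Proof.
move=> ba; rewrite (_ : (fun S : n.-tuple T => _) = fun S : n.-tuple T =>
   rad [seq (fun k => 2 * g k (tnth S i)) | i <- enum 'I_n] a).
  apply: (@bmeas_rad _ _ _ n (fun i k (S : n.-tuple T) => 2 * g k (tnth S i))
     _ (fun k _ => a k)); last exact: umeas_cst.
  by move=> i; apply: umeasZ; apply: (umeas_comp _ ug); exact: measurable_tnth.
apply/funext => S; rewrite /rads -[in LHS](map_tnth_enum S) -map_comp.
by [].
Qed.

(** Done coordinate by coordinate, without a ghost sample. With c the contribution of the other
    points, c + mu - g(z) is the half-sum of c + 2 mu and c - 2 g(z). The supremum of the first is
    at most the mean of sup (c + 2 g), and what results is the average over one sign; the induction
    hypothesis then handles the remaining points with that signed term in the offset. *)
Lemma symmetrization n a : bdd a ->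
  \int[iid D n]_S dev a S <= \int[iid D n]_S rads a S.
Proof.
elim: n a => [|n IH] a ba.
  rewrite (iid_sample0 D (fun S => dev a S)) (iid_sample0 D (fun S => rads a S)).
  rewrite /rads/= /dev /= le_eqVlt; apply/orP; left; apply/eqP.
  by apply: sup_range_ext => k; rewrite big_nil addr0.
rewrite !Rint_iidS; [|exact: bmeas_rads|exact: bmeas_dev].
pose mu k := \int[D]_z g k z; have bmu : bdd mu by exact: bdd_mean.
have bdevG : bmeas (fun p : T * n.-tuple T => dev a (p.1 :: p.2)).
  apply: (@bmeas_comp _ _ _ _ _ (@tuple_cons _ T n) (fun S => dev a S)).
    exact: measurable_tuple_cons.
  exact: bmeas_dev.
have bradG : bmeas (fun p : T * n.-tuple T => rads a (p.1 :: p.2)).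
  apply: (@bmeas_comp _ _ _ _ _ (@tuple_cons _ T n) (fun S => rads a S)).
    exact: measurable_tuple_cons.
  exact: bmeas_rads.
pose c k (S : n.-tuple T) := a k + \sum_(z <- S) (mu k - g k z).
have uc : umeas c by exact: umeas_dev.
have uc' : umeas (fun k (p : T * n.-tuple T) => c k p.2) by exact: umeas_comp uc.
have ug' : umeas (fun k (p : T * n.-tuple T) => 2 * g k p.1).
  by apply: umeasZ; exact: umeas_comp ug.
pose H1 (p : T * n.-tuple T) := sup (range (fun k => c k p.2 + 2 * g k p.1)).
pose H2 (p : T * n.-tuple T) := sup (range (fun k => c k p.2 - 2 * g k p.1)).
have bH1 : bmeas H1 by apply: umeas_sup; exact: umeasD.
have bH2 : bmeas H2 by apply: umeas_sup; exact: umeasB.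
have bH : bmeas (fun p => 2^-1 * (H1 p + H2 p)) by exact/bmeasZ/bmeasD.
rewrite (Rint_fubini2 D (iid D n) bdevG).
apply: (@le_trans _ _ (\int[iid D n]_S \int[D]_z (2^-1 * (H1 (z, S) + H2 (z, S))))).
  apply: Rint_le => [||S].
  - exact: (bmeas_Rint1 D (iid D n) bdevG).
  - exact: (bmeas_Rint1 D (iid D n) bH).
  rewrite RintZ ?RintD; [|exact: bmeas_pair1 bH1|exact: bmeas_pair1 bH2|
    by apply: bmeasD; [exact: bmeas_pair1 bH1|exact: bmeas_pair1 bH2]].
  set C := \int[D]_x H1 (x, S).
  have muC k : c k S + 2 * mu k <= C.
    rewrite -RintZ; last exact: umeas_bmeas.
    rewrite -[X in X + _](Rint_cst D) -RintD;
      [|exact: bmeas_cst|by apply: bmeasZ; exact: umeas_bmeas].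
    apply: Rint_le.
    - by apply: bmeasD; [exact: bmeas_cst|by apply: bmeasZ; exact: umeas_bmeas].
    - exact: bmeas_pair1 bH1.
    - move=> z; apply: (@le_sup_range _ (fun k => c k S + 2 * g k z)).
      apply: bddD; first exact: (umeas_bdd S uc).
      exact: (umeas_bdd z (umeasZ 2 ug)).
  have h z : dev a (z :: S) <= 2^-1 * (C + H2 (z, S)).
    apply: sup_range_le => k; rewrite big_cons -/(mu k).
    (* The half-sum decomposition: [muC] bounds the first part by [C] uniformly in k, and the second
       is a term of the supremum [H2]. *)
    have -> : a k + (mu k - g k z + \sum_(j <- S) (mu k - g k j)) =
      2^-1 * ((c k S + 2 * mu k) + (c k S - 2 * g k z)) by rewrite /c; field.
    rewrite ler_wpM2l// lerD//.
    apply: (@le_sup_range _ (fun k => c k S - 2 * g k z)).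
    apply: bddB; first exact: (umeas_bdd S uc).
    exact: (umeas_bdd z (umeasZ 2 ug)).
  apply: (@le_trans _ _ (\int[D]_z (2^-1 * (C + H2 (z, S))))).
    apply: Rint_le => //; first exact: bmeas_pair1 bdevG.
    by apply/bmeasZ/bmeasD; [exact: bmeas_cst|exact: bmeas_pair1 bH2].
  rewrite RintZ ?RintD ?Rint_cst//; [exact: bmeas_cst|exact: bmeas_pair1 bH2|].
  by apply: bmeasD; [exact: bmeas_cst|exact: bmeas_pair1 bH2].
rewrite -(Rint_fubini2 D (iid D n) bH) (Rint_fubini1 D (iid D n) bH).
rewrite (Rint_fubini1 D (iid D n) bradG).
apply: Rint_le => [||z].
- exact: (bmeas_Rint2 D (iid D n) bH).
- exact: (bmeas_Rint2 D (iid D n) bradG).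
have b2g : bdd (fun k => 2 * g k z) by exact: (umeas_bdd z (umeasZ 2 ug)).
have bap : bdd (a \+ (fun k => 2 * g k z)) by exact: bddD.
have bam : bdd (a \- (fun k => 2 * g k z)) by exact: bddB.
have e1 S : H1 (z, S) = dev (a \+ (fun k => 2 * g k z)) S.
  by apply: sup_range_ext => k; rewrite /c/= addrAC.
have e2 S : H2 (z, S) = dev (a \- (fun k => 2 * g k z)) S.
  by apply: sup_range_ext => k; rewrite /c/= addrAC.
have e3 (S : n.-tuple T) : rads a (z :: S) = 2^-1 *
   (rads (a \+ (fun k => 2 * g k z)) S + rads (a \- (fun k => 2 * g k z)) S).
  by rewrite /rads/= mulrC.
under eq_Rintegral do rewrite e1 e2.
under [leRHS]eq_Rintegral do rewrite e3.
rewrite !RintZ ?RintD; try (by [exact: bmeas_dev|exact: bmeas_rads]).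
- by rewrite ler_wpM2l// lerD// IH.
- by apply: bmeasD; exact: bmeas_rads.
- by apply: bmeasD; exact: bmeas_dev.
Qed.

Variable e : R.
Hypothesis ge : forall k z, `|g k z| <= e.

Lemma bounded_differences_dev : bounded_differences (2 * e) (dev (fun=> 0)).
Proof.
suff H s1 s2 z z' : dev (fun=> 0) (s1 ++ z :: s2) <=
    dev (fun=> 0) (s1 ++ z' :: s2) + 2 * e.
  move=> s1 s2 z z'; rewrite ler_norml.
  by have := H s1 s2 z z'; have := H s1 s2 z' z; lra.
apply: sup_range_le => k.
have bd : bdd (fun k => 0 + \sum_(y <- s1 ++ z' :: s2) (\int[D]_z0 g k z0 - g k y)).
  exact: (umeas_bdd (in_tuple (s1 ++ z' :: s2))
    (umeas_dev _ (bdd0 R))).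
apply: (@le_trans _ _
  (0 + \sum_(y <- s1 ++ z' :: s2) (\int[D]_z0 g k z0 - g k y) + 2 * e)).
  rewrite !big_cat !big_cons /=.
  have := ge k z; have := ge k z'; rewrite !ler_norml; lra.
rewrite lerD2r; exact: (le_sup_range k bd).
Qed.

Lemma bounded_differences_rads : bounded_differences (4 * e) (rads (fun=> 0)).
Proof.
suff H s1 s2 z z' a : bdd a -> rads a (s1 ++ z :: s2) <=
    rads a (s1 ++ z' :: s2) + 4 * e.
  have b0 := bdd0 R.
  move=> s1 s2 z z'; rewrite ler_norml.
  by have := H s1 s2 z z' _ b0; have := H s1 s2 z' z _ b0; lra.
have b2g y : bdd (fun k => 2 * g k y) by exact: (umeas_bdd y (umeasZ 2 ug)).
have bds s : bdds [seq (fun k => 2 * g k y) | y <- s].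
  by elim: s => //= y s IH; split.
elim: s1 a => [|y s1 IH] a ba; rewrite /rads /=.
  have h1 : rad [seq (fun k => 2 * g k y) | y <- s2] (a \+ (fun k => 2 * g k z))
    <= rad [seq (fun k => 2 * g k y) | y <- s2] (a \+ (fun k => 2 * g k z')) + 4 * e.
    apply: le_rad => //; first exact: bddD.
    by move=> k /=; have := ge k z; have := ge k z'; rewrite !ler_norml; lra.
  have h2 : rad [seq (fun k => 2 * g k y) | y <- s2] (a \- (fun k => 2 * g k z))
    <= rad [seq (fun k => 2 * g k y) | y <- s2] (a \- (fun k => 2 * g k z')) + 4 * e.
    apply: le_rad => //; first exact: bddB.
    by move=> k /=; have := ge k z; have := ge k z'; rewrite !ler_norml; lra.
  lra.
have := IH _ (bddD ba (b2g y)); have := IH _ (bddB ba (b2g y)).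
rewrite /rads; lra.
Qed.

(** Chernoff's argument for the difference of [dev] and [rads]: its mean is nonpositive by
    symmetrization, and one sample point changes it by at most 2 e + 4 e = 6 e. *)
Lemma uniform_deviation n s t delta : 0 <= s ->
  expR (n%:R * (s ^+ 2 * (6 * e) ^+ 2 / 8)) <= expR (s * t) * delta ->
  exists E : set (n.-tuple T),
    [/\ measurable E, ((1 - delta)%:E <= iid D n E)%E &
     forall S, E S -> dev (fun=> 0) S <= rads (fun=> 0) S + t].
Proof.
move=> s0 hdelta.
have b0 := bdd0 R.
pose X (S : seq T) := dev (fun=> 0) S - rads (fun=> 0) S.
have bX : bmeas (fun S : n.-tuple T => X S).
  by apply: bmeasB; [exact: bmeas_dev|exact: bmeas_rads].
have bdX : bounded_differences (6 * e) X.
  move=> s1 s2 z z'; rewrite /X.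
  have := bounded_differences_dev s1 s2 z z'.
  have := bounded_differences_rads s1 s2 z z'.
  rewrite !ler_norml; lra.
have EX : \int[iid D n]_S X S <= 0.
  by rewrite RintB ?subr_le0 ?symmetrization//; [exact: bmeas_dev|exact: bmeas_rads].
have bE : bmeas (fun S : n.-tuple T => expR (s * X S)) by exact/bmeas_expR/bmeasZ.
have mgf : \int[iid D n]_S expR (s * X S) <= expR (s * t) * delta.
  apply: le_trans hdelta; apply: le_trans (mcdiarmid_mgf D bdX bX.1 s0).
  apply: Rint_le => //.
    by apply/bmeas_expR/bmeasZ/bmeasB => //; exact: bmeas_cst.
  by move=> S; rewrite ler_expR ler_wpM2l// lerDl oppr_ge0.
have [||||mE PE] := @measurable_lt_ge _ _ _ (iid D n)
  (fun S => (expR (s * X S))%:E) (expR (s * t)) delta.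
- by apply/measurable_EFinP; exact: bE.1.
- by move=> S; rewrite lee_fin expR_ge0.
- exact: expR_gt0.
- by rewrite -EFin_Rintegral ?lee_fin//; exact: bmeas_integrable.
exists [set S | ((expR (s * X S))%:E < (expR (s * t))%:E)%E]; split => // S /=.
rewrite lte_fin ltr_expR /X => h.
suff : X S < t by rewrite /X; lra.
by rewrite ltNge; apply/negP => /(ler_wpM2l s0); rewrite leNgt h.
Qed.

End symmetrization.

(** * Gaussian measures and countable approximation *)

Section grid.
Variables (R : realType) (m : nat).
Implicit Types v w : 'rV[R]_m.

(** Index of the half-open cube of side 1/(k+1) containing v. The index type is countable, so
    preimages under cellwise constant functions are countable unions of measurable sets. *)
Definition grid (k : nat) v : 'rV[int]_m := \row_j Num.floor (k.+1%:R * v 0 j).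

Lemma grid_close k v w j : grid k v = grid k w ->
  `|v 0 j - w 0 j| <= k.+1%:R^-1.
Proof.
move=> /rowP/(_ j); rewrite !mxE => E.
have := floor_itv (k.+1%:R * v 0 j); have := floor_itv (k.+1%:R * w 0 j).
rewrite E intrD => /andP[w1 w2] /andP[v1 v2].
rewrite -(ler_pM2l (ltr0Sn R k)) mulfV ?pnatr_eq0//.
rewrite -[X in X * _](ger0_norm (ler0n R k.+1)) -normrM mulrBr ler_norml.
lra.
Qed.

Lemma cvg_grid (u : nat -> 'rV[R]_m) v :
  (forall k, grid k (u k) = grid k v) -> u @ \oo --> v.
Proof.
move=> uv; apply/cvg_ballP => e e0; near=> k; split => // i j; rewrite (ord1 i).
rewrite /ball/= (le_lt_trans (grid_close j (esym (uv k))))//.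
near: k; exact: near_infty_natSinv_lt (PosNum e0).
Unshelve. all: by end_near. Qed.

Lemma measurable_coord j : measurable_fun setT (fun v : 'rV[R]_m => v 0 j).
Proof.
move=> _ B mB; rewrite setTI; apply: sub_sigma_algebra.
rewrite -bigcup_seq; exists j => /=; first by rewrite mem_index_enum.
by exists B => //; rewrite setTI.
Qed.

Lemma measurable_grid k z : measurable [set v : 'rV[R]_m | grid k v = z].
Proof.
have -> : [set v : 'rV[R]_m | grid k v = z] =
    \bigcap_(j in [set: 'I_m]) [set v | Num.floor (k.+1%:R * v 0 j) = z 0 j].
  apply/seteqP; split => [v /= <- j _ /=|v /= h]; first by rewrite mxE.
  by apply/rowP => j; rewrite mxE; exact: h.
apply: fin_bigcap_measurable => // j _.
suff : measurable ([set: 'rV[R]_m] `&` (fun v => v 0 j) @^-1`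
    [set x | Num.floor (k.+1%:R * x) = z 0 j]) by rewrite setTI.
apply: measurable_coord => //.
have -> : [set x : R | Num.floor (k.+1%:R * x) = z 0 j] =
    [set` `[(z 0 j)%:~R / k.+1%:R, (z 0 j + 1)%:~R / k.+1%:R[%R].
  apply/seteqP; split => x /=; rewrite in_itv/= ler_pdivrMr ?ltr_pdivlMr//;
    rewrite ![x * _]mulrC.
    by move=> <-; exact: floor_itv.
  by move=> /floor_def.
exact: measurable_itv.
Qed.

(* A separately continuous/measurable function is the limit of its
   discretizations on a representative of each grid cell. *)
Lemma measurable_caratheodory d (T : measurableType d) (f : 'rV[R]_m -> T -> R) :
  (forall t, continuous (f^~ t)) -> (forall v, measurable_fun setT (f v)) ->
  measurable_fun setT (fun p : 'rV[R]_m * T => f p.1 p.2).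
Proof.
move=> cf mf; pose rep k (z : 'rV[int]_m) := xget (0 : 'rV[R]_m) [set v | grid k v = z].
have repE k v : grid k (rep k (grid k v)) = grid k v.
  by rewrite /rep; case: xgetP => [y _ //|/(_ v)/(_ erefl)].
apply: (@measurable_fun_cvg _ _ _ _
   (fun k (p : 'rV[R]_m * T) => f (rep k (grid k p.1)) p.2)) => [k|[v t] _ /=].
  move=> _ B mB; rewrite setTI.
  have -> : (fun p : 'rV[R]_m * T => f (rep k (grid k p.1)) p.2) @^-1` B =
    \bigcup_z ([set v | grid k v = z] `*` (f (rep k z) @^-1` B)).
    apply/seteqP; split => [[v t] /= h|[v t] [z _ [/= -> //]]].
    by exists (grid k v).
  apply: countable_bigcupT_measurable => // z; apply: measurableX.
    exact: measurable_grid.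
  by rewrite -[X in measurable X]setTI; exact: mf.
apply: (@cvg_comp _ _ _ (fun k => rep k (grid k v)) (f^~ t) _ (nbhs v)).
  exact: cvg_grid.
exact: cf.
Qed.

(** One point of A is picked in each cell of each mesh that meets A. Staying inside A matters: the
    bounds on the Jensen gap hold only for parameters in the ball. *)
Lemma exists_dense_seq (A : set 'rV[R]_m) : A !=set0 ->
  exists q : nat -> 'rV[R]_m, (forall k, A (q k)) /\
    forall w, A w -> exists s : nat -> nat, q \o s @ \oo --> w.
Proof.
move=> [w0 Aw0].
(* The point [w0] of A is the default, both for indices that code no pair and for cells that miss
   A. *)
pose q l := if (unpickle l : option ('rV[int]_m * nat)) is Some (z, k)
  then xget w0 (A `&` [set v | grid k v = z]) else w0.
exists q; split.
  move=> l; rewrite /q; case: unpickle => // -[z k].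
  by case: xgetP => [? ? []|].
move=> w Aw; exists (fun k => pickle (grid k w, k)).
apply: cvg_grid => k; rewrite /q /= pickleK.
by case: xgetP => [? ? []//|/(_ w)[]].
Qed.

End grid.

(** * First moment of the standard normal law *)

Section normal_mean.
Variable R : realType.
Local Notation mu := (@lebesgue_measure R).
Local Notation N01 := (@normal_prob R 0 1).

(** Change of variables produces the Radon-Nikodym density; it agrees almost everywhere with
    [normal_pdf] because both have the same integral over every measurable set. *)
Lemma ge0_integral_normal (f : R -> \bar R) :
  measurable_fun setT f -> (forall x, 0 <= f x)%E ->
  (\int[N01]_x f x = \int[mu]_x (f x * (normal_pdf 0 1 x)%:E))%E.
Proof.
move=> mf f0; have dom := normal_prob_dominates (0 : R) 1.
rewrite -(Radon_Nikodym_SigmaFinite.change_of_variables dom f0 measurableT mf).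
apply: ae_eq_integral => //.
- apply: emeasurable_funM => //.
  exact: measurable_int (Radon_Nikodym_SigmaFinite.f_integrable dom).
- apply: emeasurable_funM => //; apply/measurable_EFinP.
  exact: measurable_normal_pdf.
apply: ae_eqe_mul2l; apply: integral_ae_eq => //.
- exact: Radon_Nikodym_SigmaFinite.f_integrable.
- by apply/measurable_EFinP; exact: measurable_normal_pdf.
- by move=> E _ mE; rewrite -Radon_Nikodym_SigmaFinite.f_integral.
Qed.

(** The positive part of x, in a form whose continuity is immediate. Splitting x into two
    nonnegative pieces allows the reflection x -> - x before integrability is involved. *)
Let pospart (x : R) : R := (`|x| + x) / 2.

Let pospart_ge0 x : 0 <= pospart x.
Proof. by rewrite divr_ge0// -lerBlDr sub0r ler_normr lexx orbT. Qed.

Let pospartE x : x = pospart x - pospart (- x).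
Proof. by rewrite /pospart normrN; field. Qed.

Let continuous_pospart : continuous pospart.
Proof.
move=> x; apply: cvgM; last exact: cvg_cst.
by apply: cvgD; [exact: norm_continuous|exact: cvg_id].
Qed.

Let normal_pdfN x : normal_pdf 0 1 (- x) = normal_pdf 0 1 x :> R.
Proof.
by rewrite normal_pdfE ?oner_neq0// /normal_fun !subr0 sqrrN.
Qed.

Let continuous_pdf : continuous (@normal_pdf R 0 1).
Proof. by apply: continuous_normal_pdf; exact: oner_neq0. Qed.

Let measurable_pospart : measurable_fun setT pospart.
Proof. exact: continuous_measurable_fun. Qed.

Let measurable_pospartN : measurable_fun setT (fun x : R => pospart (- x)).
Proof. by apply: (measurableT_comp measurable_pospart); exact: measurable_funN. Qed.

Let normal_moment_sym :
  (\int[N01]_x (pospart x)%:E = \int[N01]_x (pospart (- x))%:E)%E.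
Proof.
rewrite !ge0_integral_normal//; try by move=> x; rewrite lee_fin.
  2,3: exact/measurable_EFinP.
pose G x := pospart (- x) * normal_pdf 0 1 x.
have cG : continuous G.
  move=> x; apply: cvgM; last exact: continuous_pdf.
  apply: (@continuous_comp _ _ _ -%R pospart); first exact: opp_continuous.
  exact: continuous_pospart.
have -> : (\int[mu]_x ((pospart (- x))%:E * (normal_pdf 0 1 x)%:E) =
    \int[mu]_(x in `]-oo, (- 0)%R]) (G x)%:E)%E.
  rewrite oppr0 [RHS]integral_mkcond; apply: eq_integral => x _.
  rewrite patchE; case: ifPn => // /negP; rewrite inE/= in_itv/= => /negP.
  rewrite -ltNge => x0.
  by rewrite /pospart normrN (gtr0_norm x0) subrr mul0r mul0e.
rewrite ge0_integration_by_substitutionNy; last 2 first.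
- exact: continuous_subspaceT.
- by move=> x _; rewrite mulr_ge0// normal_pdf_ge0.
rewrite [RHS]integral_mkcond; apply: eq_integral => x _.
rewrite patchE /G /=; case: ifPn => [_|/negP].
  by rewrite normal_pdfN opprK.
rewrite inE/= in_itv/= andbT => /negP; rewrite -ltNge => x0.
by rewrite /pospart ltr0_norm// addNr mul0r mul0e.
Qed.

(** Comparison with the normal density of variance 2: |x| <= 1 + x^2 / 4 <= exp (x^2 / 4), and this
    factor turns exp (- x^2 / 2) into exp (- x^2 / 4). The constant [C] is the ratio of the two
    peaks. *)
Let normal_moment_fin : (\int[N01]_x (`|x|)%:E < +oo)%E.
Proof.
have s2 : Num.sqrt 2 != 0 :> R by rewrite gt_eqF// sqrtr_gt0.
pose C : R := normal_peak 1 / normal_peak (Num.sqrt 2).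
have mabs : measurable_fun setT (fun x : R => `|x|).
  by apply: continuous_measurable_fun; exact: norm_continuous.
rewrite ge0_integral_normal//; last exact/measurable_EFinP.
apply: (@le_lt_trans _ _ (\int[mu]_x (C%:E * (normal_pdf 0 (Num.sqrt 2) x)%:E))%E).
  apply: ge0_le_integral => //.
  - by move=> x _; rewrite mule_ge0// lee_fin// normal_pdf_ge0.
  - apply: emeasurable_funM; apply/measurable_EFinP => //.
    exact: measurable_normal_pdf.
  - apply: emeasurable_funM => //; apply/measurable_EFinP.
    exact: measurable_normal_pdf.
  - move=> x _; rewrite -!EFinM lee_fin !normal_pdfE ?oner_neq0//.
    have -> y : C * (normal_peak (Num.sqrt 2) * y) = normal_peak 1 * y.
      by rewrite /C mulrA divfK// gt_eqF// normal_peak_gt0.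
    rewrite mulrCA ler_wpM2l ?normal_peak_ge0// /normal_fun !subr0.
    rewrite expr1n sqr_sqrtr//.
    have e : expR (- x ^+ 2 / (2 *+ 2)) =
        expR (x ^+ 2 / 4) * expR (- x ^+ 2 / (1 *+ 2)).
      by rewrite -expRD; congr expR; field.
    rewrite e ler_wpM2r ?expR_ge0//; apply: le_trans (expR_ge1Dx _).
    by have := sqr_ge0 (`|x| / 2 - 1); rewrite -(real_normK (num_real x)); nra.
rewrite integralZl//; last exact: integrable_normal_pdf.
by rewrite integral_normal_pdf mule1 ltry.
Qed.

Lemma integrable_normal_id : N01.-integrable setT (fun x : R => x%:E).
Proof.
apply/integrableP; split; last exact: normal_moment_fin.
by apply/measurable_EFinP; exact: measurable_id.
Qed.

Lemma integral_normal_id : (\int[N01]_x x%:E = 0)%E.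
Proof.
have ip : N01.-integrable setT (EFin \o pospart).
  apply: (le_integrable measurableT _ _ integrable_normal_id).
    exact/measurable_EFinP.
  move=> x _ /=; rewrite lee_fin ger0_norm// /pospart.
  by rewrite ler_pdivrMr// mulr_natr mulr2n lerD2l ler_norm.
have iN : N01.-integrable setT (EFin \o (fun x => pospart (- x))).
  apply: (le_integrable measurableT _ _ integrable_normal_id).
    exact/measurable_EFinP.
  move=> x _ /=; rewrite lee_fin ger0_norm// /pospart normrN.
  by rewrite ler_pdivrMr// mulr_natr mulr2n lerD2l -normrN ler_norm.
transitivity (\int[N01]_x (pospart x - pospart (- x))%:E)%E.
  by apply: eq_integral => x _; rewrite -pospartE.
rewrite integralB_EFin// [X in (X - _)%E]normal_moment_sym subee//.
exact: integrable_fin_num.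
Qed.

End normal_mean.

(** * Marginals of the product measure and Gaussian integrals *)

Section iid_coordinates.
Context d (T : measurableType d) (R : realType) (D : probability T R).

Lemma ge0_integral_iid_coord n (i : 'I_n) (f : T -> \bar R) :
  measurable_fun setT f -> (forall x, 0 <= f x)%E ->
  (\int[iid D n]_S f (tnth S i) = \int[D]_x f x)%E.
Proof.
move=> mf f0; elim: n i => [[]//|n IH] i.
rewrite ge0_integral_distribution//; last first.
  by apply: (measurableT_comp mf); exact: measurable_tnth.
have mfi : measurable_fun setT (fun p : T * n.-tuple T => f (tnth (tuple_cons p) i)).
  apply: (measurableT_comp mf).
  apply: (@measurableT_comp _ _ _ _ _ _ (fun S : n.+1.-tuple T => tnth S i)).
    exact: measurable_tnth.
  exact: measurable_tuple_cons.
rewrite [LHS](@fubini_tonelli1 _ _ _ _ _ D (iid D n)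
  (fun p => f (tnth (tuple_cons p) i)))//.
have [j ->|->] := unliftP ord0 i; last first.
  apply: eq_integral => x _.
  rewrite /fubini_F (eq_integral (fun=> f x)).
    by rewrite integral_cst// [X in (_ * X)%E]probability_setT mule1.
  by move=> S _; rewrite tnth0.
rewrite (eq_integral (fun=> (\int[D]_x f x)%E)).
  by rewrite integral_cst// [X in (_ * X)%E]probability_setT mule1.
move=> x _; rewrite /fubini_F -(IH j); apply: eq_integral => S _.
by rewrite tnthS.
Qed.

Lemma integrable_iid_coord n (i : 'I_n) (f : T -> \bar R) :
  D.-integrable setT f -> (iid D n).-integrable setT (fun S => f (tnth S i)).
Proof.
move=> /integrableP[mf fi]; apply/integrableP; split.
  by apply: (measurableT_comp mf); exact: measurable_tnth.
rewrite (ge0_integral_iid_coord i (f := fun x => `|f x|%E))//.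
exact: measurableT_comp.
Qed.

Lemma integral_iid_coord n (i : 'I_n) (f : T -> \bar R) :
  measurable_fun setT f ->
  (\int[iid D n]_S f (tnth S i) = \int[D]_x f x)%E.
Proof.
move=> mf; rewrite integralE [RHS]integralE.
have e : (fun S : n.-tuple T => f (tnth S i)) = f \o (fun S => tnth S i) by [].
rewrite e funepos_comp funeneg_comp; congr (_ - _)%E.
  exact: (ge0_integral_iid_coord i (measurable_funepos mf) (funepos_ge0 f)).
exact: (ge0_integral_iid_coord i (measurable_funeneg mf) (funeneg_ge0 f)).
Qed.

End iid_coordinates.

Section gaussian_integrals.
Variables (R : realType) (m : nat).
Implicit Types (w : 'rV[R]_m) (s : R).
Local Notation N01 := (normal_prob 0 1 : probability (measurableTypeR R) R).

(** Makes the first term of the Jensen gap under [gaussian w s] the value of the function at w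
    itself. *)
Lemma mean_gaussian w s : mean (gaussian w s) = w.
Proof.
apply/rowP => j; rewrite mxE /Rintegral.
have iN : (iid N01 m).-integrable setT (fun t => (tnth t j : R)%:E).
  exact: (integrable_iid_coord j (@integrable_normal_id R)).
have icst : (iid N01 m).-integrable setT (fun=> (w 0 j)%:E).
  exact: finite_measure_integrable_cst.
have isN : (iid N01 m).-integrable setT (fun t => s%:E * (tnth t j : R)%:E)%E.
  exact: integrableZl.
have e t : (gaussian_map w s t 0 j)%:E = ((w 0 j)%:E + s%:E * (tnth t j : R)%:E)%E.
  by rewrite !mxE.
rewrite integral_distribution.
- rewrite /comp; under eq_integral do rewrite e.
  rewrite integralD// -[X in (X + _)%E]EFin_Rintegral// Rint_cst integralZl//.
  rewrite (integral_iid_coord N01 j (f := fun x : R => x%:E)).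
    by rewrite integral_normal_id mule0 adde0.
  by apply/measurable_EFinP; exact: measurable_id.
- apply/measurable_EFinP; exact: measurable_coord.
- rewrite (_ : _ \o _ = fun t => (w 0 j)%:E + s%:E * (tnth t j : R)%:E)%E.
    exact: integrableD.
  by apply/funext => t /=; exact: e.
Qed.

Let shift w s (u : 'rV[R]_m) : 'rV[R]_m := w + s *: u.

Lemma measurable_shift w s : measurable_fun setT (shift w s).
Proof.
apply: measurable_fun_rV => i.
rewrite (_ : (fun t => _) = fun t : 'rV[R]_m => w 0 i + s * t 0 i).
  apply: measurable_funD => //; apply: measurable_funM => //.
  exact: measurable_coord.
by apply/funext => t; rewrite !mxE.
Qed.

Lemma gaussian_shiftE w s t : gaussian_map w s t = shift w s (gaussian_map 0 1 t).
Proof. by rewrite /gaussian_map /shift add0r scale1r. Qed.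

Lemma ge0_integral_gaussian w s (f : 'rV[R]_m -> \bar R) :
  measurable_fun setT f -> (forall v, 0 <= f v)%E ->
  (\int[gaussian w s]_v f v = \int[std_gaussian R m]_u f (w + s *: u)%R)%E.
Proof.
move=> mf f0; rewrite !ge0_integral_distribution//.
  by apply: eq_integral => t _; rewrite /= gaussian_shiftE.
exact: (measurableT_comp mf (measurable_shift w s)).
Qed.

Lemma integral_gaussian w s (f : 'rV[R]_m -> \bar R) :
  measurable_fun setT f ->
  (\int[gaussian w s]_v f v = \int[std_gaussian R m]_u f (w + s *: u)%R)%E.
Proof.
move=> mf; rewrite integralE [RHS]integralE.
have e : (fun u : 'rV[R]_m => f (w + s *: u)) = f \o (shift w s) by [].
rewrite e (funepos_comp f (shift w s)) (funeneg_comp f (shift w s)); congr (_ - _)%E.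
  exact: (ge0_integral_gaussian w s (measurable_funepos mf) (funepos_ge0 f)).
exact: (ge0_integral_gaussian w s (measurable_funeneg mf) (funeneg_ge0 f)).
Qed.

End gaussian_integrals.

Local Open Scope charge_scope.

(** * Change of measure and the PAC-Bayes bound *)

Section donsker_varadhan.
Context d (T : measurableType d) (R : realType) (Q P : probability T R).
Hypothesis QP : Q `<< P.

Let pdf (x : T) : R := fine (Radon_Nikodym_SigmaFinite.f Q P x).

Let pdfE x : (pdf x)%:E = Radon_Nikodym_SigmaFinite.f Q P x.
Proof. by rewrite fineK// Radon_Nikodym_SigmaFinite.f_fin_num. Qed.

Let pdf_ge0 x : 0 <= pdf x.
Proof. by rewrite -lee_fin pdfE; exact: Radon_Nikodym_SigmaFinite.f_ge0. Qed.

Let measurable_pdf : measurable_fun setT pdf.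
Proof.
apply/measurable_EFinP; rewrite (_ : _ \o _ = Radon_Nikodym_SigmaFinite.f Q P).
  exact: measurable_int (Radon_Nikodym_SigmaFinite.f_integrable QP).
by apply/funext => x /=; rewrite pdfE.
Qed.

(* The density with its zeros, a Q-null set, replaced by 1. *)
Let pos_pdf x : R := if pdf x <= 0 then 1 else pdf x.

Let pos_pdf_gt0 x : 0 < pos_pdf x.
Proof. by rewrite /pos_pdf; case: ifPn => //; rewrite -ltNge. Qed.

Let measurable_pos_pdf : measurable_fun setT pos_pdf.
Proof.
by apply: measurable_fun_ifT => //; exact: measurable_fun_ler.
Qed.

Let ldens x : R := ln (pos_pdf x).

Let measurable_ldens : measurable_fun setT ldens.
Proof. by apply: measurableT_comp => //; exact: measurable_ln. Qed.

Lemma null_dominates_ae (A : set T) : (\forall x \ae P, A x) -> (\forall x \ae Q, A x).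
Proof.
move=> [N [mN PN AN]]; exists N; split => //.
by apply/measure0_null_setP => //; apply: QP; exact/measure0_null_setP.
Qed.

(** The density in [KL] and the one used in this section agree P-almost everywhere, hence Q-almost
    everywhere. The set where the density vanishes is Q-null, so replacing it there by 1 leaves the
    integral unchanged. *)
Let KL_ldens : KL Q P = (\int[Q]_x (ldens x)%:E)%E.
Proof.
rewrite /KL; case: asboolP => // _.
set f := 'd _ '/d P.
have mf : measurable_fun setT f by exact: measurable_int (Radon_Nikodym_integrable _).
have mfr : measurable_fun setT (fun x => fine (f x)) by exact: measurableT_comp.
have fE x : f x = (fine (f x))%:E by rewrite fineK// Radon_Nikodym_fin_num.
apply: ae_eq_integral => //.
- rewrite (_ : (fun x => _) = fun x => if fine (f x) <= 0 then -oo%E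
     else (ln (fine (f x)))%:E).
    apply: measurable_fun_ifT => //; first exact: measurable_fun_ler.
    by apply/measurable_EFinP/measurableT_comp => //; exact: measurable_ln.
  by apply/funext => x; rewrite {1}fE.
- exact/measurable_EFinP.
have h1 : \forall x \ae Q, f x = (pdf x)%:E.
  apply: null_dominates_ae.
  have := ae_eq_Radon_Nikodym_SigmaFinite QP measurableT.
  by apply: filterS => x /(_ I); rewrite -pdfE => ->.
have mE : measurable [set x | pdf x <= 0].
  rewrite (_ : [set x | _] = setT `&` pdf @^-1` `]-oo, 0]).
    by apply: measurable_pdf => //; exact: measurable_itv.
  by rewrite setTI; apply/seteqP; split => x /=; rewrite in_itv.
have h2 : \forall x \ae Q, 0 < pdf x.
  exists [set x | pdf x <= 0]; split => //.
  - rewrite (Radon_Nikodym_SigmaFinite.f_integral QP mE).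
    apply: integral0_eq => x /= px; rewrite -pdfE; congr EFin.
    by apply/eqP; rewrite eq_le px pdf_ge0.
  - by move=> x /= /negP; rewrite -leNgt.
apply: filterS2 h1 h2 => x fx px _; rewrite fx lne_EFin// /ldens /pos_pdf.
by rewrite leNgt px.
Qed.

Let weight (phi : T -> R) x : R := expR (phi x) / pos_pdf x.

Let weight_ge0 phi x : 0 <= weight phi x.
Proof. by rewrite divr_ge0 ?expR_ge0// ltW. Qed.

Let measurable_weight phi : measurable_fun setT phi ->
  measurable_fun setT (weight phi).
Proof.
move=> mphi; rewrite (_ : weight phi = fun x => expR (phi x - ldens x)).
  by apply: measurableT_comp => //; exact: measurable_funB.
by apply/funext => x; rewrite /weight /ldens expRD expRN lnK ?posrE ?pos_pdf_gt0.
Qed.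

(** With f = dQ/dP, the product f * weight equals exp phi where f > 0 and vanishes where f = 0, so
    in all cases it is at most exp phi. *)
Let integral_weight_le phi Z : measurable_fun setT phi ->
  (\int[P]_x (expR (phi x))%:E <= Z)%E -> (\int[Q]_x (weight phi x)%:E <= Z)%E.
Proof.
move=> mphi; apply: le_trans; have mw := measurable_weight mphi.
rewrite -(Radon_Nikodym_SigmaFinite.change_of_variables QP)//; last 2 first.
- by move=> x; rewrite lee_fin.
- exact/measurable_EFinP.
apply: ge0_le_integral => //.
- by move=> x _; rewrite -pdfE lee_fin mulr_ge0.
- apply: emeasurable_funM; first exact/measurable_EFinP.
  exact: measurable_int (Radon_Nikodym_SigmaFinite.f_integrable QP).
- by apply/measurable_EFinP/measurableT_comp.
- move=> x _; rewrite -pdfE lee_fin /weight /pos_pdf; case: ifPn => [px|].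
    by rewrite divr1 ler_piMr ?expR_ge0// (le_trans px).
  by rewrite -ltNge => px; rewrite divfK// gt_eqF.
Qed.

Let pointwise phi Z x : 0 < Z ->
  phi x <= ldens x + (Z^-1 * weight phi x + (ln Z - 1)).
Proof.
move=> Z0; have t0 : 0 < Z^-1 * weight phi x.
  by rewrite mulr_gt0 ?invr_gt0// divr_gt0 ?expR_gt0.
have := @le_ln1Dx _ (Z^-1 * weight phi x - 1).
rewrite ltrBrDr addNr => /(_ t0); rewrite addrC subrK.
rewrite lnM ?posrE ?invr_gt0 ?divr_gt0 ?expR_gt0// lnV ?posrE//.
rewrite ln_div ?posrE ?expR_gt0// expRK /ldens; lra.
Qed.

Let integrable_weight phi Z : measurable_fun setT phi ->
  (\int[P]_x (expR (phi x))%:E <= Z%:E)%E ->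
  Q.-integrable setT (EFin \o weight phi).
Proof.
move=> mphi Zphi; apply/integrableP; split.
  by apply/measurable_EFinP; exact: measurable_weight.
under eq_integral do rewrite /= ger0_norm//.
by apply: le_lt_trans (ltry Z); exact: integral_weight_le.
Qed.

(* Integrate ln t <= t - 1 at t = e^phi / (f Z), f = dQ/dP, against Q. *)
Lemma donsker_varadhan : KL Q P = +oo%E \/
  exists2 K : R, KL Q P = K%:E &
    forall phi Z, measurable_fun setT phi -> 0 < Z ->
      (\int[P]_x (expR (phi x))%:E <= Z%:E)%E ->
      ((forall x, 0 <= phi x) -> Q.-integrable setT (EFin \o phi)) /\
      (Q.-integrable setT (EFin \o phi) -> \int[Q]_x phi x <= K + ln Z).
Proof.
(* The case phi = 0, Z = 1 of [pointwise] bounds the negative part of the log-density by an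
   integrable weight. Hence the divergence is either +oo or the integral of an integrable
   function. *)
have iw0 : Q.-integrable setT (EFin \o weight (fun=> 0)).
  apply: (@integrable_weight _ 1) => //.
  by rewrite integral_cst// [X in (_ * X)%E]probability_setT expR0 mule1.
have lneg x : (((EFin \o ldens)^\- x) <= (weight (fun=> 0) x)%:E)%E.
  rewrite funenegE /= ge_max !lee_fin weight_ge0 andbT.
  by have := pointwise (fun=> 0) x ltr01; rewrite invr1 mul1r ln1; lra.
have intneg : (\int[Q]_x (EFin \o ldens)^\- x < +oo)%E.
  apply: (@le_lt_trans _ _ (\int[Q]_x (weight (fun=> 0) x)%:E)%E).
    apply: ge0_le_integral => //.
    - by apply: measurable_funeneg; exact/measurable_EFinP.
    - by apply/measurable_EFinP; exact: measurable_weight.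
  by apply: integrable_lty.
have [posy|pos_lty] := eqVneq (\int[Q]_x (EFin \o ldens)^\+ x)%E +oo%E.
  left; rewrite KL_ldens integralE posy.
  by rewrite addye// -ltNye ltNye_eq; move: intneg; case: (integral _ _ _).
right.
have il : Q.-integrable setT (EFin \o ldens).
  apply/integrableP; split; first exact/measurable_EFinP.
  rewrite (eq_integral (fun x => (EFin \o ldens)^\+ x + (EFin \o ldens)^\- x)%E).
    rewrite ge0_integralD//.
    - by rewrite lte_add_pinfty// ltey.
    - by apply: measurable_funepos; exact/measurable_EFinP.
    - by apply: measurable_funeneg; exact/measurable_EFinP.
  by move=> x _; rewrite -[RHS]/((_ \+ _) x)%E -fune_abse.
exists (\int[Q]_x ldens x); first by rewrite KL_ldens EFin_Rintegral.
move=> phi Z mphi Z0 Zphi.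
have iw := integrable_weight mphi Zphi.
have iZw : Q.-integrable setT (EFin \o (fun x => Z^-1 * weight phi x)).
  exact: (integrableZl measurableT Z^-1 iw).
have ic : Q.-integrable setT (EFin \o (fun=> ln Z - 1)).
  exact: finite_measure_integrable_cst.
have iU1 : Q.-integrable setT (EFin \o (fun x => Z^-1 * weight phi x + (ln Z - 1))).
  exact: (integrableD measurableT iZw ic).
have iU : Q.-integrable setT
    (EFin \o (fun x => ldens x + (Z^-1 * weight phi x + (ln Z - 1)))).
  exact: (integrableD measurableT il iU1).
split=> [phi0|iphi].
  apply: (le_integrable measurableT _ _ iU); first exact/measurable_EFinP.
  move=> x _ /=; rewrite lee_fin ger0_norm//.
  by rewrite (le_trans _ (ler_norm _))// pointwise.
apply: (le_trans (le_Rintegral measurableT iphi iU (fun x _ => pointwise phi x Z0))).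
rewrite RintegralD// RintegralD// RintegralZl// Rint_cst.
rewrite lerD2l.
suff : Z^-1 * \int[Q]_x weight phi x <= 1 by lra.
rewrite mulrC ler_pdivrMr// mul1r -lee_fin EFin_Rintegral//.
exact: integral_weight_le.
Qed.

End donsker_varadhan.

(** Positive and negative parts are integrated by Tonelli and recombined through [fine], in
    agreement with the convention of [Rintegral] for infinite values. *)
Lemma measurable_Rintegral2 d1 d2 (T1 : measurableType d1) (T2 : measurableType d2)
    (R : realType) (P2 : probability T2 R) (f : T1 * T2 -> R) :
  measurable_fun setT f -> measurable_fun setT (fun x => \int[P2]_y f (x, y)).
Proof.
move=> mf; have mEf : measurable_fun setT (EFin \o f) by exact/measurable_EFinP.
have mp : measurable_fun setT (fubini_F P2 (EFin \o f)^\+%E).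
  by apply: measurable_fun_fubini_tonelli_F => //; exact: measurable_funepos.
have mn : measurable_fun setT (fubini_F P2 (EFin \o f)^\-%E).
  by apply: measurable_fun_fubini_tonelli_F => //; exact: measurable_funeneg.
rewrite (_ : (fun x => _) = fun x =>
   fine (fubini_F P2 (EFin \o f)^\+%E x - fubini_F P2 (EFin \o f)^\-%E x)%E).
  by apply: measurableT_comp => //; exact: emeasurable_funB.
apply/funext => x; rewrite /Rintegral integralE.
have e : (fun y => (f (x, y))%:E) = (EFin \o f) \o pair x by [].
by rewrite e (funepos_comp (EFin \o f) (pair x)) (funeneg_comp (EFin \o f) (pair x)).
Qed.

Lemma Rint_iid_sum d (T : measurableType d) (R : realType) (D : probability T R)
    n (f : T -> R) : bmeas f ->
  \int[iid D n]_S (\sum_(z <- S) f z) = n%:R * \int[D]_z f z.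
Proof.
move=> bf; have bsum k : bmeas (fun S : k.-tuple T => \sum_(z <- S) f z).
  have [M fM] := bf.2; split.
    rewrite (_ : (fun S => _) = fun S : k.-tuple T => \sum_(i < k) f (tnth S i)).
      apply: measurable_sum => i; apply: (measurableT_comp bf.1).
      exact: measurable_tnth.
    by apply/funext => S; rewrite big_tuple.
  exists (\sum_(i < k) M) => S; rewrite big_tuple (le_trans (ler_norm_sum _ _ _))//.
  by apply: ler_sum.
elim: n => [|n IH].
  by rewrite (iid_sample0 D (fun S => \sum_(z <- S) f z)) big_nil mul0r.
rewrite Rint_iidS// (@eq_Rintegral _ _ _ _ _ 
  (fun p : T * n.-tuple T => f p.1 + \sum_(z <- p.2) f z)).
  have b1 : bmeas (fun p : T * n.-tuple T => f p.1) by exact: bmeas_comp bf.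
  have b2 : bmeas (fun p : T * n.-tuple T => \sum_(z <- p.2) f z).
    exact: (@bmeas_comp _ _ _ _ _ snd (fun S : n.-tuple T => \sum_(z <- S) f z)).
  rewrite RintD// (Rint_fubini2 D (iid D n) b1) (Rint_fubini1 D (iid D n) b2) /=.
  by rewrite !Rint_cst IH -[n.+1%:R]natr1 mulrDl mul1r addrC.
by move=> p _; rewrite big_cons.
Qed.

(** * PAC-Bayes inequality with an envelope depending on the parameter *)

Section pac_bayes.
Context d dW (T : measurableType d) (W : measurableType dW) (R : realType).
Variables (D : probability T R) (P : probability W R) (n : nat).
Variables (loss : W -> T -> R) (l0 : R) (b : W -> R) (delta lambda : R).
Hypothesis n0 : (0 < n)%N.
Hypothesis mloss : measurable_fun setT (fun p : W * T => loss p.1 p.2).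
Hypothesis mb : measurable_fun setT b.
Hypothesis lossb : forall v z, `|loss v z - l0| <= b v.
Hypothesis delta0 : 0 < delta.
Hypothesis lambda0 : 0 < lambda.

Definition mean_loss v : R := \int[D]_z loss v z.
Definition sample_loss (S : n.-tuple T) v : R :=
  n%:R^-1 * \sum_(i < n) loss v (tnth S i).

Let gap (S : n.-tuple T) v := mean_loss v - sample_loss S v.

(** The McDiarmid exponent n (lambda^2 c^2 / 8) of a sample mean, where one point changes it by at
    most c = 2 b v / n. *)
Definition log_mgf v : R := lambda ^+ 2 * b v ^+ 2 / (2 * n%:R).

Let bloss v : bmeas (loss v).
Proof.
split; first exact: measurable_fun_pair2 mloss.
exists (`|l0| + b v) => z; rewrite -(subrK l0 (loss v z)) addrC.
by rewrite (le_trans (ler_normD _ _))// lerD2l.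
Qed.

Let measurable_mean_loss : measurable_fun setT mean_loss.
Proof. exact: (measurable_Rintegral2 D mloss). Qed.

Let measurable_gap : measurable_fun setT
  (fun p : n.-tuple T * W => gap p.1 p.2).
Proof.
apply: measurable_funB; first exact: measurableT_comp.
apply: measurable_funM => //; apply: measurable_sum => i.
have mti : measurable_fun setT (fun p : n.-tuple T * W => tnth p.1 i).
  apply: (@measurableT_comp _ _ _ _ _ _ (fun S : n.-tuple T => tnth S i)) => //.
  exact: measurable_tnth.
exact: (measurableT_comp mloss (measurable_fun_pair measurable_snd mti)).
Qed.

Let b_ge0 v : 0 <= b v.
Proof. by apply: le_trans (lossb v point). Qed.

Let mgf v : (\int[iid D n]_S (expR (lambda * gap S v))%:E <=
  (expR (log_mgf v))%:E)%E.
Proof.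
(* The sign makes F minus its mean equal to the gap, so the upper exponential moment is the one that
   is needed. *)
pose F (s : seq T) := - (n%:R^-1 * \sum_(z <- s) loss v z).
have n0R : n%:R != 0 :> R by rewrite pnatr_eq0 -lt0n.
have bF : bounded_differences (2 * b v / n%:R) F.
  move=> s1 s2 z z'; rewrite /F !big_cat !big_cons /=.
  rewrite (_ : _ - _ = n%:R^-1 * ((loss v z' - l0) - (loss v z - l0))); last by ring.
  rewrite normrM ger0_norm ?invr_ge0// mulrC ler_wpM2r ?invr_ge0//.
  rewrite (le_trans (ler_normB _ _))//.
  by have := lossb v z; have := lossb v z'; lra.
have mF : measurable_fun setT (fun S : n.-tuple T => F S).
  rewrite (_ : (fun S => _) = fun S : n.-tuple T => - (n%:R^-1 * \sum_(i < n) loss v (tnth S i))).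
    apply: measurable_funN; apply: measurable_funM => //; apply: measurable_sum => i.
    by apply: (measurableT_comp (bloss v).1); exact: measurable_tnth.
  by apply/funext => S; rewrite /F big_tuple.
have bmF := bounded_differences_bmeas bF mF.
have bsum : bmeas (fun S : n.-tuple T => \sum_(z <- S) loss v z).
  rewrite (_ : (fun S => _) = fun S : n.-tuple T => - n%:R * F S).
    exact: bmeasZ.
  by apply/funext => S; rewrite /F; field.
have EF : \int[iid D n]_S F S = - mean_loss v.
  rewrite (@eq_Rintegral _ _ _ _ _ 
    (fun S : n.-tuple T => - n%:R^-1 * \sum_(z <- S) loss v z)).
    by rewrite RintZ// Rint_iid_sum// mulNr mulKf.
  by move=> S _; rewrite /F mulNr.
have := mcdiarmid_mgf D bF mF (ltW lambda0); rewrite EF => h.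
rewrite (_ : log_mgf v = n%:R * (lambda ^+ 2 * (2 * b v / n%:R) ^+ 2 / 8)); last first.
  by rewrite /log_mgf; field.
have gapE S : gap S v = F S - - mean_loss v.
  by rewrite /gap /sample_loss /F big_tuple; ring.
under eq_integral do rewrite gapE.
rewrite -EFin_Rintegral ?lee_fin//; apply: bmeas_integrable.
by apply/bmeas_expR/bmeasZ/bmeasB => //; exact: bmeas_cst.
Qed.

Let Z0 := (\int[P]_v (expR (log_mgf v))%:E)%E.

Let measurable_log_mgf : measurable_fun setT log_mgf.
Proof.
rewrite (_ : log_mgf = fun v => lambda ^+ 2 / (2 * n%:R) * (b v ^+ 2)).
  by apply: measurable_funM => //; apply: measurable_funX.
by apply/funext => v; rewrite /log_mgf mulrAC.
Qed.

(** The event only compares the prior integral of exp (lambda gap) with 2 / delta times [Z0], so it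
    does not depend on Q and the conclusion is uniform in Q. Tonelli and [mgf] bound the expectation
    of that integral by [Z0], and Markov's inequality gives the probability. In the finite case
    integrability of b under Q is exported, since the later use of Fubini rests on it. *)
Lemma pac_bayes : exists E : set (n.-tuple T),
  [/\ measurable E, ((1 - delta / 2)%:E <= iid D n E)%E &
   forall S, E S -> forall Q : probability W R,
     [\/ KL Q P = +oo%E, Z0 = +oo%E |
      exists K z0, [/\ KL Q P = K%:E, Z0 = z0%:E, 0 < z0,
        Q.-integrable setT (EFin \o b) &
        \int[Q]_v (mean_loss v - sample_loss S v) <=
          lambda^-1 * (K + ln (2 / delta * z0))]]].
Proof.
have [Zy|ZNy] := eqVneq Z0 +oo%E.
  exists setT; split=> [||S _ Q]; last by constructor 2.
    exact: measurableT.
  by rewrite probability_setT lee_fin gerBl divr_ge0// ltW.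
have Z0ge : (1 <= Z0)%E.
  rewrite -[leLHS](@probability_setT _ _ _ P) -[leLHS]mul1e -integral_cst//.
  apply: ge0_le_integral => //.
    by apply/measurable_EFinP/measurableT_comp.
  move=> v _; rewrite lee_fin -expR0 ler_expR /log_mgf.
  by rewrite divr_ge0// mulr_ge0// ?sqr_ge0.
have [z0 Z0E] : exists z0, Z0 = z0%:E.
  by move: ZNy Z0ge; case: Z0 => [r _ _|//|//]; exists r.
have z0_gt0 : 0 < z0 by rewrite (lt_le_trans ltr01)// -lee_fin -Z0E.
pose f (S : n.-tuple T) := (\int[P]_v (expR (lambda * gap S v))%:E)%E.
have mG : measurable_fun setT (fun p : n.-tuple T * W => (expR (lambda * gap p.1 p.2))%:E).
  apply/measurable_EFinP; apply: measurableT_comp => //.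
  exact: (measurable_funM (measurable_cst lambda) measurable_gap).
have G0 (p : n.-tuple T * W) : (0 <= (expR (lambda * gap p.1 p.2))%:E)%E.
  by rewrite lee_fin expR_ge0.
have mf : measurable_fun setT f := measurable_fun_fubini_tonelli_F _ mG G0.
have f0 S : (0 <= f S)%E by apply: integral_ge0 => v _; rewrite lee_fin expR_ge0.
have c0 : 0 < 2 / delta * z0 by rewrite mulr_gt0// divr_gt0.
have [||||mE PE] := @measurable_lt_ge _ _ _ (iid D n) f (2 / delta * z0) (delta / 2).
- exact: mf.
- exact: f0.
- exact: c0.
- have -> : 2 / delta * z0 * (delta / 2) = z0 by field; rewrite gt_eqF.
  rewrite /f (fubini_tonelli (fun p : n.-tuple T * W => (expR (lambda * gap p.1 p.2))%:E))//=.
  rewrite -Z0E; apply: ge0_le_integral => //.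
  + by move=> v _; apply: integral_ge0 => S _; rewrite lee_fin expR_ge0.
  + exact: (measurable_fun_fubini_tonelli_G _ mG G0).
  + by apply/measurable_EFinP/measurableT_comp.
exists [set S | (f S < (2 / delta * z0)%:E)%E]; split => // S /= fS Q.
have [QP|NQP] := pselect (Q `<< P); last first.
  by constructor 1; rewrite /KL; case: asboolP.
have [->|[K KLE DV]] := donsker_varadhan QP; first by constructor 1.
constructor 3; exists K, z0.
have mgapS : measurable_fun setT (gap S) := measurable_fun_pair2 S measurable_gap.
have ib : Q.-integrable setT (EFin \o b).
  have i2 : Q.-integrable setT (EFin \o log_mgf).
    have [|+ _] := DV log_mgf z0 measurable_log_mgf z0_gt0; first by rewrite -Z0E.
    by apply=> v; rewrite /log_mgf divr_ge0// mulr_ge0// ?sqr_ge0.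
  (* This constant turns [log_mgf] back into b^2, and (b - 1/2)^2 >= 0 gives b <= 1 + b^2. Thus
     integrability of the exponent carries over to b. *)
  pose c := 2 * n%:R / lambda ^+ 2.
  have ic : Q.-integrable setT (EFin \o (fun v => 1 + c * log_mgf v)).
    have i1 : Q.-integrable setT (EFin \o (fun=> 1)).
      exact: finite_measure_integrable_cst.
    exact: (integrableD measurableT i1 (integrableZl measurableT c i2)).
  apply: (le_integrable measurableT _ _ ic); first exact/measurable_EFinP.
  move=> v _ /=; rewrite lee_fin ger0_norm// (le_trans _ (ler_norm _))//.
  have -> : c * log_mgf v = b v ^+ 2.
    rewrite /c /log_mgf; field.
    by rewrite pnatr_eq0 -lt0n n0 gt_eqF.
  have := sqr_ge0 (b v - 1 / 2); nra.
have igap : Q.-integrable setT (EFin \o (fun v => lambda * gap S v)).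
  apply: (@le_integrable _ _ _ _ _ measurableT _ (EFin \o (fun v => lambda * (2 * b v)))).
  - by apply/measurable_EFinP; exact: measurable_funM.
  - move=> v _ /=; rewrite lee_fin normrM gtr0_norm//.
    rewrite (le_trans _ (ler_norm _))// ler_wpM2l ?(ltW lambda0)//.
    have n0R : n%:R != 0 :> R by rewrite pnatr_eq0 -lt0n.
    have -> : gap S v = (mean_loss v - l0) - (sample_loss S v - l0) by rewrite /gap; ring.
    rewrite (le_trans (ler_normB _ _))// mulr2n mulrDl mul1r lerD//.
      rewrite /mean_loss -[X in _ - X](Rint_cst D) -RintB//; last exact: bmeas_cst.
      by apply: Rint_bound => //; apply: bmeasB => //; exact: bmeas_cst.
    have -> : sample_loss S v - l0 = n%:R^-1 * \sum_(i < n) (loss v (tnth S i) - l0).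
      rewrite sumrB mulrBr /sample_loss sumr_const card_ord.
      by rewrite -[l0 *+ n]mulr_natl mulKf.
    rewrite normrM ger0_norm ?invr_ge0//.
    rewrite mulrC ler_pdivrMr ?ltr0n//.
    rewrite (le_trans (ler_norm_sum _ _ _))//.
    rewrite (le_trans (ler_sum _ (fun i _ => lossb v (tnth S i))))//.
    by rewrite sumr_const card_ord mulr_natr.
  - exact: (integrableZl measurableT lambda (integrableZl measurableT 2 ib)).
split => //.
have [_ /(_ igap)] := DV (fun v => lambda * gap S v) (2 / delta * z0)
  (measurable_funM (measurable_cst _) mgapS) c0 (ltW fS).
have ig : Q.-integrable setT (EFin \o gap S).
  have := integrableZl measurableT lambda^-1 igap; apply: eq_integrable => //.
  by move=> v _ /=; rewrite -EFinM mulKf// gt_eqF.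
rewrite RintegralZl// => h.
by rewrite mulrC ler_pdivlMr// mulrC.
Qed.

End pac_bayes.

Local Close Scope charge_scope.

(** * Gradient of the Jensen gap *)

Section gradient_calculus.
Variable R : realType.

Lemma is_derive_line (m : nat) (V : normedModType R) (f : 'rV[R]_m -> V)
    (a v : 'rV[R]_m) (t : R) :
  differentiable f (a + t *: v) ->
  is_derive t (1 : R) (fun s => f (a + s *: v)) ('d f (a + t *: v) v).
Proof.
move=> df.
pose line : R -> 'rV[R]_m := cst a + ( *:%R ^~ v).
have dl : is_diff t line (0 + ( *:%R ^~ v)) by apply: is_diffD.
have dc : is_diff t (f \o line) ('d f (a + t *: v) \o (0 + ( *:%R ^~ v))).
  by apply: is_diff_comp; apply: DiffDef.
apply: DeriveDef; first exact: diff_derivable.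
rewrite deriveE// (_ : (fun s => f (a + s *: v)) = f \o line)//.
by rewrite diff_val /= fctE add0r scale1r.
Qed.

Lemma rV_sum_delta (m : nat) (v : 'rV[R]_m) : v = \sum_j v 0 j *: delta_mx 0 j.
Proof.
apply/rowP => k; rewrite summxE (bigD1 k)//= !mxE !eqxx mulr1 big1 ?addr0//.
by move=> j jk; rewrite !mxE eq_sym (negbTE jk) andbF mulr0.
Qed.

Lemma dot_gradient (m : nat) (f : 'rV[R]_m -> R) (w v : 'rV[R]_m) :
  differentiable f w -> 'd f w v = dot v (gradient f w).
Proof.
move=> df; rewrite {1}[v]rV_sum_delta linear_sum /dot; apply: eq_bigr => j _.
by rewrite linearZ/= mxE deriveE.
Qed.

Lemma is_diff_coord (C : nat) (k : 'I_C) (z : 'rV[R]_C) :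
  is_diff z (fun v : 'rV[R]_C => v 0 k) (fun v => v 0 k).
Proof.
pose c : 'rV[R]_C -> R := fun v => v 0 k.
have lc : linear c by move=> s x y; rewrite /c !mxE.
pose cL := GRing.isLinear.Build R _ R _ c lc.
pose CL : {linear 'rV[R]_C -> R} := HB.pack c cL.
have cc : continuous CL by exact: coord_continuous.
apply: (@DiffDef _ _ _ _ _ CL); first exact: linear_differentiable.
by rewrite diff_lin.
Qed.

Lemma diff_coord (m C : nat) (f : 'rV[R]_m -> 'rV[R]_C) (k : 'I_C) w :
  differentiable f w ->
  is_diff w (fun v => f v 0 k) (fun u => 'd f w u 0 k).
Proof.
move=> df; have dc := is_diff_coord k (f w).
have dfw : is_diff w f ('d f w) by exact: DiffDef.
exact: is_diff_comp dfw dc.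
Qed.

Lemma enormZ (n : nat) (t : R) (u : 'rV[R]_n) : enorm (t *: u) = `|t| * enorm u.
Proof.
rewrite -sqrtr_sqr -sqrtrM ?sqr_ge0// /enorm mulr_sumr; congr Num.sqrt.
by apply: eq_bigr => i _; rewrite mxE exprMn.
Qed.

Lemma lipschitz_diff_le (n : nat) (l : R) (f : 'rV[R]_n -> R) z u :
  lipschitz_fun l f -> differentiable f z -> ('d f z u) ^+ 2 <= l ^+ 2 * enorm u ^+ 2.
Proof.
move=> lf df; have dd : derivable f z u := diff_derivable df.
suff : `|'d f z u| <= l * enorm u.
  move=> h; rewrite -exprMn -(real_normK (num_real ('d f z u))).
  by rewrite ler_pXn2r// nnegrE// (le_trans _ h).
rewrite -deriveE//.
have hh : (fun h => h^-1 *: (f (h *: u + z) - f z)) @ 0^' --> 'D_u f z by exact: dd.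
apply: (cvgr_to_le (cvg_norm hh)).
near=> h; have h0 : h != 0 by near: h; exact: nbhs_dnbhs_neq.
rewrite normrZ normfV ler_pdivrMl ?normr_gt0// mulrCA -enormZ.
by rewrite (le_trans (lf _ _))// addrK.
Unshelve. all: by end_near. Qed.

Local Notation mu := (@lebesgue_measure R).

Lemma continuous_integrable_itv (f : R -> R) : continuous f ->
  mu.-integrable `[0%R, 1%R] (EFin \o f).
Proof.
move=> cf; apply: continuous_compact_integrable; first exact: segment_compact.
exact: continuous_subspaceT.
Qed.

(* Integrate 2 c f' - c^2 <= f'^2 with c = f 1 - f 0. *)
Lemma sqr_increment_le (f f' : R -> R) :
  (forall t, is_derive t (1 : R) f (f' t)) -> continuous f' ->
  (((f 1 - f 0) ^+ 2)%:E <= \int[mu]_(t in `[0%R, 1%R]) (f' t ^+ 2)%:E)%E.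
Proof.
move=> df cf'; set c := f 1 - f 0.
have cf : continuous f.
  by move=> t; apply/differentiable_continuous/derivable1_diffP; exact: ex_derive.
have ftc : (\int[mu]_(t in `[0%R, 1%R]) (f' t)%:E = c%:E)%E.
  rewrite (continuous_FTC2 (F := f) ltr01)//.
  - exact: continuous_subspaceT.
  - split.
    + by move=> t _; exact: ex_derive.
    + exact: cvg_at_right_filter (cf 0).
    + exact: cvg_at_left_filter (cf 1).
  - by move=> t _; rewrite derive1E derive_val.
have csq : continuous (fun t => f' t ^+ 2).
  by move=> t; apply: cvgM; exact: cf'.
have i1 := continuous_integrable_itv cf'.
have i2 := continuous_integrable_itv csq.
have m01 : mu `[0%R, 1%R] = 1%E.
  by rewrite /= lebesgue_measure_itv/= lte01 oppr0 adde0.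
have i3 : mu.-integrable `[0%R, 1%R] (EFin \o (fun t => 2 * c * f' t)).
  exact: (integrableZl _ (2 * c) i1).
have i4 : mu.-integrable `[0%R, 1%R] (EFin \o (fun=> c ^+ 2)).
  by apply: continuous_integrable_itv => t; exact: cvg_cst.
have h : (\int[mu]_(t in `[0%R, 1%R]) ((2 * c * f' t) - c ^+ 2)%:E <=
   \int[mu]_(t in `[0%R, 1%R]) (f' t ^+ 2)%:E)%E.
  apply: le_integral => //; first exact: (integrableB _ i3 i4).
  by move=> t _; rewrite lee_fin; have := sqr_ge0 (f' t - c); nra.
apply: le_trans h; rewrite integralB_EFin//.
under eq_integral do rewrite EFinM.
rewrite integralZl// ftc integral_cst// [X in (_ - _ * X)%E]m01 mule1.
by rewrite -EFinM -EFinB lee_fin le_eqVlt; apply/orP; left; apply/eqP; ring.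
Qed.

Lemma sqr_enorm_increment_le (C : nat) (f : R -> 'rV[R]_C) (f' : R -> 'rV[R]_C) :
  (forall k t, is_derive t (1 : R) (fun t => f t 0 k) (f' t 0 k)) ->
  (forall k, continuous (fun t => f' t 0 k)) ->
  ((enorm (f 1 - f 0) ^+ 2)%:E <=
   \int[mu]_(t in `[0%R, 1%R]) (enorm (f' t) ^+ 2)%:E)%E.
Proof.
move=> df cf'; rewrite sqr_enorm.
have -> : (\int[mu]_(t in `[0%R, 1%R]) (enorm (f' t) ^+ 2)%:E =
    \sum_k \int[mu]_(t in `[0%R, 1%R]) (f' t 0 k ^+ 2)%:E)%E.
  rewrite -ge0_integral_sum//.
  - by apply: eq_integral => t _; rewrite sqr_enorm sumEFin.
  - move=> k; apply/measurable_EFinP/measurable_funTS.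
    by apply: continuous_measurable_fun => t; apply: cvgM; exact: cf'.
  - by move=> k t _; rewrite lee_fin sqr_ge0.
rewrite -sumEFin; apply: lee_sum => k _; rewrite !mxE.
exact: (sqr_increment_le (df k) (cf' k)).
Qed.

(** Row vectors carry the sigma-algebra generated by the coordinates; the grid approximation, with a
    dummy second variable, links it to continuity. *)
Lemma continuous_measurable_rV (m : nat) (f : 'rV[R]_m -> R) :
  continuous f -> measurable_fun setT f.
Proof.
move=> cf.
have := @measurable_caratheodory R m _ (measurableTypeR R) (fun v _ => f v) (fun=> cf) _.
move=> /(_ (fun v => measurable_cst _)) h.
exact: (measurable_fun_pair1 (0 : measurableTypeR R) h).
Qed.

End gradient_calculus.

(** The indicator of [0, 1] is moved into the integrand, so that Tonelli applies on the product with
    the whole line. *)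
Lemma tonelli_itv d (T : measurableType d) (R : realType) (P : probability T R)
    (q : T -> R -> R) :
  measurable_fun setT (fun p : T * measurableTypeR R => q p.1 p.2) ->
  (forall u t, 0 <= q u t) ->
  measurable_fun setT
    (fun u => \int[lebesgue_measure]_(t in `[0%R, 1%R]) (q u t)%:E)%E /\
  (\int[P]_u \int[lebesgue_measure]_(t in `[0%R, 1%R]) (q u t)%:E =
   \int[lebesgue_measure]_(t in `[0%R, 1%R]) \int[P]_u (q u t)%:E)%E.
Proof.
move=> mq q0.
have m01 : measurable (`[0%R, 1%R] : set (measurableTypeR R)) by exact: measurable_itv.
pose ind (t : measurableTypeR R) : R := \1_(`[0%R, 1%R] : set R) t.
pose f (p : T * measurableTypeR R) := (q p.1 p.2 * ind p.2)%:E.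
have mind : measurable_fun setT ind by exact: measurable_indic.
have mf : measurable_fun setT f.
  apply/measurable_EFinP; apply: measurable_funM => //.
  exact: (measurableT_comp mind measurable_snd).
have f0 p : (0 <= f p)%E by rewrite lee_fin mulr_ge0// indicE; case: (_ \in _).
have fE u : (\int[lebesgue_measure]_(t in `[0%R, 1%R]) (q u t)%:E =
    \int[lebesgue_measure]_t f (u, t))%E.
  rewrite integral_mkcond; apply: eq_integral => t _.
  by rewrite patchE /f /ind /= indicE; case: (_ \in _); rewrite ?mulr1 ?mulr0.
split.
  under eq_fun do rewrite fE.
  exact: (measurable_fun_fubini_tonelli_F (m2 := lebesgue_measure) f mf f0).
under eq_integral do rewrite fE.
rewrite (@fubini_tonelli _ _ _ _ _ P lebesgue_measure f)//.
rewrite [RHS]integral_mkcond; apply: eq_integral => t _; rewrite patchE.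
case: ifPn => [t01|t01]; first by
  apply: eq_integral => u _; rewrite /f /ind /= indicE t01 mulr1.
rewrite (eq_integral (fun=> 0%E)) ?integral0// => u _.
by rewrite /f /ind /= indicE (negbTE t01) mulr0.
Qed.

(** Jensen for the square, by integrating 2 c x - c^2 <= x^2 at c the mean. If the second moment is
    infinite the right side is +oo. *)
Lemma sqr_Rintegral_le d (T : measurableType d) (R : realType)
    (P : probability T R) (xi : T -> R) :
  P.-integrable setT (EFin \o xi) ->
  (((\int[P]_u xi u) ^+ 2)%:E <= \int[P]_u (xi u ^+ 2)%:E)%E.
Proof.
move=> ixi; have mxi : measurable_fun setT xi.
  by apply/measurable_EFinP; exact: measurable_int ixi.
have msq : measurable_fun setT (fun u => xi u ^+ 2) by exact: measurable_funX.
have [->|fin] := eqVneq (\int[P]_u (xi u ^+ 2)%:E)%E +oo%E; first exact: leey.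
have isq : P.-integrable setT (EFin \o (fun u => xi u ^+ 2)).
  apply/integrableP; split; first exact/measurable_EFinP.
  under eq_integral do rewrite /= ger0_norm ?sqr_ge0//.
  by rewrite ltey.
rewrite -EFin_Rintegral// lee_fin; set c := \int[P]_u xi u.
have i3 : P.-integrable setT (EFin \o (fun u => 2 * c * xi u)).
  exact: (integrableZl measurableT (2 * c) ixi).
have i4 : P.-integrable setT (EFin \o (fun=> c ^+ 2)).
  exact: finite_measure_integrable_cst.
have := @le_Rintegral _ _ _ P setT (fun u => 2 * c * xi u - c ^+ 2)
  (fun u => xi u ^+ 2) measurableT (integrableB measurableT i3 i4) isq.
rewrite RintegralB// RintegralZl// Rint_cst -/c => h.
rewrite (_ : c ^+ 2 = 2 * c * c - c ^+ 2); last by ring.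
by apply: h => u _; have := sqr_ge0 (xi u - c); nra.
Qed.

Lemma continuous_sum (R : realType) (T : topologicalType) (I : finType)
    (F : I -> T -> R) :
  (forall i, continuous (F i)) -> continuous (fun x => \sum_i F i x).
Proof. by move=> cF; apply: continuous_big => //; exact: add_continuous. Qed.

Lemma continuous_lincomb (R : realType) (T : topologicalType) (I : finType)
    (c : I -> R) (F : I -> T -> R) :
  (forall i, continuous (F i)) -> continuous (fun x => \sum_i c i * F i x).
Proof.
move=> cF; apply: continuous_big => [|i _ x]; first exact: add_continuous.
by apply: cvgM; [exact: cvg_cst|exact: cF].
Qed.

(** * Increments of the predictor and of its differential along a segment *)

Section increments.
Context dX (X : measurableType dX) (R : realType) (m C : nat).
Variables (h : 'rV[R]_m -> X -> 'rV[R]_C) (x : X) (sigma : R).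
Hypothesis hC2 : twice_continuously_differentiable (h^~ x).

Local Notation H := (h^~ x).
Local Notation Hk k := (fun v : 'rV[R]_m => h v x 0 k).

Let dH w : differentiable H w := hC2.1 w.
Let dgrad k w : differentiable (gradient (Hk k)) w := (hC2.2 k).1 w.

Let dHk k w : differentiable (Hk k) w.
Proof. by have := diff_coord k (dH w) => ?; exact: ex_diff. Qed.

Let diffHk k w v : ('d H w v) 0 k = dot v (gradient (Hk k) w).
Proof.
rewrite -dot_gradient//; have dk := diff_coord k (dH w).
by rewrite (@diff_val _ _ _ _ _ _ _ dk).
Qed.

Lemma jac_formE w u : jac_form h x w u = enorm ('d H w u) ^+ 2.
Proof.
rewrite /jac_form /jac trmxK sqr_enorm.
have -> : u *m 'J H w = 'd H w u by rewrite /jacobian mul_rV_lin1.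
rewrite -mulmxA (_ : ('J H w)^T *m u^T = ('d H w u)^T); last first.
  by rewrite -trmx_mul /jacobian mul_rV_lin1.
by rewrite mxE; apply: eq_bigr => k _; rewrite mxE expr2.
Qed.

Lemma qform_jac w v : qform ((jac h x w)^T *m jac h x w) v = enorm ('d H w v) ^+ 2.
Proof. by rewrite -jac_formE /qform /jac_form mulmxA. Qed.

Lemma qform_hess_form w u v : qform (hess_form h x w u) v =
  \sum_(k < C) dot v ('d (gradient (Hk k)) w u) ^+ 2.
Proof.
rewrite /qform /hess_form mulmx_sumr mulmx_suml summxE; apply: eq_bigr => k _.
have e : u *m hess h x k w = 'd (gradient (Hk k)) w u.
  by rewrite /hess /hessian /jacobian mul_rV_lin1.
have -> : (hess h x k w)^T *m u^T *m u *m hess h x k w =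
    ('d (gradient (Hk k)) w u)^T *m 'd (gradient (Hk k)) w u.
  by rewrite -e trmx_mul !mulmxA.
exact: qform_outer.
Qed.

Let continuous_line (u w : 'rV[R]_m) : continuous (fun t : R => w + t *: (sigma *: u)).
Proof.
move=> t; apply: cvgD; first exact: cvg_cst.
by apply: cvgZr_tmp; exact: cvg_id.
Qed.

Let continuous_dot (v : 'rV[R]_m) : continuous (fun y : 'rV[R]_m => dot v y).
Proof.
by apply: continuous_lincomb => j; exact: coord_continuous.
Qed.

Let continuous_diffHk k v : continuous (fun w => ('d H w v) 0 k).
Proof.
rewrite (_ : (fun w => _) = (dot v) \o (gradient (Hk k))); last first.
  by apply/funext => w; rewrite diffHk.
move=> w; apply: continuous_comp; last exact: continuous_dot.
exact: differentiable_continuous.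
Qed.

Let continuous_dot_hess k u v : continuous (fun w => dot v ('d (gradient (Hk k)) w u)).
Proof.
suff : continuous (fun w => dot v (u *m hessian (Hk k) w)).
  rewrite (_ : (fun w => dot v (u *m _)) = fun w => dot v ('d (gradient (Hk k)) w u))//.
  by apply/funext => w; rewrite /hessian /jacobian mul_rV_lin1.
apply: continuous_lincomb => j.
suff : continuous (fun w => \sum_a u 0 a * hessian (Hk k) w a j).
  rewrite (_ : (fun w => \sum_a _) = fun w => (u *m hessian (Hk k) w) 0 j).
    exact.
  by apply/funext => w'; rewrite mxE.
apply: continuous_lincomb => a w.
apply: (@continuous_comp _ _ _ (hessian (Hk k)) (fun M : 'M[R]_m => M a j)).
  exact: (hC2.2 k).2.
exact: coord_continuous.
Qed.

Lemma enorm_increment_le w u :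
  ((enorm (H (w + sigma *: u) - H w) ^+ 2)%:E <=
   \int[lebesgue_measure]_(t in `[0%R, 1%R])
     (sigma ^+ 2 * jac_form h x (w + (t * sigma) *: u) u)%:E)%E.
Proof.
have := @sqr_enorm_increment_le R C (fun t => H (w + t *: (sigma *: u)))
  (fun t => 'd H (w + t *: (sigma *: u)) (sigma *: u)).
rewrite scale1r scale0r addr0 => /(_ _ _)/le_trans; apply.
- move=> k t.
  have := @is_derive_line R m R (Hk k) w (sigma *: u) t (dHk k _).
  by rewrite dot_gradient// -diffHk.
- move=> k t; apply: (@continuous_comp _ _ _ (fun t : R => w + t *: (sigma *: u))
    (fun w => ('d H w (sigma *: u)) 0 k)); first exact: continuous_line.
  exact: continuous_diffHk.
rewrite le_eqVlt; apply/orP; left; apply/eqP; apply: eq_integral => t _.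
rewrite scalerA; move: (w + _) => w'; rewrite jac_formE.
have -> : 'd H w' (sigma *: u) = sigma *: 'd H w' u by rewrite linearZ.
by rewrite enormZ exprMn real_normK ?num_real.
Qed.

(** The curve t -> dH(w + t sigma u) v has as velocity in coordinate k the Hessian form of that
    coordinate at (sigma u, v). Summing squares over k gives sigma^2 times the form of [hess_form]
    at v. *)
Lemma diff_increment_le w u v :
  ((enorm ('d H (w + sigma *: u) v - 'd H w v) ^+ 2)%:E <=
   \int[lebesgue_measure]_(t in `[0%R, 1%R])
     (sigma ^+ 2 * qform (hess_form h x (w + (t * sigma) *: u) u) v)%:E)%E.
Proof.
have := @sqr_enorm_increment_le R C (fun t => 'd H (w + t *: (sigma *: u)) v)
  (fun t => \row_k dot v ('d (gradient (Hk k)) (w + t *: (sigma *: u)) (sigma *: u))).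
rewrite scale1r scale0r addr0 => /(_ _ _)/le_trans; apply.
- move=> k t; rewrite mxE.
  have dl := @is_derive_line R m _ (gradient (Hk k)) w (sigma *: u) t (dgrad k _).
  rewrite (_ : (fun t0 => _) = fun t0 => \sum_j v 0 j *
      gradient (Hk k) (w + t0 *: (sigma *: u)) 0 j); last first.
    by apply/funext => s; rewrite diffHk.
  rewrite (_ : (fun t0 => _) = \sum_j (v 0 j \*: (fun t0 =>
      gradient (Hk k) (w + t0 *: (sigma *: u)) 0 j))); last first.
    by apply/funext => s; rewrite fct_sumE.
  apply: is_derive_sum => j; apply: is_deriveZ.
  have dg := diff_coord j (dgrad k (w + t *: (sigma *: u))).
  have dgd : differentiable (fun w => gradient (Hk k) w 0 j) (w + t *: (sigma *: u)).
    exact: ex_diff.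
  have := is_derive_line dgd.
  by rewrite (@diff_val _ _ _ _ _ _ _ dg).
- move=> k; rewrite (_ : (fun t => _) = fun t =>
    dot v ('d (gradient (Hk k)) (w + t *: (sigma *: u)) (sigma *: u))); last first.
    by apply/funext => t; rewrite mxE.
  move=> t; apply: (@continuous_comp _ _ _ (fun t : R => w + t *: (sigma *: u))
    (fun w => dot v ('d (gradient (Hk k)) w (sigma *: u)))); first exact: continuous_line.
  exact: continuous_dot_hess.
rewrite le_eqVlt; apply/orP; left; apply/eqP; apply: eq_integral => t _.
rewrite qform_hess_form sqr_enorm mulr_sumr; congr EFin; apply: eq_bigr => k _.
rewrite mxE scalerA; move: (w + _) => w'.
have -> : 'd (gradient (Hk k)) w' (sigma *: u) = sigma *: 'd (gradient (Hk k)) w' u.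
  by rewrite linearZ.
by rewrite dotZr exprMn.
Qed.

Let continuous_dotf (T : topologicalType) (a b : T -> 'rV[R]_m) :
  continuous a -> continuous b -> continuous (fun s => dot (a s) (b s)).
Proof.
move=> ca cb; apply: continuous_sum => j s; apply: cvgM.
  by apply: (@continuous_comp _ _ _ a (fun y : 'rV[R]_m => y 0 j));
    [exact: ca|exact: coord_continuous].
by apply: (@continuous_comp _ _ _ b (fun y : 'rV[R]_m => y 0 j));
  [exact: cb|exact: coord_continuous].
Qed.

Let continuous_sqr (T : topologicalType) (a : T -> R) :
  continuous a -> continuous (fun s => a s ^+ 2).
Proof. by move=> ca s; apply: cvgM; exact: ca. Qed.

(** Stated along two continuous maps, to be used once with u varying and once with t varying: joint
    measurability in (u, t) is derived from these two. *)
Lemma continuous_jac_form (T : topologicalType) (a b : T -> 'rV[R]_m) :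
  continuous a -> continuous b -> continuous (fun s => jac_form h x (a s) (b s)).
Proof.
move=> ca cb; rewrite (_ : (fun s => _) = fun s =>
    \sum_k dot (b s) (gradient (Hk k) (a s)) ^+ 2).
  apply: continuous_sum => k; apply: continuous_sqr; apply: continuous_dotf => //.
  move=> s; apply: continuous_comp; first exact: ca.
  exact: differentiable_continuous.
apply/funext => s; rewrite jac_formE sqr_enorm.
by apply: eq_bigr => k _; rewrite diffHk.
Qed.

Lemma continuous_qform_hess_form (T : topologicalType) (a b : T -> 'rV[R]_m) v :
  continuous a -> continuous b ->
  continuous (fun s => qform (hess_form h x (a s) (b s)) v).
Proof.
move=> ca cb; rewrite (_ : (fun s => _) = fun s =>
    \sum_k (\sum_j v 0 j * \sum_i b s 0 i * hessian (Hk k) (a s) i j) ^+ 2).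
  apply: continuous_sum => k; apply: continuous_sqr.
  apply: continuous_lincomb => j; apply: continuous_sum => i.
  have c1 : continuous (fun w => hessian (Hk k) w i j).
    move=> w; apply: (@continuous_comp _ _ _ (hessian (Hk k)) (fun M : 'M[R]_m => M i j)).
      exact: (hC2.2 k).2.
    exact: coord_continuous.
  have c2 : continuous (fun s => hessian (Hk k) (a s) i j).
    by move=> s; exact: (continuous_comp (ca s) (c1 (a s))).
  have c3 : continuous (fun s => b s 0 i).
    move=> s; apply: (@continuous_comp _ _ _ b (fun y : 'rV[R]_m => y 0 i)).
      exact: cb.
    exact: coord_continuous.
  by move=> s; apply: cvgM; [exact: c3|exact: c2].
apply/funext => s; rewrite qform_hess_form; apply: eq_bigr => k _.
congr (_ ^+ 2); apply: eq_bigr => j _; congr (_ * _).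
have -> : 'd (gradient (Hk k)) (a s) (b s) = b s *m hessian (Hk k) (a s).
  by rewrite /hessian /jacobian mul_rV_lin1.
by rewrite mxE.
Qed.

Let continuous_subc (T : topologicalType) (f : T -> R) c :
  continuous f -> continuous (fun s => f s - c).
Proof. by move=> cf s; apply: cvgB; [exact: cf|exact: cvg_cst]. Qed.

Let continuous_shift (w : 'rV[R]_m) : continuous (fun u : 'rV[R]_m => w + sigma *: u).
Proof.
move=> u; pose g : 'rV[R]_m -> 'rV[R]_m := cst w + ( *:%R sigma).
have dg : is_diff u g (0 + ( *:%R sigma)) by exact: is_diffD.
by apply: (@differentiable_continuous _ _ _ u g); exact: ex_diff.
Qed.

Lemma continuous_enorm_increment (w : 'rV[R]_m) :
  continuous (fun u : 'rV[R]_m => enorm (H (w + sigma *: u) - H w) ^+ 2).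
Proof.
rewrite (_ : (fun u => _) = fun u => \sum_k (h (w + sigma *: u) x 0 k - h w x 0 k) ^+ 2).
  apply: continuous_sum => k; apply: continuous_sqr; apply: continuous_subc => u.
  apply: (@continuous_comp _ _ _ (fun u : 'rV[R]_m => w + sigma *: u) (Hk k)).
    exact: continuous_shift.
  exact: differentiable_continuous.
by apply/funext => u; rewrite sqr_enorm; apply: eq_bigr => k _; rewrite !mxE.
Qed.

Lemma continuous_diff_increment (w v : 'rV[R]_m) :
  continuous (fun u : 'rV[R]_m => enorm ('d H (w + sigma *: u) v - 'd H w v) ^+ 2).
Proof.
rewrite (_ : (fun u => _) = fun u =>
   \sum_k (('d H (w + sigma *: u) v) 0 k - ('d H w v) 0 k) ^+ 2).
  apply: continuous_sum => k; apply: continuous_sqr; apply: continuous_subc => u.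
  apply: (@continuous_comp _ _ _ (fun u : 'rV[R]_m => w + sigma *: u)
    (fun w : 'rV[R]_m => ('d H w v) 0 k)).
    exact: continuous_shift.
  exact: continuous_diffHk.
by apply/funext => u; rewrite sqr_enorm; apply: eq_bigr => k _; rewrite !mxE.
Qed.

End increments.

Lemma enormD (R : realType) (n : nat) (x y : 'rV[R]_n) :
  enorm (x + y) <= enorm x + enorm y.
Proof.
rewrite -(@ler_pXn2r _ 2) ?nnegrE ?addr_ge0 ?enorm_ge0//.
have e : enorm (x + y) ^+ 2 = enorm x ^+ 2 + 2 * dot x y + enorm y ^+ 2.
  rewrite !sqr_enorm /dot mulr_sumr -!big_split/=; apply: eq_bigr => i _.
  by rewrite !mxE; ring.
have := dot_le x y; rewrite ler_norml e => /andP[_ h]; nra.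
Qed.

Lemma eball_segment (R : realType) (n : nat) (r : R) (a b : 'rV[R]_n) t :
  eball r a -> eball r b -> 0 <= t <= 1 -> eball r (a + t *: (b - a)).
Proof.
rewrite /eball/= => ha hb /andP[t0 t1].
rewrite (_ : a + t *: (b - a) = (1 - t) *: a + t *: b); last first.
  by apply/rowP => k; rewrite !mxE; ring.
rewrite (le_trans (enormD _ _))// !enormZ !ger0_norm ?subr_ge0//.
have h1 : (1 - t) * enorm a <= (1 - t) * r by rewrite ler_wpM2l// subr_ge0.
have h2 : t * enorm b <= t * r by rewrite ler_wpM2l.
lra.
Qed.

(** Splits the difference as a . (g0 - g1) - (b - a) . g1 and uses (s - t)^2 <= 2 s^2 + 2 t^2. In
    the application a and b are the differentials of the predictor at the two ends, applied to v,
    and g0, g1 the loss gradients: smoothness controls the first term, the Lipschitz bound the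
    second. *)
Lemma sqr_dot_increment_le (R : realType) (n : nat) (a b g0 g1 : 'rV[R]_n)
    (beta ell q p : R) :
  enorm a ^+ 2 <= q -> enorm (g0 - g1) <= beta * p ->
  dot (b - a) g1 ^+ 2 <= ell ^+ 2 * enorm (b - a) ^+ 2 ->
  (dot a g0 - dot b g1) ^+ 2 <=
    2 * beta ^+ 2 * q * p ^+ 2 + 2 * ell ^+ 2 * enorm (b - a) ^+ 2.
Proof.
move=> ha hg h2.
have -> : dot a g0 - dot b g1 = dot a (g0 - g1) - dot (b - a) g1.
  by rewrite dotDr dotNr [dot (b - a) g1]dotC dotDr dotNr ![dot g1 _]dotC; ring.
have h1 : dot a (g0 - g1) ^+ 2 <= q * (beta ^+ 2 * p ^+ 2).
  apply: (le_trans (sqr_dot_le _ _)).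
  apply: ler_pM; rewrite ?sqr_ge0// -exprMn ler_pXn2r// nnegrE ?enorm_ge0//.
  by rewrite (le_trans _ hg)// enorm_ge0.
move: h1 h2; set s := dot a _; set t := dot _ g1.
have := sqr_ge0 (s + t); nra.
Qed.

(** The Jensen gap of the loss under N(w, sigma^2 I), written with the standard Gaussian so that it
    can be differentiated in w; see [jensen_gap_gaussian]. *)
Definition loss_gap dX dY (X : measurableType dX) (Y : measurableType dY)
    (R : realType) (m C : nat) (L : 'rV[R]_C -> Y -> R)
    (h : 'rV[R]_m -> X -> 'rV[R]_C) (sigma : R) (z : X * Y) (w : 'rV[R]_m) : R :=
  loss_at L h z w - smoothed_loss_at L h sigma z w.

Section jensen_gap_gradient.
Context dX dY (X : measurableType dX) (Y : measurableType dY) (R : realType).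
Variables (m C n : nat) (L : 'rV[R]_C -> Y -> R) (h : 'rV[R]_m -> X -> 'rV[R]_C).
Variables (ell beta sigma : R) (Theta : set 'rV[R]_m) (S : n.-tuple (X * Y)).
Variables (G B : 'I_n -> 'M[R]_m).
Hypothesis lipL : forall y, lipschitz_fun ell (L^~ y).
Hypothesis smoothL : forall y, smooth_fun beta (L^~ y).
Hypothesis rg : Reg L h sigma Theta S G B.
Variable i : 'I_n.

Local Notation x := (tnth S i).1.
Local Notation y := (tnth S i).2.
Local Notation gauss := (std_gaussian R m).
Local Notation H := (h^~ x).
Local Notation psi := (L^~ y).
Local Notation loss := (loss_at L h (tnth S i)).
Local Notation mu := lebesgue_measure.
Local Notation gap_at := (loss_gap L h sigma (tnth S i)).

Let hC2 : twice_continuously_differentiable H := reg_C2 rg i.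
Let dpsi z : differentiable psi z := (smoothL y).1 z.
Let dH w : differentiable H w := hC2.1 w.

Lemma differentiable_loss w : differentiable loss w.
Proof. exact: (differentiable_comp (dH w) (dpsi (H w))). Qed.

Lemma dot_gradient_loss v w :
  dot v (gradient loss w) = dot ('d H w v) (gradient psi (H w)).
Proof.
rewrite -dot_gradient; last exact: differentiable_loss.
rewrite -dot_gradient//.
have -> : loss = psi \o H by [].
by rewrite diff_comp.
Qed.

Let fst_incr (w u : 'rV[R]_m) := enorm (H (w + sigma *: u) - H w) ^+ 2.
Let snd_incr (w v u : 'rV[R]_m) := enorm ('d H (w + sigma *: u) v - 'd H w v) ^+ 2.

Lemma qform_jac_le w v : Theta w -> enorm ('d H w v) ^+ 2 <= qform (G i) v.
Proof.
move=> Tw; have [_ /(_ v)] := reg_G_dom rg i Tw.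
by rewrite -/(qform _ _) qformB subr_ge0 qform_jac.
Qed.

Let xi (w v u : 'rV[R]_m) := dot v (gradient loss w) - dot v (gradient loss (w + sigma *: u)).

Lemma sqr_xi_le w v u : Theta w ->
  xi w v u ^+ 2 <= 2 * beta ^+ 2 * qform (G i) v * fst_incr w u +
                   2 * ell ^+ 2 * snd_incr w v u.
Proof.
move=> Tw; rewrite /xi !dot_gradient_loss /fst_incr /snd_incr.
have hG := qform_jac_le v Tw.
have hs := (smoothL y).2 (H w) (H (w + sigma *: u)).
have hl := lipschitz_diff_le ('d H (w + sigma *: u) v - 'd H w v)
  (lipL y) (dpsi (H (w + sigma *: u))).
rewrite dot_gradient// in hl.
apply: sqr_dot_increment_le hG _ hl.
apply: (le_trans hs); rewrite le_eqVlt; apply/orP; left; apply/eqP.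
rewrite (_ : H w - _ = - (H (w + sigma *: u) - H w)); last by rewrite opprB.
by rewrite -scaleN1r enormZ normrN1 mul1r.
Qed.

Let measurable_caratheodory_tu (q : 'rV[R]_m -> R -> R) :
  (forall t, continuous (q^~ t)) -> (forall u, continuous (q u)) ->
  measurable_fun setT (fun p : 'rV[R]_m * measurableTypeR R => q p.1 p.2).
Proof.
move=> c1 c2; apply: (@measurable_caratheodory R m _ (measurableTypeR R) q) => // u.
exact: continuous_measurable_fun.
Qed.

Let continuous_shift_u w t : continuous (fun u : 'rV[R]_m => w + (t * sigma) *: u).
Proof.
move=> u; pose g : 'rV[R]_m -> 'rV[R]_m := cst w + ( *:%R (t * sigma)).
have dg : is_diff u g (0 + ( *:%R (t * sigma))) by exact: is_diffD.
by apply: (@differentiable_continuous _ _ _ u g); exact: ex_diff.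
Qed.

Let continuous_shift_tt (w u : 'rV[R]_m) : continuous (fun t : R => w + (t * sigma) *: u).
Proof.
rewrite (_ : (fun t : R => _) = fun t => w + t *: (sigma *: u)).
  move=> t; apply: cvgD; first exact: cvg_cst.
  by apply: cvgZr_tmp; exact: cvg_id.
by apply/funext => t; rewrite scalerA.
Qed.

Let id_cont (T : topologicalType) : continuous (fun u : T => u).
Proof. by move=> u; exact: cvg_id. Qed.

Let measurable_jac (w : 'rV[R]_m) : measurable_fun setT
  (fun p : 'rV[R]_m * measurableTypeR R => jac_form h x (w + (p.2 * sigma) *: p.1) p.1).
Proof.
apply: (measurable_caratheodory_tu
  (q := fun u t => jac_form h x (w + (t * sigma) *: u) u)) => [t|u].
  apply: (@continuous_jac_form _ _ _ _ _ h x hC2 _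
    (fun u : 'rV[R]_m => w + (t * sigma) *: u) (fun u => u)).
    exact: continuous_shift_u.
  exact: id_cont.
apply: (@continuous_jac_form _ _ _ _ _ h x hC2 _
  (fun t : R => w + (t * sigma) *: u) (fun=> u)).
  exact: continuous_shift_tt.
by move=> ?; exact: cvg_cst.
Qed.

Let measurable_qhess (w v : 'rV[R]_m) : measurable_fun setT
  (fun p : 'rV[R]_m * measurableTypeR R =>
     qform (hess_form h x (w + (p.2 * sigma) *: p.1) p.1) v).
Proof.
apply: (measurable_caratheodory_tu
  (q := fun u t => qform (hess_form h x (w + (t * sigma) *: u) u) v)) => [t|u].
  apply: (@continuous_qform_hess_form _ _ _ _ _ h x hC2 _
    (fun u : 'rV[R]_m => w + (t * sigma) *: u) (fun u => u)).
    exact: continuous_shift_u.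
  exact: id_cont.
apply: (@continuous_qform_hess_form _ _ _ _ _ h x hC2 _
  (fun t : R => w + (t * sigma) *: u) (fun=> u)).
  exact: continuous_shift_tt.
by move=> ?; exact: cvg_cst.
Qed.

Lemma integral_fst_incr_le w : Theta w ->
  (\int[gauss]_u (fst_incr w u)%:E <=
   (sigma ^+ 2 * fine (jac_sup h sigma Theta x))%:E)%E.
Proof.
move=> Tw.
pose q (u : 'rV[R]_m) (t : R) := sigma ^+ 2 * jac_form h x (w + (t * sigma) *: u) u.
have q0 u t : 0 <= q u t.
  by rewrite mulr_ge0 ?sqr_ge0// jac_formE sqr_ge0.
have mq : measurable_fun setT (fun p : 'rV[R]_m * measurableTypeR R => q p.1 p.2).
  exact: (measurable_funM (measurable_cst _) (measurable_jac w)).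
have [mI ton] := tonelli_itv gauss mq q0.
apply: (@le_trans _ _ (\int[gauss]_u \int[mu]_(t in `[0%R, 1%R]) (q u t)%:E)%E).
  apply: ge0_le_integral => //.
  - by move=> u _; rewrite lee_fin sqr_ge0.
  - apply/measurable_EFinP; apply: continuous_measurable_rV.
    exact: continuous_enorm_increment.
  - by move=> u _; exact: enorm_increment_le.
rewrite ton /q.
have mj u t : (0 <= (jac_form h x (w + (t * sigma) *: u) u)%:E)%E.
  by rewrite lee_fin jac_formE sqr_ge0.
have -> : (\int[mu]_(t in `[0%R, 1%R])
    \int[gauss]_u (sigma ^+ 2 * jac_form h x (w + (t * sigma) *: u) u)%:E =
  (sigma ^+ 2)%:E * \int[mu]_(t in `[0%R, 1%R])
    \int[gauss]_u (jac_form h x (w + (t * sigma) *: u) u)%:E)%E.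
  rewrite -ge0_integralZl//; first last.
  - by rewrite lee_fin sqr_ge0.
  - by move=> t _; apply: integral_ge0.
  - apply: measurable_funTS.
    apply: (measurable_fun_fubini_tonelli_G (m1 := gauss)
      (fun p : 'rV[R]_m * measurableTypeR R =>
         (jac_form h x (w + (p.2 * sigma) *: p.1) p.1)%:E)) => //.
    by apply/measurable_EFinP; exact: measurable_jac.
  apply: eq_integral => t _; rewrite -ge0_integralZl//.
  - apply/measurable_EFinP.
    exact: (measurable_fun_pair1 (t : measurableTypeR R) (measurable_jac w)).
  - by rewrite lee_fin sqr_ge0.
rewrite [leRHS]EFinM lee_wpmul2l// ?lee_fin ?sqr_ge0//.
rewrite fineK; last exact: (reg_jac_sup_fin rg i).
by apply: ereal_sup_ubound; exists w.
Qed.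

Let qhess (w v u : 'rV[R]_m) (t : R) := qform (hess_form h x (w + (t * sigma) *: u) u) v.

(** Since [hess_mean] is defined entry by entry, the form is expanded into finitely many entries,
    and the entrywise integrability in [Reg] lets both integrals pass through the sums. *)
Let integral_qhess w v : Theta w ->
  (\int[mu]_(t in `[0%R, 1%R]) \int[gauss]_u (qhess w v u t)%:E =
   (qform (hess_mean h sigma x w) v)%:E)%E.
Proof.
move=> Tw.
have m01 : measurable (`[0%R, 1%R] : set (measurableTypeR R)) by exact: measurable_itv.
have ihm a b : mu.-integrable `[0%R, 1%R]
    (fun t : R => (v 0 a * v 0 b * hess_mean_at h sigma x w t a b)%:E).
  exact: (integrableZl m01 (v 0 a * v 0 b) (reg_hess_mean_integrable rg i a b Tw)).
transitivity (\int[mu]_(t in `[0%R, 1%R])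
    (\sum_a \sum_b (v 0 a * v 0 b * hess_mean_at h sigma x w t a b)%:E))%E.
  apply: eq_integral => t; rewrite inE/= in_itv/= => t01.
  have ihu a b : gauss.-integrable setT (fun u =>
      (v 0 a * v 0 b * hess_form h x (w + (t * sigma) *: u) u a b)%:E).
    exact: (integrableZl measurableT (v 0 a * v 0 b) (reg_hess_integrable rg i a b Tw t01)).
  transitivity (\int[gauss]_u (\sum_a \sum_b
      (v 0 a * v 0 b * hess_form h x (w + (t * sigma) *: u) u a b)%:E))%E.
    apply: eq_integral => u _; rewrite /qhess qformE -sumEFin.
    by apply: eq_bigr => a _; rewrite sumEFin.
  rewrite integral_sum//; last first.
    by move=> a; apply: integrable_sum => // b _; exact: ihu.
  apply: eq_bigr => a _; rewrite integral_sum//.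
  apply: eq_bigr => b _; rewrite mxE.
  have ih := reg_hess_integrable rg i a b Tw t01.
  rewrite -[LHS]EFin_Rintegral; last exact: ihu.
  by rewrite RintegralZl.
rewrite integral_sum//; last first.
  by move=> a; apply: integrable_sum => // b _; exact: ihm.
rewrite qformE -sumEFin; apply: eq_bigr => a _.
rewrite integral_sum// -sumEFin; apply: eq_bigr => b _.
rewrite mxE -(RintegralZl _ m01 (reg_hess_mean_integrable rg i a b Tw)).
by rewrite /Rintegral fineK//; exact: integrable_fin_num.
Qed.

Lemma integral_snd_incr_le w v : Theta w ->
  (\int[gauss]_u (snd_incr w v u)%:E <= (sigma ^+ 2 * qform (B i) v)%:E)%E.
Proof.
move=> Tw.
pose q (u : 'rV[R]_m) (t : R) := sigma ^+ 2 * qhess w v u t.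
have qh0 u t : 0 <= qhess w v u t.
  by rewrite /qhess qform_hess_form sumr_ge0// => k _; exact: sqr_ge0.
have q0 u t : 0 <= q u t by rewrite mulr_ge0 ?sqr_ge0.
have mq : measurable_fun setT (fun p : 'rV[R]_m * measurableTypeR R => q p.1 p.2).
  exact: (measurable_funM (measurable_cst _) (measurable_qhess w v)).
have [mI ton] := tonelli_itv gauss mq q0.
apply: (@le_trans _ _ (\int[gauss]_u \int[mu]_(t in `[0%R, 1%R]) (q u t)%:E)%E).
  apply: ge0_le_integral => //.
  - by move=> u _; rewrite lee_fin sqr_ge0.
  - apply/measurable_EFinP; apply: continuous_measurable_rV.
    exact: continuous_diff_increment.
  - by move=> u _; exact: diff_increment_le.
rewrite ton /q.
have -> : (\int[mu]_(t in `[0%R, 1%R])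
    \int[gauss]_u (sigma ^+ 2 * qhess w v u t)%:E =
  (sigma ^+ 2)%:E * \int[mu]_(t in `[0%R, 1%R]) \int[gauss]_u (qhess w v u t)%:E)%E.
  rewrite -ge0_integralZl//; first last.
  - by rewrite lee_fin sqr_ge0.
  - by move=> t _; apply: integral_ge0 => u _; rewrite lee_fin.
  - apply: measurable_funTS.
    apply: (measurable_fun_fubini_tonelli_G (m1 := gauss)
      (fun p : 'rV[R]_m * measurableTypeR R => (qhess w v p.1 p.2)%:E)).
      by apply/measurable_EFinP; exact: measurable_qhess.
    by move=> p; rewrite lee_fin.
  apply: eq_integral => t _; rewrite -ge0_integralZl//.
  - apply/measurable_EFinP.
    exact: (measurable_fun_pair1 (t : measurableTypeR R) (measurable_qhess w v)).
  - by move=> u _; rewrite lee_fin.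
  - by rewrite lee_fin sqr_ge0.
rewrite integral_qhess// -EFinM lee_fin ler_wpM2l ?sqr_ge0//.
have [_ /(_ v)] := reg_B_dom rg i Tw.
by rewrite -/(qform _ _) qformB subr_ge0.
Qed.

Lemma differentiable_loss_gap w : Theta w -> differentiable gap_at w.
Proof.
move=> Tw; apply: differentiableB; first exact: differentiable_loss.
exact: (reg_smoothed_differentiable rg i Tw).
Qed.

Lemma sqr_diff_loss_gap_le w v : Theta w ->
  ('d gap_at w v) ^+ 2 <= 2 * sigma ^+ 2 *
    (beta ^+ 2 * fine (jac_sup h sigma Theta x) * qform (G i) v +
     ell ^+ 2 * qform (B i) v).
Proof.
move=> Tw.
have dS := reg_smoothed_differentiable rg i Tw.
have dl := differentiable_loss w.
have igrad j := reg_grad_integrable rg i j Tw.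
have ivg j : gauss.-integrable setT
    (fun u => (v 0 j * gradient loss (w + sigma *: u) 0 j)%:E).
  exact: (integrableZl measurableT (v 0 j) (igrad j)).
have idot : gauss.-integrable setT
    (EFin \o (fun u => dot v (gradient loss (w + sigma *: u)))).
  rewrite (_ : _ \o _ = fun u =>
      (\sum_j (v 0 j * gradient loss (w + sigma *: u) 0 j)%:E)%E); last first.
    by apply/funext => u /=; rewrite sumEFin.
  by apply: integrable_sum => // j _; exact: ivg.
have icst : gauss.-integrable setT (EFin \o (fun=> dot v (gradient loss w))).
  exact: finite_measure_integrable_cst.
have ixi : gauss.-integrable setT (EFin \o xi w v).
  exact: (integrableB measurableT icst idot).
have dE : 'd gap_at w v = \int[gauss]_u xi w v u.
  rewrite RintegralB// Rint_cst.
  have -> : 'd gap_at w v = 'd loss w v - 'd (smoothed_loss_at L h sigma (tnth S i)) w v.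
    by rewrite (diffB dl dS).
  rewrite dot_gradient// dot_gradient//; congr (_ - _).
  rewrite (reg_diff_under_expectation rg i Tw) /dot.
  apply: EFin_inj; rewrite EFin_Rintegral//.
  transitivity (\int[gauss]_u
      (\sum_j (v 0 j * gradient loss (w + sigma *: u) 0 j)%:E))%E.
    rewrite integral_sum// -sumEFin; apply: eq_bigr => j _.
    rewrite mxE -(RintegralZl _ measurableT (igrad j)).
    by rewrite EFin_Rintegral//; exact: ivg.
  by apply: eq_integral => u _; rewrite sumEFin.
rewrite dE -lee_fin; apply: (le_trans (sqr_Rintegral_le ixi)).
have Gq0 : 0 <= qform (G i) v by exact: (reg_G_psd rg i).2.
have c1 : 0 <= 2 * beta ^+ 2 * qform (G i) v by rewrite mulr_ge0// mulr_ge0 ?sqr_ge0//.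
have c2 : 0 <= 2 * ell ^+ 2 by rewrite mulr_ge0 ?sqr_ge0//.
have m1 : measurable_fun setT (fst_incr w).
  apply: continuous_measurable_rV; exact: continuous_enorm_increment.
have m2 : measurable_fun setT (snd_incr w v).
  apply: continuous_measurable_rV; exact: continuous_diff_increment.
have mxi : measurable_fun setT (xi w v).
  by apply/measurable_EFinP; exact: measurable_int ixi.
apply: (@le_trans _ _ (\int[gauss]_u
   ((2 * beta ^+ 2 * qform (G i) v)%:E * (fst_incr w u)%:E +
    (2 * ell ^+ 2)%:E * (snd_incr w v u)%:E))%E).
  apply: ge0_le_integral => //.
  - by move=> u _; rewrite lee_fin sqr_ge0.
  - by apply/measurable_EFinP; exact: measurable_funX.
  - apply: emeasurable_funD; apply: emeasurable_funM => //; exact/measurable_EFinP.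
  - by move=> u _; rewrite -!EFinM -EFinD lee_fin; exact: sqr_xi_le.
rewrite ge0_integralD//; first last.
- by apply: emeasurable_funM => //; exact/measurable_EFinP.
- by move=> u _; rewrite mule_ge0// lee_fin// sqr_ge0.
- by apply: emeasurable_funM => //; exact/measurable_EFinP.
- by move=> u _; rewrite mule_ge0// lee_fin// sqr_ge0.
rewrite !ge0_integralZl//; first last.
- by move=> u _; rewrite lee_fin sqr_ge0.
- exact/measurable_EFinP.
- by move=> u _; rewrite lee_fin sqr_ge0.
- exact/measurable_EFinP.
apply: (@le_trans _ _ ((2 * beta ^+ 2 * qform (G i) v)%:E *
    (sigma ^+ 2 * fine (jac_sup h sigma Theta x))%:E +
    (2 * ell ^+ 2)%:E * (sigma ^+ 2 * qform (B i) v)%:E)%E).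
  apply: leeD; rewrite lee_wpmul2l ?lee_fin//.
    exact: integral_fst_incr_le.
  exact: integral_snd_incr_le.
rewrite -!EFinM -EFinD lee_fin le_eqVlt; apply/orP; left; apply/eqP; ring.
Qed.

(** Mean value theorem on the segment from w' to w, which stays in the ball by convexity. The
    derivative bound depends on the direction only, so the unknown intermediate point disappears. *)
Lemma sqr_loss_gap_le r w w' : Theta = eball r -> Theta w -> Theta w' ->
  (gap_at w - gap_at w') ^+ 2 <= 2 * sigma ^+ 2 *
    (beta ^+ 2 * fine (jac_sup h sigma Theta x) * qform (G i) (w - w') +
     ell ^+ 2 * qform (B i) (w - w')).
Proof.
move=> TE Tw Tw'.
have seg (t : R) : 0 <= t <= 1 -> Theta (w' + t *: (w - w')).
  by move=> t01; rewrite TE; apply: eball_segment; rewrite -?TE.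
have dline (t : R) : 0 <= t <= 1 -> is_derive t (1 : R) (fun s => gap_at (w' + s *: (w - w')))
    ('d gap_at (w' + t *: (w - w')) (w - w')).
  by move=> t01; apply: is_derive_line; apply: differentiable_loss_gap; exact: seg.
have [||c] := @MVT_segment R (fun s => gap_at (w' + s *: (w - w')))
  (fun t => 'd gap_at (w' + t *: (w - w')) (w - w')) 0 1 ler01.
- by move=> t; rewrite in_itv/= => /andP[t0 t1]; apply: dline; rewrite !ltW.
- apply: derivable_within_continuous => t; rewrite in_itv/= => t01.
  by have := dline t t01 => ?; exact: ex_derive.
rewrite in_itv/= => c01; rewrite scale1r scale0r addr0 subr0 mulr1 subrKC => ->.
exact/sqr_diff_loss_gap_le/seg.
Qed.

End jensen_gap_gradient.

(** * Uniform deviation of the Jensen gap *)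

Lemma jensen_gap_gaussian (R : realType) m (w : 'rV[R]_m) s (f : 'rV[R]_m -> R) :
  measurable_fun setT f ->
  jensen_gap (gaussian w s) f = f w - \int[std_gaussian R m]_u f (w + s *: u).
Proof.
move=> mf; rewrite /jensen_gap mean_gaussian /Rintegral integral_gaussian//.
exact/measurable_EFinP.
Qed.

Lemma cvg_Rintegral d (T : measurableType d) (R : realType) (D : probability T R)
    (g : nat -> T -> R) (f : T -> R) (e : R) :
  (forall k, measurable_fun setT (g k)) -> measurable_fun setT f ->
  (forall k z, `|g k z| <= e) -> (forall z, g ^~ z @ \oo --> f z) ->
  (fun k => \int[D]_z g k z) @ \oo --> \int[D]_z f z.
Proof.
move=> mg mf ge gf.
have ie : D.-integrable setT (fun=> e%:E) by exact: finite_measure_integrable_cst.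
have h := dominated_cvg measurableT (mu := D) (f_ := fun k z => (g k z)%:E)
  (f := EFin \o f) (g := fun=> e%:E).
have fE : D.-integrable setT (EFin \o f).
  apply: bmeas_integrable; split => //; exists e => z.
  have cn : (fun k => `|g k z|) @ \oo --> `|f z| by exact: cvg_norm (gf z).
  rewrite -(cvg_lim (@Rhausdorff R) cn).
  apply: limr_le; first by apply/cvg_ex; exists `|f z|.
  by apply: nearW => k; exact: ge.
apply: fine_cvg; rewrite fineK; last exact: integrable_fin_num.
apply: h => //.
- by move=> k; exact/measurable_EFinP.
- by move=> z _; apply: cvg_EFin; [exact: nearW|exact: gf].
- by move=> k z _; rewrite lee_fin.
Qed.

(** Dominated convergence passes from the sequence to its limits, so a supremum over countably many
    parameters controls every parameter of the ball. *)
Lemma le_dev_cvg d (T : measurableType d) (R : realType) (D : probability T R)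
    (g : nat -> T -> R) (f : T -> R) (s : nat -> nat) n (S : n.-tuple T) :
  umeas g -> measurable_fun setT f -> (forall z, (fun k => g (s k) z) @ \oo --> f z) ->
  \sum_(z <- S) (\int[D]_z' f z' - f z) <= dev D g (fun=> 0) S.
Proof.
move=> ug mf gf; have [mg [e ge]] := ug.
have ci : (fun k => \int[D]_z g (s k) z) @ \oo --> \int[D]_z f z.
  exact: (@cvg_Rintegral _ _ _ D (fun k => g (s k)) f e).
pose G k := \sum_(z <- S) (\int[D]_z' g (s k) z' - g (s k) z).
have cG : G @ \oo --> \sum_(z <- S) (\int[D]_z' f z' - f z).
  rewrite /G; elim: (tval S) => [|z l IH].
    by under eq_fun do rewrite big_nil; rewrite big_nil; exact: cvg_cst.
  under eq_fun do rewrite big_cons; rewrite big_cons.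
  by apply: cvgD IH; apply: cvgB; [exact: ci|exact: gf].
rewrite -(cvg_lim (@Rhausdorff R) cG).
apply: limr_le; first by apply/cvg_ex; exists (\sum_(z <- S) (\int[D]_z' f z' - f z)).
apply: nearW => k.
have b := umeas_bdd S (umeas_dev D ug n (bdd0 R)).
by have := le_sup_range (s k) b; rewrite add0r.
Qed.

(** * Empirical Rademacher average of the Jensen gap *)

Section complexity.
Context dX dY (X : measurableType dX) (Y : measurableType dY) (R : realType).
Variables (m C n : nat) (L : 'rV[R]_C -> Y -> R) (h : 'rV[R]_m -> X -> 'rV[R]_C).
Variables (ell beta sigma Rad e : R) (S : n.-tuple (X * Y)).
Variables (G B : 'I_n -> 'M[R]_m) (q : nat -> 'rV[R]_m).
Hypothesis n0 : (0 < n)%N.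
Hypothesis sigma0 : 0 < sigma.
Hypothesis lipL : forall y, lipschitz_fun ell (L^~ y).
Hypothesis smoothL : forall y, smooth_fun beta (L^~ y).
Hypothesis rg : Reg L h sigma (eball Rad) S G B.
Hypothesis qT : forall k, eball Rad (q k).
Hypothesis gape : forall k z, `|loss_gap L h sigma z (q k)| <= e.

Local Notation A i := (fine (jac_sup h sigma (eball Rad) (tnth S i).1)).

Let A_ge0 i : 0 <= A i.
Proof.
apply: fine_ge0; apply: (@le_trans _ _
  (\int[lebesgue_measure]_(t in `[0%R, 1%R]) \int[std_gaussian R m]_u
    (jac_form h (tnth S i).1 (q 0 + (t * sigma) *: u) u)%:E)%E).
  apply: integral_ge0 => t _; apply: integral_ge0 => u _.
  by rewrite lee_fin jac_formE sqr_ge0.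
by apply: ereal_sup_ubound; exists (q 0).
Qed.

(* 32 = 4 * 2^2 * 2: the 4 is required by [contraction], the functions are 2/n times
   the gap, and the last 2 comes from [sqr_loss_gap_le]. *)
Let M i : 'M[R]_m :=
  (32 * sigma ^+ 2 / n%:R ^+ 2) *: ((beta ^+ 2 * A i) *: G i + ell ^+ 2 *: B i).

Let psdM i : psd (M i).
Proof.
apply: psdZ.
  by apply: divr_ge0; [apply: mulr_ge0 => //; exact: sqr_ge0|exact: sqr_ge0].
apply: psdD; apply: psdZ.
- exact: mulr_ge0 (sqr_ge0 _) (A_ge0 i).
- exact: (reg_G_psd rg i).
- exact: sqr_ge0.
- exact: (reg_B_psd rg i).
Qed.

Let n0R : n%:R != 0 :> R. Proof. by rewrite pnatr_eq0 -lt0n. Qed.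

(** After contraction, the vectors from the decompositions of all the [M i] form a single linear
    class, bounded by [rad_linear] with zero offset. One factor 1/n remains under the root because
    [J_S] and [H_S] are averages. *)
Lemma rads_loss_gap_le :
  rads (fun k z => n%:R^-1 * loss_gap L h sigma z (q k)) (fun=> 0) S <=
  2 * 3 * (Rad * sigma / Num.sqrt n%:R)
    * Num.sqrt (beta ^+ 2 * J_S h sigma (eball Rad) S G + ell ^+ 2 * H_S B).
Proof.
have [us usP] := choice (fun i => psd_sum_squares (psdM i)).
pose g (i : 'I_n) k := 2 * (n%:R^-1 * loss_gap L h sigma (tnth S i) (q k)).
pose vs (i : 'I_n) := [seq (fun k => dot (q k) u) | u <- us i].
have Rad0 : 0 <= Rad by apply: le_trans (enorm_ge0 (q 0)) (qT 0).
have -> : rads (fun k z => n%:R^-1 * loss_gap L h sigma z (q k)) (fun=> 0) S =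
    rad ([seq g i | i <- enum 'I_n] ++ [::]) (fun=> 0).
  by rewrite /rads cats0 -[in LHS](map_tnth_enum S) -map_comp.
apply: (@le_trans _ _ (rad (flatten [seq vs i | i <- enum 'I_n] ++ [::]) (fun=> 0))).
  apply: contraction => //.
  - move=> i; rewrite /vs; elim: (us i) => //= u l IH; split=> //.
    exact: (bdd_linear u qT).
  - exact: bdd0.
  - move=> i; exists (2 * (n%:R^-1 * e)) => k; rewrite /g normrM ger0_norm// ler_wpM2l//.
    by rewrite normrM ger0_norm ?invr_ge0// ler_wpM2l ?invr_ge0.
  move=> i j k.
  have -> : sumsq (deltas (vs i) j k) = qform (M i) (q j - q k).
    rewrite (usP i).1 /sumsq /deltas /vs !big_map; apply: eq_bigr => u _.
    by rewrite [dot (q j - _) _]dotC dotDr dotNr ![dot u _]dotC.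
  rewrite /M qformZ qformD !qformZ /g.
  have hg := sqr_loss_gap_le lipL smoothL rg i (erefl _) (qT j) (qT k).
  rewrite -mulrBr -mulrBr !exprMn.
  have c0 : 0 <= 2 ^+ 2 * n%:R^-1 ^+ 2 :> R by rewrite mulr_ge0 ?sqr_ge0.
  rewrite mulrA; apply: (le_trans (ler_wpM2l c0 hg)).
  by rewrite le_eqVlt; apply/orP; left; apply/eqP; field.
rewrite cats0.
have -> : flatten [seq vs i | i <- enum 'I_n] =
    [seq (fun k => dot (q k) u) | u <- flatten [seq us i | i <- enum 'I_n]].
  by rewrite map_flatten -map_comp.
have -> : (fun=> 0) = (fun k : nat => dot (q k) 0).
  by apply/funext => k; rewrite /dot big1// => j _; rewrite mxE mulr0.
apply: (le_trans (rad_linear _ _ qT)).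
rewrite sqr_enorm [X in X + _]big1 ?add0r; last by move=> j _; rewrite mxE expr0n.
have -> : \sum_(u <- flatten [seq us i | i <- enum 'I_n]) enorm u ^+ 2 =
    (32 * sigma ^+ 2 / n%:R) *
      (beta ^+ 2 * J_S h sigma (eball Rad) S G + ell ^+ 2 * H_S B).
  rewrite big_flatten big_map big_enum/= (eq_bigr (fun i => \tr (M i))); last first.
    by move=> i _; rewrite (usP i).2.
  rewrite /J_S /H_S mulrDr ![_ * (n%:R^-1 * _)]mulrCA !mulrA.
  rewrite !mulr_sumr -big_split/=; apply: eq_bigr => i _.
  by rewrite /M mxtraceZ mxtraceD !mxtraceZ; field.
rewrite sqrtrM; last by rewrite divr_ge0// mulr_ge0 ?sqr_ge0.
rewrite [Rad * (_ * _)]mulrA ler_wpM2r ?sqrtr_ge0//.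
have -> : 2 * 3 * (Rad * sigma / Num.sqrt n%:R) = Rad * (6 * sigma / Num.sqrt n%:R).
  by field; rewrite sqrtr_eq0 -ltNge ltr0n.
rewrite ler_wpM2l//.
(* What remains is sqrt 32 <= 6, proved as 32 <= 6^2; this rounding fixes the constant 3 of the
   theorem. *)
have p0 : 0 <= 6 * sigma / Num.sqrt n%:R by rewrite divr_ge0 ?sqrtr_ge0// mulr_ge0// ltW.
rewrite -[leRHS]ger0_norm// -sqrtr_sqr ler_wsqrtr// exprMn exprVn sqr_sqrtr//.
rewrite ler_wpM2r ?invr_ge0// exprMn ler_wpM2r ?sqr_ge0//; lra.
Qed.

End complexity.

Lemma KL_neqNy d (T : measurableType d) (R : realType) (Q P : probability T R) :
  KL Q P != -oo%E.
Proof.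
have [QP|NQP] := pselect (Q `<< P); last by rewrite /KL; case: asboolP.
by have [->|[K -> _]] := donsker_varadhan QP.
Qed.

Lemma probability_setI_ge d (T : measurableType d) (R : realType)
    (P : probability T R) (A B : set T) (x y : R) :
  measurable A -> measurable B -> ((1 - x)%:E <= P A)%E -> ((1 - y)%:E <= P B)%E ->
  ((1 - (x + y))%:E <= P (A `&` B))%E.
Proof.
move=> mA mB PA PB.
have : (P (~` (A `&` B)) <= P (~` A) + P (~` B))%E.
  by rewrite setCI; apply: measureU2; exact: measurableC.
rewrite !probability_setC//; last exact: measurableI.
have fin (E : set T) : measurable E -> exists r, P E = r%:E.
  by move=> mE; exists (fine (P E)); rewrite fineK// fin_num_measure.
have [a Ea] := fin A mA; have [b Eb] := fin B mB.
have [c Ec] := fin _ (measurableI _ _ mA mB).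
move: PA PB; rewrite Ea Eb Ec !lee_fin => ? ? h.
have : ((1 - c)%:E <= (1 - a + (1 - b))%:E)%E by exact: h.
rewrite lee_fin; lra.
Qed.

(** Write l = ln (8 / delta). The left exponent is 36/8 n tau^2 = 9 l, while on the right 8 n tau^2
    = 16 l and delta / 2 >= delta / 8 = exp (- l). Hence 9 <= 15 suffices; the threshold 8 b tau is
    the deviation term of the theorem. *)
Lemma deviation_exponent (R : realType) (n : nat) (b delta tau : R) :
  (0 < n)%N -> 0 < b -> 0 < delta <= 1 ->
  n%:R * tau ^+ 2 = 2 * ln (8 / delta) ->
  expR (n%:R * ((n%:R * tau / b) ^+ 2 * (6 * (b / n%:R)) ^+ 2 / 8)) <=
  expR (n%:R * tau / b * (8 * b * tau)) * (delta / 2).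
Proof.
move=> n0 b0 /andP[d0 d1] tau2.
have n0R : n%:R != 0 :> R by rewrite pnatr_eq0 -lt0n.
have b0R : b != 0 by rewrite gt_eqF.
have e8 : 8 <= 8 / delta by rewrite ler_pdivlMr//; lra.
set l := ln (8 / delta) in tau2 *.
have l0 : 0 <= l by rewrite /l ln_ge0//; lra.
have dE : delta / 8 = expR (- l).
  by rewrite expRN /l lnK ?posrE ?divr_gt0// invf_div.
have -> : n%:R * ((n%:R * tau / b) ^+ 2 * (6 * (b / n%:R)) ^+ 2 / 8) =
    9 / 2 * (n%:R * tau ^+ 2) by field; rewrite n0R b0R.
have -> : n%:R * tau / b * (8 * b * tau) = 8 * (n%:R * tau ^+ 2) by field.
rewrite tau2 (@le_trans _ _ (expR (8 * (2 * l)) * (delta / 8)))//.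
  by rewrite dE -expRD ler_expR; lra.
by rewrite ler_wpM2l ?expR_ge0//; lra.
Qed.

(** * Fubini under an integrable envelope *)

Section dominated_fubini.
Context d dW (T : measurableType d) (W : measurableType dW) (R : realType).
Variables (D : probability T R) (Q : probability W R).
Variables (f : W -> T -> R) (b : W -> R).
Hypothesis mf : measurable_fun setT (fun p : W * T => f p.1 p.2).
Hypothesis mb : measurable_fun setT b.
Hypothesis fb : forall v z, `|f v z| <= b v.
Hypothesis ib : Q.-integrable setT (EFin \o b).

Let bf v : bmeas (f v).
Proof. by split; [exact: measurable_fun_pair2 mf|exists (b v)]. Qed.

Lemma dominated_integrable_at z : Q.-integrable setT (EFin \o (f ^~ z)).
Proof.
apply: (le_integrable measurableT _ _ ib).
  by apply/measurable_EFinP; exact: measurable_fun_pair1 mf.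
by move=> v _ /=; rewrite lee_fin (le_trans (fb v z))// ler_norm.
Qed.

Lemma dominated_integrable_mean : Q.-integrable setT (EFin \o (fun v => \int[D]_z f v z)).
Proof.
apply: (le_integrable measurableT _ _ ib).
  by apply/measurable_EFinP; exact: (measurable_Rintegral2 D mf).
move=> v _ /=; rewrite lee_fin (le_trans (Rint_bound D (bf v) (fb v)))//.
exact: ler_norm.
Qed.

Lemma dominated_fubini :
  \int[D]_z \int[Q]_v f v z = \int[Q]_v \int[D]_z f v z.
Proof.
have iF : (Q \x D)%E.-integrable setT (fun p : W * T => (f p.1 p.2)%:E).
  apply/integrable12ltyP; first exact/measurable_EFinP.
  have [_] := integrableP _ _ _ ib; apply: le_lt_trans.
  apply: ge0_le_integral => //.
  - by move=> v _; exact: integral_ge0.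
  - apply: (measurable_fun_fubini_tonelli_F (m2 := D) (fun p : W * T => `|(f p.1 p.2)%:E|%E)) => //.
    by apply: measurableT_comp => //; exact/measurable_EFinP.
  - by apply: measurableT_comp => //; exact/measurable_EFinP.
  move=> v _ /=; rewrite (@le_trans _ _ (\int[D]_z (b v)%:E)%E)//.
    apply: ge0_le_integral => //.
    - by apply/measurable_EFinP; apply: measurableT_comp => //; exact: (bf v).1.
    - by move=> z _; rewrite lee_fin.
  rewrite integral_cst// [X in (_ * X)%E]probability_setT mule1 lee_fin.
  exact: ler_norm.
have h12 := integral12_prod_meas1 iF.
have h21 := integral21_prod_meas1 iF.
transitivity (fine (\int[D]_z \int[Q]_v (f v z)%:E)%E).
  congr fine; apply: eq_integral => z _.
  by rewrite EFin_Rintegral//; exact: dominated_integrable_at.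
transitivity (fine (\int[Q]_v \int[D]_z (f v z)%:E)%E).
  by congr fine; rewrite [LHS]h21 -[LHS]h12.
congr fine; apply: eq_integral => v _.
by rewrite EFin_Rintegral//; exact: bmeas_integrable.
Qed.

End dominated_fubini.

Section jensen_gap_deviation.
Context dX dY (X : measurableType dX) (Y : measurableType dY) (R : realType).
Variables (m C n : nat) (L : 'rV[R]_C -> Y -> R) (ell beta : R).
Variables (D : probability (X * Y)%type R) (h : 'rV[R]_m -> X -> 'rV[R]_C).
Variables (Rad sigma : R) (G B : n.-tuple (X * Y) -> 'I_n -> 'M[R]_m) (Bjen delta : R).
Hypothesis n0 : (0 < n)%N.
Hypothesis mL : forall z, measurable_fun setT (L z).
Hypothesis lipL : forall y, lipschitz_fun ell (L^~ y).
Hypothesis smoothL : forall y, smooth_fun beta (L^~ y).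
Hypothesis mh : forall w, measurable_fun setT (h w).
Hypothesis sigma0 : 0 < sigma.
Hypothesis rg : forall S, Reg L h sigma (eball Rad) S (G S) (B S).
Hypothesis Bjen0 : 0 < Bjen.
Hypothesis jensen_le : forall x y w, eball Rad w ->
  `|jensen_gap (gaussian w sigma) (fun v => L (h v x) y)| <= sigma ^+ 2 * Bjen.
Hypothesis delta01 : 0 < delta <= 1.

Local Notation gap := (loss_gap L h sigma).
Local Notation loss := (loss_at L h).

(** [Reg] speaks about sample points only. A constant sample transfers it to an arbitrary x, and 0 <
    n supplies an index. *)
Let C2 x : twice_continuously_differentiable (h ^~ x).
Proof.
have := reg_C2 (rg [tuple of nseq n (x, point)]) (Ordinal n0).
by rewrite tnth_nseq.
Qed.

Let continuous_loss z : continuous (loss z).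
Proof.
move=> w; apply: (@continuous_comp _ _ _ (h ^~ z.1) (L ^~ z.2)).
  by apply: differentiable_continuous; exact: (C2 z.1).1.
by apply: differentiable_continuous; exact: (smoothL z.2).1.
Qed.

(** L is continuous in the prediction and measurable in the label, hence jointly measurable by the
    grid approximation, and can be composed with the measurable [h w]. *)
Lemma measurable_loss_param w : measurable_fun setT (fun z : X * Y => loss z w).
Proof.
have mLL : measurable_fun setT (fun p : 'rV[R]_C * Y => L p.1 p.2).
  apply: measurable_caratheodory => // y z.
  by apply: differentiable_continuous; exact: (smoothL y).1.
have mhw : measurable_fun setT (fun z : X * Y => h w z.1).
  by apply: (measurableT_comp (mh w)).
exact: (measurableT_comp mLL (measurable_fun_pair mhw measurable_snd)).
Qed.

Lemma measurable_loss : measurable_fun setT (fun p : 'rV[R]_m * (X * Y) => loss p.2 p.1).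
Proof.
apply: (measurable_caratheodory (f := fun w z => loss z w)).
  by move=> z; exact: continuous_loss.
exact: measurable_loss_param.
Qed.

Lemma measurable_smoothed_loss w :
  measurable_fun setT (fun z : X * Y => smoothed_loss_at L h sigma z w).
Proof.
apply: (measurable_Rintegral2 (std_gaussian R m)
  (f := fun p : (X * Y) * 'rV[R]_m => loss p.1 (w + sigma *: p.2))).
have ms : measurable_fun setT (fun p : (X * Y) * 'rV[R]_m => w + sigma *: p.2).
  exact: (measurableT_comp (measurable_shift w sigma) measurable_snd).
exact: (measurableT_comp measurable_loss (measurable_fun_pair ms measurable_fst)).
Qed.

Lemma measurable_loss_gap w : measurable_fun setT (fun z : X * Y => gap z w).
Proof.
by apply: measurable_funB; [exact: measurable_loss_param|exact: measurable_smoothed_loss].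
Qed.

Lemma loss_gap_bound z w : eball Rad w -> `|gap z w| <= sigma ^+ 2 * Bjen.
Proof.
move=> Tw; have := jensen_le z.1 z.2 Tw.
rewrite jensen_gap_gaussian//; exact: (continuous_measurable_rV (@continuous_loss z)).
Qed.

Lemma smoothed_loss_gaussian z w :
  smoothed_loss_at L h sigma z w = \int[gaussian w sigma]_v loss z v.
Proof.
rewrite /smoothed_loss_at /Rintegral [in RHS]integral_gaussian//.
by apply/measurable_EFinP; exact: (continuous_measurable_rV (@continuous_loss z)).
Qed.

Let continuous_gap z w : eball Rad w -> {for w, continuous (gap z)}.
Proof.
move=> Tw; apply: differentiable_continuous.
have := differentiable_loss_gap smoothL (rg [tuple of nseq n z]) (Ordinal n0) Tw.
by rewrite tnth_nseq.
Qed.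

Lemma uniform_loss_gap_deviation : exists E : set (n.-tuple (X * Y)),
  [/\ measurable E, ((1 - delta / 2)%:E <= iid D n E)%E &
  forall S, E S -> forall w, eball Rad w ->
    \int[D]_z gap z w - n%:R^-1 * \sum_(i < n) gap (tnth S i) w <=
    2 * 3 * (Rad * sigma / Num.sqrt n%:R)
      * Num.sqrt (beta ^+ 2 * J_S h sigma (eball Rad) S (G S) + ell ^+ 2 * H_S (B S))
    + 8 * sigma ^+ 2 * Bjen * Num.sqrt (2 * ln (8 / delta) / n%:R)].
Proof.
have [d0 d1] := andP delta01.
(* A negative radius gives an empty ball, where no dense sequence exists and the claim is
   vacuous. *)
have [T0|T0] := pselect ((eball Rad : set 'rV[R]_m) !=set0); last first.
  exists setT; split=> [||S _ w Tw]; first exact: measurableT.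
    by rewrite probability_setT lee_fin gerBl divr_ge0// ltW.
  by case: T0; exists w.
have [q [qT qdense]] := exists_dense_seq T0.
pose b := sigma ^+ 2 * Bjen.
have b0 : 0 < b by rewrite mulr_gt0// exprn_gt0.
have n0R : n%:R != 0 :> R by rewrite pnatr_eq0 -lt0n.
(* With the factor 1/n inside, each summand is bounded by b / n; this is the e in the difference
   constant 6 e. *)
pose g k z := n%:R^-1 * gap z (q k).
have ge k z : `|g k z| <= b / n%:R.
  rewrite /g normrM ger0_norm ?invr_ge0// mulrC ler_wpM2r ?invr_ge0//.
  exact: loss_gap_bound.
have ug : umeas g.
  split; last by exists (b / n%:R).
  by move=> k; apply: measurable_funM => //; exact: measurable_loss_gap.
pose tau := Num.sqrt (2 * ln (8 / delta) / n%:R).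
have tau2 : n%:R * tau ^+ 2 = 2 * ln (8 / delta).
  have l0 : 0 <= ln (8 / delta) by rewrite ln_ge0// ler_pdivlMr//; lra.
  by rewrite /tau sqr_sqrtr ?divr_ge0 ?mulr_ge0//; field.
have s0 : 0 <= n%:R * tau / b by rewrite divr_ge0 ?mulr_ge0 ?sqrtr_ge0// ltW.
have [E [mE PE Edev]] := uniform_deviation D ug ge (n := n) (t := 8 * b * tau)
  (delta := delta / 2) s0 (deviation_exponent n0 b0 delta01 tau2).
exists E; split => // S ES w Tw.
have [s qs] := qdense w Tw.
have mw : measurable_fun setT (fun z => n%:R^-1 * gap z w).
  by apply: measurable_funM => //; exact: measurable_loss_gap.
have bw : bmeas (fun z => gap z w).
  split; first exact: measurable_loss_gap.
  by exists b => z; exact: loss_gap_bound.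
have cg z : (fun k => g (s k) z) @ \oo --> n%:R^-1 * gap z w.
  apply: cvgM; first exact: cvg_cst.
  apply: (@cvg_comp _ _ _ (q \o s) (gap z) _ (nbhs w)); first exact: qs.
  exact: continuous_gap Tw.
have := le_dev_cvg D S ug mw cg; have := Edev S ES.
have -> : \sum_(z <- S) (\int[D]_z' (n%:R^-1 * gap z' w) - n%:R^-1 * gap z w) =
    \int[D]_z gap z w - n%:R^-1 * \sum_(i < n) gap (tnth S i) w.
  rewrite RintZ// big_tuple sumrB sumr_const card_ord -[_ *+ n]mulr_natl mulVKf//.
  by rewrite mulr_sumr.
have hr := rads_loss_gap_le n0 sigma0 lipL smoothL (rg S) qT
  (fun k z => loss_gap_bound z (qT k)).
move: hr; rewrite -/g /b /tau; lra.
Qed.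

End jensen_gap_deviation.

Theorem theorem3p7 (R : realType) :
  exists c : R, 0 < c /\
  forall (dX dY : measure_display) (X : measurableType dX)
    (Y : measurableType dY) (m C n : nat)
    (L : 'rV[R]_C -> Y -> R) (ell beta : R)
    (D : probability (X * Y)%type R)
    (h : 'rV[R]_m -> X -> 'rV[R]_C) (a : 'rV[R]_m -> R)
    (Rad sigma : R)
    (G B : n.-tuple (X * Y) -> 'I_n -> 'M[R]_m) (Bjen : R)
    (P : probability 'rV[R]_m R) (delta lambda : R),
  (0 < n)%N ->
  (forall z, measurable_fun setT (L z)) ->
  (forall y, lipschitz_fun ell (L^~ y)) ->
  (forall y, smooth_fun beta (L^~ y)) ->
  (forall y y', L 0 y = L 0 y') ->
  (forall w, measurable_fun setT (h w)) ->
  measurable_fun setT a ->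
  (forall w, 0 < a w) ->
  (forall w x, enorm (h w x) <= a w) ->
  0 < sigma ->
  (forall S, Reg L h sigma (eball Rad) S (G S) (B S)) ->
  0 < Bjen ->
  (forall x y w, eball Rad w ->
    `|jensen_gap (gaussian w sigma) (fun v => L (h v x) y)|
      <= sigma ^+ 2 * Bjen) ->
  0 < delta <= 1 ->
  0 < lambda ->
  exists E : set (n.-tuple (X * Y)),
    [/\ measurable E, ((1 - delta)%:E <= iid D n E)%E &
    forall S, E S -> forall w, eball Rad w ->
      ((risk L h D w)%:E <=
       (emp_risk L h S w
        + 2 * c * (Rad * sigma / Num.sqrt n%:R)
          * Num.sqrt (beta ^+ 2 * J_S h sigma (eball Rad) S (G S)
                      + ell ^+ 2 * H_S (B S))
        + 8 * sigma ^+ 2 * Bjen * Num.sqrt (2 * ln (8 / delta) / n%:R))%:E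
       + lambda^-1%:E *
         (KL (gaussian w sigma) P
          + lne ((2 / delta)%:E *
              \int[P]_v (expR (lambda ^+ 2 * ell ^+ 2 * a v ^+ 2
                               / (2 * n%:R)))%:E)))%E].
Proof.
exists 3; split=> // dX dY X Y m C n L ell beta D h a Rad sigma G B Bjen P delta lambda.
move=> n0 mL lipL smoothL L0 mh ma a0 ha sigma0 rg Bjen0 jensen_le delta01 lambda0.
have [d0 d1] := andP delta01.
pose loss v z := loss_at L h z v : R.
(* The common value of L(0, y) is the center of the loss: the Lipschitz bound puts every loss within
   |ell| a_w of it. *)
pose l0 := L 0 point.
pose b v := `|ell| * a v.
have mloss : measurable_fun setT (fun p : 'rV[R]_m * (X * Y) => loss p.1 p.2).
  exact: measurable_loss n0 mL smoothL mh rg.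
have mb : measurable_fun setT b by exact: measurable_funM.
have lossb v z : `|loss v z - l0| <= b v.
  rewrite /loss /loss_at /l0 (L0 point z.2) (le_trans (lipL _ _ _))// subr0.
  rewrite (le_trans (ler_wpM2r (enorm_ge0 _) (ler_norm ell)))//.
  by rewrite ler_wpM2l.
have [E1 [mE1 PE1 E1dev]] := uniform_loss_gap_deviation D n0 mL lipL smoothL mh
  sigma0 rg Bjen0 jensen_le delta01.
have [E2 [mE2 PE2 E2pac]] := pac_bayes D P n0 mloss mb lossb d0 lambda0.
exists (E1 `&` E2); split; first exact: measurableI.
  rewrite [delta in 1 - delta](splitr delta).
  exact: probability_setI_ge mE1 mE2 PE1 PE2.
move=> S [E1S E2S] w Tw.
have KNy := KL_neqNy (gaussian w sigma) P.
have ZE : (\int[P]_v (expR (log_mgf n b lambda v))%:E =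
    \int[P]_v (expR (lambda ^+ 2 * ell ^+ 2 * a v ^+ 2 / (2 * n%:R)))%:E)%E.
  apply: eq_integral => v _; rewrite /log_mgf /b exprMn real_normK ?num_real//.
  by rewrite mulrA.
rewrite -ZE; set Z0 := (\int[P]_v _)%E.
have Z0ge : (1 <= Z0)%E.
  rewrite -[leLHS](@probability_setT _ _ _ P) -[leLHS]mul1e -integral_cst//.
  apply: ge0_le_integral => //.
    apply/measurable_EFinP/measurableT_comp => //; rewrite /log_mgf.
    apply: measurable_funM => //; apply: measurable_funM => //.
    exact: measurable_funX.
  move=> v _; rewrite lee_fin -expR0 ler_expR /log_mgf.
  by rewrite divr_ge0// mulr_ge0// ?sqr_ge0.
have li0 : (0 < (lambda^-1)%:E)%E by rewrite lte_fin invr_gt0.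
have d2 : 0 < 2 / delta by rewrite divr_gt0.
(* If the divergence or the prior moment is infinite, the right side is +oo. The bound 1 <= [Z0] and
   [KNy] rule out the undetermined sum of +oo and -oo. *)
have := E2pac S E2S (gaussian w sigma); rewrite -/Z0 => -[KLy|Zy|].
- rewrite KLy addye; last first.
    have : (0 < (2 / delta)%:E * Z0)%E by rewrite mule_gt0// (lt_le_trans _ Z0ge).
    case: (_ * Z0)%E => //= r; rewrite lte_fin => r0.
    by rewrite leNgt r0.
  by rewrite gt0_muley// addey// leey//.
- rewrite Zy gt0_muley// /lne addey// gt0_muley// addey// leey//.
move=> [K [z0 [-> -> z00 ib hpac]]].
have -> : lne ((2 / delta)%:E * z0%:E) = (ln (2 / delta * z0))%:E.
  by rewrite -EFinM lne_EFin// mulr_gt0.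
have -> : (lambda^-1%:E * (K%:E + (ln (2 / delta * z0))%:E) =
  (lambda^-1 * (K + ln (2 / delta * z0)))%:E)%E by [].
rewrite -EFinD lee_fin.
have := E1dev S E1S w Tw; move: hpac.
set Q := gaussian w sigma.
(* The PAC-Bayes step bounds the centered loss; adding |l0| gives an integrable envelope of the loss
   itself, as Fubini requires. *)
have ib' : Q.-integrable setT (EFin \o (fun v => `|l0| + b v)).
  have i1 : Q.-integrable setT (EFin \o (fun=> `|l0|)).
    exact: finite_measure_integrable_cst.
  exact: (integrableD measurableT i1 ib).
have mb' : measurable_fun setT (fun v => `|l0| + b v) by exact: measurable_funD.
have lossb' v z : `|loss v z| <= `|l0| + b v.
  rewrite -(subrK l0 (loss v z)) addrC (le_trans (ler_normD _ _))// lerD2l.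
  exact: lossb.
have fub := dominated_fubini D mloss mb' lossb' ib'.
have imean := dominated_integrable_mean D mloss lossb' ib'.
have iz z := dominated_integrable_at mloss lossb' ib' z.
have sE z : smoothed_loss_at L h sigma z w = \int[Q]_v loss v z.
  exact: (smoothed_loss_gaussian n0 smoothL rg).
have bloss : bmeas (fun z => loss_at L h z w).
  split; first exact: measurable_fun_pair2 mloss.
  by exists (`|l0| + b w) => z; exact: lossb'.
have bgap : bmeas (fun z => loss_gap L h sigma z w).
  split; first exact: (measurable_loss_gap n0 mL smoothL mh rg).
  by exists (sigma ^+ 2 * Bjen) => z; exact: (loss_gap_bound n0 smoothL rg jensen_le).
have gE : \int[D]_z loss_gap L h sigma z w =
    risk L h D w - \int[Q]_v mean_loss D loss v.
  rewrite /mean_loss -fub /risk -/(loss_at L h _ w).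
  have -> : \int[D]_z \int[Q]_v loss v z = \int[D]_z (loss_at L h z w - loss_gap L h sigma z w).
    by apply: eq_Rintegral => z _; rewrite /loss_gap subKr sE.
  by rewrite RintB// subKr.
have isum : Q.-integrable setT (EFin \o (fun v => \sum_(i < n) loss v (tnth S i))).
  rewrite (_ : _ \o _ = fun v => (\sum_(i < n) (loss v (tnth S i))%:E)%E).
    by apply: integrable_sum => // i _; exact: iz.
  by apply/funext => v /=; rewrite sumEFin.
have isam : Q.-integrable setT (EFin \o (sample_loss loss S)).
  exact: (integrableZl measurableT n%:R^-1 isum).
have samE : \int[Q]_v sample_loss loss S v =
    n%:R^-1 * \sum_(i < n) smoothed_loss_at L h sigma (tnth S i) w.
  rewrite /sample_loss RintegralZl//; congr (_ * _); apply: EFin_inj.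
  rewrite EFin_Rintegral//; under eq_integral do rewrite -sumEFin.
  rewrite integral_sum//; last by move=> i; exact: iz.
  by rewrite -sumEFin; apply: eq_bigr => i _; rewrite sE EFin_Rintegral.
have empE : n%:R^-1 * \sum_(i < n) loss_gap L h sigma (tnth S i) w =
    emp_risk L h S w - \int[Q]_v sample_loss loss S v.
  by rewrite samE /loss_gap sumrB mulrBr.
rewrite RintegralB// gE empE.
lra.
Qed.
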